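(* Let $RGT$ be any spectral triple obtained from $ZGT$ by leaving out exactly one of its summands (either the one associated with $\Delta_{0,1}$, or the one associated with one triangle $\nabla_{m,k}$). The metric $d_{RGT}$ induced by $RGT$ is equivalent to the geodesic distance $d_g$ on the gasket but does not coincide with it: there exist points $x\neq y$ in $SG$ such that $$d_{RGT}(x,y)\ge\frac32\,d_g(x,y).$$
   Context: Gasket. Let $\Delta_{0,1}$ be (the boundary curve of) an equilateral triangle in the plane of circumference $2\pi$ with one vertex pointing upwards. The Sierpinski gasket $SG$ is the intersection of the decreasing sequence of compact sets that starts with the solid triangle bounded by $\Delta_{0,1}$ and where at each step, from every remaining solid triangle, the open upside-down middle triangle (with vertices the edge midpoints) is removed. For $m\ge 1$, $\nabla_{m,k}$ $(1\le k\le 3^{m-1})$ are the boundary curves, of circumference $2\pi/2^m$, of the upside-down triangles removed at step $m$. The geodesic distance $d_g$ on $SG$ is the infimum of lengths of rectifiable curves in $SG$ joining two points. Two metrics $d,d'$ are equivalent if $c\,d\le d'\le C\,d$ for some constants $c,C>0$. Unbounded Fredholm modules. An unbounded Fredholm module over a unital C*-algebra $\mathcal{A}$ is a Hilbert space $H$ with a unital representation $\pi$ of $\mathcal{A}$ and an unbounded selfadjoint operator $D$ on $H$ with $(I+D^2)^{-1}$ compact and such that the set of $a\in \mathcal{A}$ for which $[D,\pi(a)]$ is densely defined and extends to a bounded operator is dense in $\mathcal{A}$. It is called a spectral triple if $\pi$ is faithful. For $\mathcal{A}=C(X)$ the induced metric is $d(x,y)=\sup\{|a(x)-a(y)| : a\in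 C(X),\ \|[D,\pi(a)]\|\le 1\}$. For a triangle $T\subset SG$ of circumference $2\pi r$, let $\rho:[-\pi r,\pi r]\to T$ be its closed counterclockwise arc-length parametrization. $UFM(T)$ is the module over $C(SG)$ with $H=L^2([-\pi r,\pi r],\tfrac{dx}{2\pi r})$, $\pi(a)\xi(x)=a(\rho(x))\xi(x)$, and $D$ the selfadjoint operator with $D e^{ilx/r}=\tfrac{1}{r}(l+\tfrac12)e^{ilx/r}$, $l\in\mathbb{Z}$ (i.e. $\tfrac1i\tfrac{d}{dx}+\tfrac1{2r}$ with periodic boundary conditions). $\overline{UFM(T)}$ is the same with the orientation of the parametrization reversed. $ZGT:=\overline{UFM(\Delta_{0,1})}\oplus\bigoplus_{m=1}^\infty\bigoplus_{k=1}^{3^{m-1}}UFM(\nabla_{m,k})$. *)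

(* Defs.v *)
(* MathComp-Analysis, over an arbitrary model R of the real numbers; the
   complex numbers are R[i] and the plane is R * R. *)
From HB Require Import structures.
From mathcomp Require Import all_boot all_order all_algebra.
From mathcomp Require Import complex.
From mathcomp Require Import all_classical all_reals all_analysis.

Set Implicit Arguments.
Unset Strict Implicit.
Unset Printing Implicit Defensive.

Import Order.TTheory GRing.Theory Num.Theory.
Import numFieldNormedType.Exports.

Local Open Scope classical_set_scope.
Local Open Scope ring_scope.

Section Plane.
Context {R : realType}.
Implicit Types (p q : R * R) (X : set (R * R)) (g : R -> R * R).

(* The norm that the library puts on R * R is the maximum norm. *)
Definition eucl_dist p q : R :=
  Num.sqrt ((p.1 - q.1) ^+ 2 + (p.2 - q.2) ^+ 2).

Definition midpoint p q : R * R := 2^-1 *: (p + q).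

(* A partition of [0, 1] is given by the list of its points other than 0. *)
Definition curve_length g : \bar R :=
  ereal_sup [set (\sum_(0 <= k < size s)
                   eucl_dist (g (nth 1 (0 :: s) k)) (g (nth 1 s k)))%:E
            | s in itv_partition 0 1].

Definition rectifiable_curve X (x y : R * R) g : Prop :=
  [/\ {within `[0, 1], continuous g},
      g 0 = x /\ g 1 = y,
      g @` `[0, 1] `<=` X &
      (curve_length g < +oo)%E].

Definition geodesic_dist X (x y : R * R) : \bar R :=
  ereal_inf [set curve_length g | g in rectifiable_curve X x y].

Definition equivalent_on X (d d' : R * R -> R * R -> \bar R) : Prop :=
  exists c C : R, [/\ 0 < c, 0 < C &
    forall x y, X x -> X y ->
      (c%:E * d x y <= d' x y)%E /\ (d' x y <= C%:E * d x y)%E].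

End Plane.

Section Triangles.
Context {R : realType}.

(* Vertices in counterclockwise order. *)
Record triangle := Triangle { va : R * R; vb : R * R; vc : R * R }.

Implicit Types T : triangle.

Definition solid T : set (R * R) :=
  [set p | exists s t u : R, [/\ [/\ 0 <= s, 0 <= t & 0 <= u], s + t + u = 1 &
    p = s *: va T + t *: vb T + u *: vc T]].

Definition open_solid T : set (R * R) :=
  [set p | exists s t u : R, [/\ [/\ 0 < s, 0 < t & 0 < u], s + t + u = 1 &
    p = s *: va T + t *: vb T + u *: vc T]].

Definition circumference T : R :=
  eucl_dist (va T) (vb T) + eucl_dist (vb T) (vc T) + eucl_dist (vc T) (va T).

Definition middle T : triangle :=
  Triangle (midpoint (va T) (vb T)) (midpoint (vb T) (vc T))
           (midpoint (vc T) (va T)).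

Definition corners T : seq triangle :=
  [:: Triangle (va T) (midpoint (va T) (vb T)) (midpoint (vc T) (va T));
      Triangle (midpoint (va T) (vb T)) (vb T) (midpoint (vb T) (vc T));
      Triangle (midpoint (vc T) (va T)) (midpoint (vb T) (vc T)) (vc T)].

(* Equilateral, of side 2 pi / 3, with the vertex vc on top. *)
Definition Delta01 : triangle :=
  Triangle (0, 0) (2 * pi / 3, 0) (pi / 3, pi / Num.sqrt 3).

(* The 3 ^ m solid triangles remaining after m steps. *)
Fixpoint remaining (m : nat) : seq triangle :=
  if m is m'.+1 then flatten [seq corners T | T <- remaining m']
  else [:: Delta01].

(* For k < 3 ^ m: the k-th triangle removed at step m + 1. Steps are counted
   from 1 in the mathematics, so this is nabla_{m+1,k+1}. *)
Definition nabla (m k : nat) : triangle := middle (nth Delta01 (remaining m) k).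

Fixpoint stage (m : nat) : set (R * R) :=
  if m is m'.+1 then
    stage m' `\` \bigcup_(k in `I_(3 ^ m')) open_solid (nabla m' k)
  else solid Delta01.

Definition SG : set (R * R) := \bigcap_(m in [set: nat]) stage m.

(* Point of the boundary of T reached from va T after running
   counterclockwise over the length t, for 0 <= t <= circumference T. *)
Definition boundary T (t : R) : R * R :=
  let l1 := eucl_dist (va T) (vb T) in
  let l2 := eucl_dist (vb T) (vc T) in
  let l3 := eucl_dist (vc T) (va T) in
  if t <= l1 then va T + (t / l1) *: (vb T - va T)
  else if t <= l1 + l2 then vb T + ((t - l1) / l2) *: (vc T - vb T)
  else vc T + ((t - l1 - l2) / l3) *: (va T - vc T).

(* T has circumference 2 pi (radius T). *)
Definition radius T : R := circumference T / (2 * pi).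

(* Closed counterclockwise arc-length parametrization of T by
   [- pi r, pi r], r = radius T, with base point boundary T s0,
   for 0 <= s0 < circumference T. *)
Definition param T (s0 x : R) : R * R :=
  let t := x + pi * radius T + s0 in
  boundary T (if t <= circumference T then t else t - circumference T).

End Triangles.
Arguments triangle : clear implicits.

(* Pointwise vector space structure on a product of vector spaces. *)
Definition dprod (K : pzRingType) (I : Type) (V : I -> lmodType K) : Type :=
  forall i, V i.

Section DProd.
Context (K : pzRingType) (I : Type) (V : I -> lmodType K).
Local Notation W := (dprod V).

HB.instance Definition _ := gen_eqMixin W.
HB.instance Definition _ := gen_choiceMixin W.

Let add (f g : W) : W := fun i => f i + g i.
Let opp (f : W) : W := fun i => - f i.
Let zero : W := fun i => 0.
Let scale (c : K) (f : W) : W := fun i => c *: f i.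

Fact dprod_addA : associative add.
Proof. by move=> f g h; apply: functional_extensionality_dep => i; exact: addrA. Qed.
Fact dprod_addC : commutative add.
Proof. by move=> f g; apply: functional_extensionality_dep => i; exact: addrC. Qed.
Fact dprod_add0 : left_id zero add.
Proof. by move=> f; apply: functional_extensionality_dep => i; exact: add0r. Qed.
Fact dprod_addN : left_inverse zero opp add.
Proof. by move=> f; apply: functional_extensionality_dep => i; exact: addNr. Qed.

HB.instance Definition _ :=
  GRing.isZmodule.Build W dprod_addA dprod_addC dprod_add0 dprod_addN.

Fact dprod_scaleA (a b : K) (f : W) : scale a (scale b f) = scale (a * b) f.
Proof. by apply: functional_extensionality_dep => i; exact: scalerA. Qed.
Fact dprod_scale1 : left_id 1 scale.
Proof. by move=> f; apply: functional_extensionality_dep => i; exact: scale1r. Qed.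
Fact dprod_scaleDr : right_distributive scale +%R.
Proof. by move=> a f g; apply: functional_extensionality_dep => i; exact: scalerDr. Qed.
Fact dprod_scaleDl (f : W) : {morph scale^~ f : a b / a + b}.
Proof. by move=> a b; apply: functional_extensionality_dep => i; exact: scalerDl. Qed.

HB.instance Definition _ := GRing.Zmodule_isLmodule.Build K W
  dprod_scaleA dprod_scale1 dprod_scaleDr dprod_scaleDl.

End DProd.

Section Modules.
Context {R : realType}.

(* The objects (H, pi, D) that make up an unbounded Fredholm module over C(X),
   for a set X in the plane. As usual for L^2 spaces, the elements of H are
   given by representatives: H is the set of the xi such that in_hilbert xi,
   two of which are identified when the squared norm of their difference is 0.
   The inner product is determined by the norm. An element of C(X) is given by
   a function on the plane of which only the values on X matter. D is given by
   its graph: dirac xi eta means that xi is in dom D and D xi = eta. *)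
Record fredholm_data := FredholmData {
  vec : lmodType R[i];
  in_hilbert : set vec;
  sqnorm : vec -> \bar R;
  rep : (R * R -> R[i]) -> vec -> vec;
  dirac : vec -> vec -> Prop }.

(* pi(a) maps dom D into itself, and on dom D the commutator [D, pi(a)] has
   norm at most 1, that is, [D, pi(a)] is defined on dom D and extends to a
   bounded operator of norm at most 1. Density in H of
   {xi in dom D | pi(a) xi in dom D} would be too weak a reading of "densely
   defined": on a circle the commutator with a Cantor function is zero on a
   dense subspace. *)
Definition commutator_le1 (M : fredholm_data) (a : R * R -> R[i]) : Prop :=
  forall xi eta : vec M, dirac xi eta ->
    exists zeta : vec M, dirac (rep a xi) zeta /\
      (sqnorm (zeta - rep a eta) <= sqnorm xi)%E.

Definition induced_dist (X : set (R * R)) (M : fredholm_data)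
    (x y : R * R) : \bar R :=
  ereal_sup [set (complex.Re `|a x - a y|)%:E
            | a in [set a : R * R -> R[i]^o |
                     {within X, continuous a} /\ commutator_le1 M a]].

Definition direct_sum (I : choiceType) (M : I -> fredholm_data) :
    fredholm_data :=
  let V := dprod (fun i => vec (M i)) : lmodType R[i] in
  let nrm (xi : V) := (\esum_(i in [set: I]) sqnorm (xi i))%E in
  let mem : set V :=
    [set xi | (forall i, in_hilbert (xi i)) /\ (nrm xi < +oo)%E] in
  @FredholmData V mem nrm
    (fun a xi => (fun i => rep a (xi i)) : V)
    (fun xi eta => [/\ mem xi, mem eta & forall i, dirac (xi i) (eta i)]).

Local Notation leb := (@lebesgue_measure R).

Definition cintegral (A : set R) (f : R -> R[i]) : R[i] :=
  ((\int[leb]_(x in A) complex.Re (f x)) +i*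
   (\int[leb]_(x in A) complex.Im (f x)))%C.

Definition circle_dom (r : R) : set R := `[- (pi * r), pi * r].

(* The squared norm of L^2([- pi r, pi r], dx / (2 pi r)). *)
Definition circle_sqnorm (r : R) (xi : R -> R[i]) : \bar R :=
  ((2 * pi * r)^-1%:E *
   \int[leb]_(x in circle_dom r) ((complex.Re `|xi x|) ^+ 2)%:E)%E.

Definition circle_L2 (r : R) : set (R -> R[i]) :=
  [set xi | [/\ measurable_fun (circle_dom r) (fun x => complex.Re (xi x)),
                measurable_fun (circle_dom r) (fun x => complex.Im (xi x)) &
                (circle_sqnorm r xi < +oo)%E]].

(* e^{i l x / r} *)
Definition circle_exp (r : R) (l : int) (x : R) : R[i] :=
  (cos (l%:~R * x / r) +i* sin (l%:~R * x / r))%C.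

Definition fourier_coef (r : R) (xi : R -> R[i]) (l : int) : R[i] :=
  ((2 * pi * r)^-1)%:C%C *
  cintegral (circle_dom r) (fun x => (circle_exp r l x)^*%C * xi x).

(* The module of a closed curve rho of length 2 pi r parametrized by arc length
   on [- pi r, pi r]. As the circle_exp r l form an orthonormal basis, the
   selfadjoint operator D with
     D (circle_exp r l) = (l + 1/2) / r * circle_exp r l
   acts by multiplying the l-th Fourier coefficient by (l + 1/2) / r, and its
   domain consists of all xi for which this gives an element of L^2. *)
Definition curve_module (r : R) (rho : R -> R * R) : fredholm_data :=
  @FredholmData (R -> R[i] : lmodType R[i]) (circle_L2 r) (circle_sqnorm r)
    (fun a xi x => a (rho x) * xi x)
    (fun xi eta => [/\ circle_L2 r xi, circle_L2 r eta &
      forall l : int, fourier_coef r eta l =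
        ((l%:~R + 2^-1) / r)%:C%C * fourier_coef r xi l]).

(* Base points of the parametrizations are arbitrary. *)
Definition UFM (T : triangle R) (s0 : R) : fredholm_data :=
  curve_module (radius T) (param T s0).

Definition UFM_rev (T : triangle R) (s0 : R) : fredholm_data :=
  curve_module (radius T) (fun x => param T s0 (- x)).

(* None stands for Delta01 and Some (existT _ m k) for nabla m k. *)
Definition summand_index : choiceType := option {m : nat & 'I_(3 ^ m)}.

Definition summand_triangle (i : summand_index) : triangle R :=
  if i is Some mk then nabla (tag mk) (tagged mk) else Delta01.

Definition summand (s : summand_index -> R) (i : summand_index) :
    fredholm_data :=
  if i is Some _ then UFM (summand_triangle i) (s i)
  else UFM_rev (summand_triangle i) (s i).

Definition ZGT (s : summand_index -> R) : fredholm_data :=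
  direct_sum (summand s).

Definition RGT (s : summand_index -> R) (i0 : summand_index) : fredholm_data :=
  direct_sum (fun i : {i : summand_index | i != i0} => summand s (val i)).

End Modules.
Arguments fredholm_data : clear implicits.

(* Main.v *)
Require Import Defs.
From HB Require Import structures.
From mathcomp Require Import all_boot all_order all_algebra.
From mathcomp Require Import complex ring lra zify.
From mathcomp Require Import all_classical all_reals all_analysis.
From mathcomp Require Import measurable_realfun.
Import Order.TTheory GRing.Theory Num.Theory.
Import numFieldNormedType.Exports.
Local Open Scope classical_set_scope.
Local Open Scope ring_scope.
Set Implicit Arguments.
Unset Strict Implicit.
Unset Printing Implicit Defensive.
(** Let r be the radius of a retained triangle. On its circle a continuous a
    satisfies ||[D, pi(a)]|| <= 1 only if its real and imaginary parts are
    1-Lipschitz in arc length, and a real a does as soon as it is 1-Lipschitz.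
    Both facts are obtained by averaging against the trigonometric polynomial
    (1 + cos ((t - x) / r)) ^ n, whose moments follow from a recursion, the
    second one together with Rademacher's theorem. So d_RGT is the supremum of
    |a x - a y| over the functions that are 1-Lipschitz on the retained edges,
    up to the passage from real to complex values.

    Equivalence goes through the Euclidean distance. Two points of the gasket
    lie in two cells with a common vertex whose sides are of the order of their
    distance. From a vertex of a cell, any point of it can be reached along edges
    of total length at most twice the side; when some edges are lost because a
    triangle is left out, a detour along retained edges still does this up to
    a factor. Conversely the coordinate functions are admissible.

    For the factor 3/2, let the side of a cell opposite to a vertex i lie on the
    triangle that is left out, and prescribe at the vertices values x_i, x_j,
    x_k with x_k - x_j = 3/2 side and x_i in between. Subdividing with weights 1/3
    and 2/3 on the two sides at i reproduces this situation in the children at j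
    and k, and gives a 1-Lipschitz situation in the child at i. Iterating gives
    a function on the vertices that is Lipschitz for the Euclidean distance and
    1-Lipschitz on all retained edges, hence an admissible function that
    increases by 3/2 side between two points at geodesic distance at most side. *)

(** * Rademacher's theorem on an interval *)

(** [dirac] is given by Fourier coefficients, so only trigonometric polynomials can be paired with
    it directly; everything about continuous or Lipschitz functions is a limit. The kernel
    [(1 + cos) ^ n] suits both directions: it is a trigonometric polynomial and, for even [n], the
    square of another one. Taking this square root as test vector, a commutator of norm at most 1
    bounds the derivative of the averaged function by exactly 1. Conversely the commutator with a
    Lipschitz [u] is multiplication by [- i u'], which needs [u'] only almost everywhere.

    The number 3/2 is a length: when a side of a cell is lost, its ends are still joined by the path
    end, midpoint, midpoint, end over the other two sides, made of three retained segments of half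
    the side. No function that is 1-Lipschitz on retained edges can increase by more, and one that
    does so grows by half the side on each segment; this forces the weights 1/3 and 2/3.

    Equivalence has one obstacle: without the outer triangle, the three outermost vertices start no
    retained side of the outermost cell. Chains of edges therefore begin one level down. *)

Section Lipschitz.
Context {R : realType}.
Local Notation leb := (@lebesgue_measure R).

(** Both sides are infima over countable covers by half-open intervals, and on such an interval the
    hypothesis compares the two lengths. For a null set [A] this is absolute continuity. *)
Lemma lebesgue_stieltjes_le (F : cumulative R R) (k : R) : 0 < k ->
  (forall x y, x <= y -> F y - F x <= k * (y - x)) ->
  forall A, (lebesgue_stieltjes_measure F A <= k%:E * leb A)%E.
Proof.
move=> k0 Fk A; rewrite -lee_pdivrMl//.
apply: le_ereal_inf_tmp => _ [B [mB AB] <-].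
rewrite lee_pdivrMl// -nneseriesZl; last by move=> n _; exact: wlength_ge0.
apply: (@le_trans _ _ (\sum_(0 <= n <oo) wlength F (B n))%E).
  by apply: ereal_inf_lbound; exists B.
apply: lee_nneseries => n _; first by move=> _; exact: wlength_ge0.
have /ocitvP[->|[[x y] /= xy ->]] := mB n.
  apply: (@le_trans _ _ 0%E).
    by rewrite le_eqVlt; apply/orP; left; apply/eqP; exact: wlength0.
  by apply: mule_ge0; [exact: ltW|exact: wlength_ge0].
rewrite [X in (_ <= _ * X)%E](_ : _ = (y - x)%:E); last first.
  by apply: wlength_itv_bnd; exact: ltW.
rewrite [X in (X <= _)%E](_ : _ = (F y - F x)%:E); last first.
  by apply: wlength_itv_bnd; exact: ltW.
by apply: Fk; exact: ltW.
Qed.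

(** A monotone function made from [f] has an absolutely continuous Stieltjes measure; the
    Radon-Nikodym density of that measure is the derivative almost everywhere, by Lebesgue's
    differentiation theorem. *)
Lemma lipschitz_ae_derivable (f : R -> R) (a b : R) : a < b ->
  {in `[a, b] &, forall x y, `|f x - f y| <= `|x - y|} ->
  exists g : R -> R, [/\ measurable_fun setT g, forall x, `|g x| <= 1 &
    {ae leb, forall x, x \in `]a, b[ -> is_derive x 1 f (g x)}].
Proof.
move=> ab fL.
pose c x := Num.max a (Num.min b x).
have cab x : c x \in `[a, b].
  by rewrite in_itv/= /c le_max lexx/= ge_max ge_min lexx/= andbT ltW.
have cid x : x \in `[a, b] -> c x = x.
  rewrite in_itv/= => /andP[ax xb].
  by rewrite /c (min_idPr xb) (max_idPr ax).
have cle x y : x <= y -> 0 <= c y - c x <= y - x.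
  move=> xy; rewrite /c !maxEle !minEle.
  by repeat case: ifP => /=; move=> *; apply/andP; split; lra.
(* The clamp [c] extends [f] beyond the interval; adding [2 * c] makes the sum nondecreasing, with
   slope at most 3. *)
pose F x := f (c x) + 2 * c x.
have FL x y : x <= y -> 0 <= F y - F x <= 3 * (y - x).
  move=> xy; have /andP[c0 c1] := cle _ _ xy.
  have := fL _ _ (cab y) (cab x); rewrite ler_norml (ger0_norm c0).
  by move=> /andP[f1 f2]; apply/andP; rewrite /F; split; lra.
have Fnd : nondecreasing F.
  by move=> x y /FL /andP[+ _]; rewrite subr_ge0.
have Fcont : continuous F.
  move=> x; apply/cvgrPdist_le => e e0; near=> y.
  have [xy|yx] := leP x y.
    have /andP[? ?] := FL _ _ xy.
    rewrite distrC ger0_norm//; apply: (@le_trans _ _ (3 * `|x - y|)).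
      by rewrite distrC ger0_norm// subr_ge0.
    rewrite mulrC -ler_pdivlMr//; near: y.
    by apply: cvgr_dist_le => //; rewrite divr_gt0.
  have /andP[? ?] := FL _ _ (ltW yx).
  rewrite ger0_norm//; apply: (@le_trans _ _ (3 * `|x - y|)).
    by rewrite ger0_norm// subr_ge0 ltW.
  rewrite mulrC -ler_pdivlMr//; near: y.
  by apply: cvgr_dist_le => //; rewrite divr_gt0.
pose FC := isCumulative.Build R _ R F Fnd (right_continuousW Fcont).
pose Fc : cumulative R R := HB.pack F FC.
pose nu0 := lebesgue_stieltjes_measure Fc.
have nuE x y : x <= y -> nu0 `]x, y]%classic = (F y - F x)%:E.
  move=> xy; rewrite -(@wlength_itv_bnd _ F _ _ false false xy).
  by apply: (measurable_mu_extE (wlength Fc)); exact: is_ocitv.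
have mD : measurable (`]a, b]%classic : set (measurableTypeR R)).
  exact: measurable_itv.
have Doo : (nu0 `]a, b]%classic < +oo)%E by rewrite nuE ?ltW// ltry.
pose nu := mfrestr mD Doo.
have nuleb : nu `<< leb.
  apply/null_content_dominatesP => A mA A0.
  apply/eqP; rewrite eq_le measure_ge0 andbT.
  rewrite /nu /mfrestr /mrestr.
  apply: (@le_trans _ _ (nu0 A)).
    by apply: le_measure; rewrite ?inE//; exact: measurableI.
  have := @lebesgue_stieltjes_le Fc 3 (ltr0n _ _) _ A.
  rewrite A0 mule0; apply.
  by move=> x y /FL /andP[].
have [h [h0 hfin hint hE]] := radon_nikodym_sigma_finite nuleb.
pose h' x := fine (h x).
have hh' : EFin \o h' = h by apply/funext => x /=; rewrite fineK.
have hint' A : measurable A -> leb.-integrable A (EFin \o h').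
  by move=> mA; rewrite hh'; apply: integrableS hint.
have mh' : measurable_fun setT h'.
  by apply/measurable_EFinP; exact: measurable_int (hint' _ measurableT).
have hloc : locally_integrable setT h'.
  by apply: open_integrable_locally => //; [exact: openT|exact: hint'].
have := @FTC1 R h' (BRight a) (fun y => hint' _ (measurable_itv _)) hloc.
pose H x := \int[leb]_(t in [set` `]a, x]]) h' t.
rewrite -/H => aeH.
have HE x : x \in `]a, b[ -> F x - F a = H x.
  rewrite in_itv/= => /andP[ax xb].
  have -> : F x - F a = fine (nu `]a, x]%classic).
    rewrite /nu /mfrestr /mrestr setIidl; first by rewrite nuE// ltW.
    apply: subset_itvl; rewrite bnd_simp ltW//.
  transitivity (fine (\int[leb]_(t in `]a, x]%classic) h t)%E).
    by congr fine; apply: hE; exact: measurable_itv.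
  by rewrite /H /Rintegral -hh'.
(* Truncation makes the bound hold at every point; it changes nothing where [h' x - 2] is the
   derivative of [f]. *)
pose g x := Num.max (-1) (Num.min 1 (h' x - 2)).
exists g; split.
- apply: measurable_maxr => //; apply: measurable_minr => //.
  exact: measurable_funB.
- move=> x; rewrite ler_norml /g le_max lexx/= ge_max ge_min lexx/= andbT.
  by lra.
move: aeH; apply: filterS; first exact: (ae_filter_ringOfSetsType leb).
move=> x aeH xab.
have := xab; rewrite in_itv/= => /andP[ax xb].
have /aeH[dH H'] : (BRight a < BRight x)%O by [].
have HD : is_derive x 1 H (h' x).
  apply: DeriveDef; first exact: dH.
  by rewrite -derive1E.
have fE : {near x, f =1 (fun y => H y + F a - 2 * y)}.
  near=> y; have yab : y \in `]a, b[.
    by near: y; exact: near_in_itvoo.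
  rewrite -(HE _ yab) /F cid; last exact: subset_itv_oo_cc.
  by ring.
have fD : is_derive x 1 f (h' x - 2).
  have D : is_derive x 1 (fun y => H y + F a - 2 * y) (h' x - 2).
    have -> : h' x - 2 = h' x + 0 - 2 *: 1 by rewrite addr0 /GRing.scale/= mulr1.
    exact: is_deriveB.
  have fE' : \near x, H x + F a - 2 * x = f x by near do apply/esym.
  exact: (near_eq_is_derive fE' D).
have f1 : `|h' x - 2| <= 1.
  have <- : 'D_1 f x = h' x - 2 by case: fD.
  have fd : derivable f x 1 by case: fD.
  have /cvg_norm := fd => /cvgr_to_le; apply.
  near=> t; rewrite normrZ normfV -[_ *: 1]/(t * 1) mulr1 /=.
  rewrite ler_pdivrMl ?mulr1 ?normr_gt0//; last by near: t; exact: nbhs_dnbhs_neq.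
  apply: le_trans (fL _ _ _ _) _; last by rewrite addrK.
    have : `|t| < Num.min (x - a) (b - x).
      by near: t; apply: dnbhs0_lt; rewrite lt_min !subr_gt0 ax.
    rewrite in_itv/= lt_min !ltr_norml => /andP[/andP[? ?] /andP[? ?]].
    by apply/andP; split; lra.
  exact: subset_itv_oo_cc.
have -> // : g x = h' x - 2.
move: f1; rewrite ler_norml => /andP[f1 f2].
by rewrite /g (min_idPr f2) (max_idPr f1).
Unshelve. all: by end_near.
Qed.

End Lipschitz.

(** * The kernel (1 + cos) ^ n *)

Section TrigKernel.
Context {R : realType}.
Variable r : R.
Hypothesis r0 : 0 < r.
Local Notation leb := (@lebesgue_measure R).
Local Notation J := (circle_dom r).
Local Notation integ f := (leb.-integrable J (EFin \o f)).
Local Notation int f := (\int[leb]_(x in J) f x).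

Lemma measurable_circle_dom : measurable (J : set (measurableTypeR R)).
Proof. exact: measurable_itv. Qed.
Hint Resolve measurable_circle_dom : core.

Lemma pir_gt0 : 0 < pi * r :> R.
Proof. by rewrite mulr_gt0// pi_gt0. Qed.

Lemma Npir_lt : - (pi * r) < pi * r :> R.
Proof. by have := pir_gt0; lra. Qed.

Lemma circle_measure : leb J = (2 * pi * r)%:E.
Proof.
rewrite /circle_dom lebesgue_measure_itv/= lte_fin Npir_lt.
by rewrite -EFinB; congr (_%:E); ring.
Qed.

Lemma continuous_integ (f : R -> R) : {within J, continuous f} -> integ f.
Proof. by move=> cf; apply: continuous_compact_integrable => //; exact: segment_compact. Qed.

Lemma Rintegral_derive (G g : R -> R) : (forall t : R, is_derive t 1 G (g t)) ->
  continuous g -> int g = G (pi * r) - G (- (pi * r)).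
Proof.
move=> dG cg; rewrite /Rintegral (@continuous_FTC2 _ g G)//.
- exact: Npir_lt.
- exact: continuous_subspaceT.
- split.
  + by move=> t _; case: (dG t).
  + by apply: cvg_at_right_filter; apply: differentiable_continuous; apply/derivable1_diffP; case: (dG (- (pi * r))).
  + by apply: cvg_at_left_filter; apply: differentiable_continuous; apply/derivable1_diffP; case: (dG (pi * r)).
- by move=> t _; rewrite derive1E; case: (dG t).
Qed.

Lemma within_cst (k : R) : {within J, continuous (fun _ : R => k)}.
Proof. by apply: continuous_subspaceT => t; exact: cvg_cst. Qed.

Lemma withinD (f g : R -> R) : {within J, continuous f} ->
  {within J, continuous g} -> {within J, continuous (fun t => f t + g t)}.
Proof. by move=> cf cg t; apply: cvgD; [exact: cf|exact: cg]. Qed.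

Lemma withinB (f g : R -> R) : {within J, continuous f} ->
  {within J, continuous g} -> {within J, continuous (fun t => f t - g t)}.
Proof. by move=> cf cg t; apply: cvgB; [exact: cf|exact: cg]. Qed.

Lemma withinM (f g : R -> R) : {within J, continuous f} ->
  {within J, continuous g} -> {within J, continuous (fun t => f t * g t)}.
Proof. by move=> cf cg t; apply: cvgM; [exact: cf|exact: cg]. Qed.

Lemma within_norm (f : R -> R) : {within J, continuous f} ->
  {within J, continuous (fun t => `|f t|)}.
Proof. by move=> cf t; apply: cvg_norm; exact: cf. Qed.

Section Center.
Variable x : R.

Definition kcos (t : R) : R := cos ((t - x) / r).
Definition ksin (t : R) : R := sin ((t - x) / r).

Lemma is_derive_arg (t : R) : is_derive t 1 (fun t => (t - x) / r) r^-1.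
Proof.
have -> : (fun t : R => (t - x) / r) = r^-1 *: (id \- cst x).
  by apply/funext => u; rewrite /GRing.scale/= mulrC.
by apply: is_derive_eq; rewrite subr0 /GRing.scale/= mulr1.
Qed.

Lemma is_derive_kcos (t : R) : is_derive t 1 kcos (- ksin t / r).
Proof.
have := is_derive_arg t => dA.
have := @is_derive1_comp _ cos (fun t => (t - x) / r) t _ _ (is_derive_cos _) dA.
exact.
Qed.

Lemma is_derive_ksin (t : R) : is_derive t 1 ksin (kcos t / r).
Proof.
have := is_derive_arg t => dA.
have := @is_derive1_comp _ sin (fun t => (t - x) / r) t _ _ (is_derive_sin _) dA.
exact.
Qed.

Lemma continuous_kcos : continuous kcos.
Proof.
by move=> t; apply: differentiable_continuous; apply/derivable1_diffP; case: (is_derive_kcos t).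
Qed.

Lemma continuous_ksin : continuous ksin.
Proof.
by move=> t; apply: differentiable_continuous; apply/derivable1_diffP; case: (is_derive_ksin t).
Qed.

Lemma kcos_periodic : kcos (pi * r) = kcos (- (pi * r)).
Proof.
rewrite /kcos -[in RHS]cosD2pi; congr cos; rewrite mulr2n; field; exact: lt0r_neq0.
Qed.

Lemma ksin_periodic : ksin (pi * r) = ksin (- (pi * r)).
Proof.
rewrite /ksin -[in RHS]sinD2pi; congr sin; rewrite mulr2n; field; exact: lt0r_neq0.
Qed.

Lemma kcos_sin2 t : ksin t ^+ 2 = 1 - kcos t ^+ 2.
Proof. exact: sin2cos2. Qed.

Definition kerI n : R := int (fun t => (1 + kcos t) ^+ n).

Lemma continuous_ker n : continuous (fun t => (1 + kcos t) ^+ n).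
Proof.
move=> t; apply: (@continuous_comp _ _ _ (fun t => 1 + kcos t) (fun u => u ^+ n)); last exact: exprn_continuous.
by apply: cvgD; [exact: cvg_cst|exact: continuous_kcos].
Qed.

Lemma within_ker n : {within J, continuous (fun t => (1 + kcos t) ^+ n)}.
Proof. by apply: continuous_subspaceT; exact: continuous_ker. Qed.

Lemma within_kcos : {within J, continuous kcos}.
Proof. by apply: continuous_subspaceT; exact: continuous_kcos. Qed.

Lemma within_ksin : {within J, continuous ksin}.
Proof. by apply: continuous_subspaceT; exact: continuous_ksin. Qed.

(** The periodic function [ksin * (1 + kcos) ^ n] has a derivative of integral 0. The resulting
    recursion yields every moment that is used, so the integrals are never evaluated. *)
Lemma kerI_rec n : n.+1%:R * kerI n.+1 = (2 * n%:R + 1) * kerI n.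
Proof.
have dG (t : R) : is_derive t 1 (fun t => ksin t * (1 + kcos t) ^+ n)
    (r^-1 * (n.+1%:R * (1 + kcos t) ^+ n.+1 - (2 * n%:R + 1) * (1 + kcos t) ^+ n)).
  have := is_derive_kcos t => dc; have := is_derive_ksin t => ds.
  have d1 : is_derive t 1 (cst 1 + kcos) (0 + (- ksin t / r)) by exact: is_deriveD.
  have d2 := is_deriveX n d1.
  have d3 := is_deriveM ds d2.
  have -> : (fun t => ksin t * (1 + kcos t) ^+ n) = ksin * (cst 1 + kcos) ^+ n.
    by apply/funext => u; rewrite !fctE.
  apply: (is_derive_eq d3); rewrite /GRing.scale/= add0r !fctE.
  rewrite -addn1 natrD exprD expr1.
  have := kcos_sin2 t; move: (kcos t) (ksin t) => c s s2.
  case: n d2 d3 => [|n] _ _ /=; first by rewrite !expr0; field; exact: lt0r_neq0.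
  rewrite [_ ^+ n.+1]exprS; move: (_ ^+ n) => p.
  have s2' : s * s = 1 - c ^+ 2 by rewrite -expr2.
  transitivity (r^-1 * (- n.+1%:R * p * (s * s) + (1 + c) * p * c)); first by field; exact: lt0r_neq0.
  by rewrite s2'; field; exact: lt0r_neq0.
have i0 m : integ (fun t => (1 + kcos t) ^+ m).
  by apply: continuous_integ; apply: continuous_subspaceT; exact: continuous_ker.
have i1 m k : integ (fun t => k * (1 + kcos t) ^+ m).
  by apply: continuous_integ; apply: continuous_subspaceT => t; apply: cvgM; [exact: cvg_cst|exact: continuous_ker].
have cG : continuous (fun t => r^-1 * (n.+1%:R * (1 + kcos t) ^+ n.+1 -
    (2 * n%:R + 1) * (1 + kcos t) ^+ n)).
  by move=> t; apply: cvgM; [exact: cvg_cst|apply: cvgB; apply: cvgM;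
    by [exact: cvg_cst|exact: continuous_ker]].
have /eqP := Rintegral_derive dG cG.
rewrite kcos_periodic ksin_periodic subrr RintegralZl//; last first.
  by apply: continuous_integ; apply: continuous_subspaceT => t; apply: cvgB;
    apply: cvgM; by [exact: cvg_cst|exact: continuous_ker].
rewrite RintegralB// !RintegralZl// mulf_eq0 invr_eq0 (gt_eqF r0)/= subr_eq0.
by move=> /eqP.
Qed.

End Center.


(** The derivative of [(1 + kcos x t) ^ n.+1] with respect to the centre [x], and minus its
    derivative with respect to [t]. *)
Definition dker x n (t : R) : R := n.+1%:R * (1 + kcos x t) ^+ n * ksin x t / r.

Lemma within_dker x n : {within J, continuous (dker x n)}.
Proof.
rewrite /dker; apply: withinM; last exact: within_cst.
apply: withinM; last exact: within_ksin.
by apply: withinM; [exact: within_cst|exact: within_ker].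
Qed.

Ltac wcont := lazymatch goal with
  | |- {within _, continuous (fun t => @?f t - @?g t)} => refine (@withinB f g _ _); wcont
  | |- {within _, continuous (fun t => @?f t + @?g t)} => refine (@withinD f g _ _); wcont
  | |- {within _, continuous (fun t => @?f t * @?g t)} => refine (@withinM f g _ _); wcont
  | |- {within _, continuous (fun t => (1 + kcos _ _) ^+ _)} => exact: within_ker
  | |- {within _, continuous (fun t => kcos _ _)} => exact: within_kcos
  | |- {within _, continuous (fun t => ksin _ _)} => exact: within_ksin
  | |- _ => first [exact: within_cst | assumption | exact: within_ksin | exact: within_kcos | exact: within_dker]
  end.
Ltac cint := apply: continuous_integ; wcont.

Lemma kerI0 x : kerI x 0 = 2 * pi * r.
Proof.
rewrite /kerI; under eq_Rintegral do rewrite expr0.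
rewrite Rintegral_cst// mul1r.
by have /(congr1 fine) := circle_measure.
Qed.

Lemma kerI_gt0 x n : 0 < kerI x n.
Proof.
elim: n => [|n ih]; first by rewrite kerI0 !mulr_gt0// pi_gt0.
by rewrite -(pmulr_rgt0 _ (ltr0Sn R n)) kerI_rec mulr_gt0// ltr_wpDl// mulr_ge0.
Qed.

Lemma kerI_center x y n : kerI x n = kerI y n.
Proof.
elim: n => [|n ih]; first by rewrite !kerI0.
apply: (mulfI (lt0r_neq0 (ltr0Sn R n))).
by rewrite !kerI_rec ih.
Qed.

Lemma kerI_recE x n : kerI x n.+1 = (2 * n%:R + 1) / n.+1%:R * kerI x n.
Proof.
apply: (mulfI (lt0r_neq0 (ltr0Sn R n))); rewrite kerI_rec.
by field; exact: lt0r_neq0.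
Qed.

Lemma kerI_le x n : kerI x n <= kerI x n.+1.
Proof.
rewrite kerI_recE ler_peMl ?(ltW (kerI_gt0 _ _))// ler_pdivlMr// mul1r -natr1.
by have : 0 <= n%:R :> R by []; lra.
Qed.

Lemma int_kerZ x n k : int (fun t => k * (1 + kcos x t) ^+ n) = k * kerI x n.
Proof. by rewrite RintegralZl//; cint. Qed.

Lemma kcos_le1 x t : 0 <= 1 - kcos x t.
Proof. by rewrite subr_ge0 cos_le1. Qed.

Lemma kcos_geN1 x t : 0 <= 1 + kcos x t.
Proof. by have := cos_geN1 ((t - x) / r); rewrite /kcos; lra. Qed.

(** By the recursion [1 - kcos] has mean [1 / n.+1] under the kernel. A modulus of this form thus
    controls the error without cutting the integral into a near and a far part. *)
Lemma ker_average (f : R -> R) x n (e C : R) : {within J, continuous f} ->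
  (forall t, J t -> `|f t - f x| <= e + C * (1 - kcos x t)) ->
  `|int (fun t => f t * (1 + kcos x t) ^+ n) - f x * kerI x n|
    <= (e + C / n.+1%:R) * kerI x n.
Proof.
move=> cf fb.
have -> : int (fun t => f t * (1 + kcos x t) ^+ n) - f x * kerI x n =
    int (fun t => (f t - f x) * (1 + kcos x t) ^+ n).
  rewrite -int_kerZ -RintegralB; [|by []|by cint|by cint].
  by apply: eq_Rintegral => t _; rewrite mulrBl.
apply: le_trans (le_normr_Rintegral _ _) _; [by []|by cint|].
have -> : (e + C / n.+1%:R) * kerI x n =
    int (fun t => e * (1 + kcos x t) ^+ n +
      (2 * C * (1 + kcos x t) ^+ n - C * (1 + kcos x t) ^+ n.+1)).
  rewrite RintegralD; [|by []|by cint|by cint].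
  rewrite RintegralB; [|by []|by cint|by cint].
  rewrite !int_kerZ kerI_recE -natr1; field; exact: lt0r_neq0.
apply: le_Rintegral => //.
- by apply: continuous_integ; apply: within_norm; wcont.
- by cint.
move=> t Jt; rewrite normrM [X in _ * X]ger0_norm; last by rewrite exprn_ge0// kcos_geN1.
apply: le_trans (ler_wpM2r (exprn_ge0 _ (kcos_geN1 _ _)) (fb t Jt)) _.
by rewrite exprS le_eqVlt; apply/orP; left; apply/eqP; ring.
Qed.


Lemma int_dker0 x n : int (dker x n) = 0.
Proof.
have dG (t : R) : is_derive t 1 (fun t => - (1 + kcos x t) ^+ n.+1) (dker x n t).
  have dc := is_derive_kcos x t.
  have d1 : is_derive t 1 (cst 1 + kcos x) (0 + (- ksin x t / r)) by exact: is_deriveD.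
  have d2 := is_deriveN (is_deriveX n.+1 d1).
  have -> : (fun t => - (1 + kcos x t) ^+ n.+1) = - (cst 1 + kcos x) ^+ n.+1.
    by apply/funext => u; rewrite !fctE.
  apply: (is_derive_eq d2); rewrite /GRing.scale/= add0r !fctE /dker.
  by ring.
rewrite (Rintegral_derive dG) ?kcos_periodic ?subrr// => t.
by apply: cvgM; [apply: cvgM; [apply: cvgM; [exact: cvg_cst|exact: continuous_ker]|exact: continuous_ksin]|exact: cvg_cst].
Qed.

(** [2 * r * |hsin x t|] is the chord between two points of a circle of radius [r]: a distance that
    does not see where the circle was cut open. *)
Definition hsin x (t : R) : R := sin ((t - x) / (2 * r)).

Lemma kcos_hsin x t : 1 - kcos x t = 2 * hsin x t ^+ 2.
Proof.
rewrite /kcos /hsin.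
have -> : (t - x) / r = ((t - x) / (2 * r)) *+ 2.
  by rewrite mulr2n; field; exact: lt0r_neq0.
by rewrite cos_mulr2n cos2sin2; ring.
Qed.

Lemma hsin_ksin x t : `|hsin x t| * `|ksin x t| <= 1 - kcos x t.
Proof.
rewrite kcos_hsin /ksin.
have -> : (t - x) / r = ((t - x) / (2 * r)) *+ 2.
  by rewrite mulr2n; field; exact: lt0r_neq0.
rewrite sin_mulr2n -/(hsin x t) normrMn normrM -[X in _ <= _ * X]real_normK ?num_real//.
have := cos_le1 ((t - x) / (2 * r)); have := cos_geN1 ((t - x) / (2 * r)).
move=> c1 c2; have : `|cos ((t - x) / (2 * r))| <= 1 by rewrite ler_norml c1.
move: (`|cos _|) (`|hsin x t|) (normr_ge0 (hsin x t)) => c h h0 {}c1.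
rewrite mulr2n expr2.
have : c * (h * h) <= 1 * (h * h) by apply: ler_wpM2r => //; rewrite mulr_ge0.
by nra.
Qed.

(** The linear term [t - x] is replaced by [r * ksin], which is periodic and has the same derivative
    at [x]. Its pairing with [dker] is exactly [n.+1 / n.+2] times the mass, and the remainder is
    absorbed by [|hsin| * |ksin| <= 1 - kcos]. *)
Lemma ker_derivative (f : R -> R) x n (g e C : R) : {within J, continuous f} ->
  0 <= e -> 0 <= C ->
  (forall t, J t -> `|f t - f x - g * (r * ksin x t)| <=
     (e + C * (1 - kcos x t)) * `|hsin x t|) ->
  `|int (fun t => f t * dker x n t) - g * (n.+1%:R / n.+2%:R) * kerI x n.+1|
    <= (e + 3 * C / n.+2%:R) / r * kerI x n.+1.
Proof.
move=> cf e0 C0 fb.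
have -> : int (fun t => f t * dker x n t) - g * (n.+1%:R / n.+2%:R) * kerI x n.+1 =
    int (fun t => (f t - f x - g * (r * ksin x t)) * dker x n t).
  have -> : g * (n.+1%:R / n.+2%:R) * kerI x n.+1 = f x * int (dker x n) +
      int (fun t => 2 * (g * n.+1%:R) * (1 + kcos x t) ^+ n.+1 -
                    g * n.+1%:R * (1 + kcos x t) ^+ n.+2).
    rewrite int_dker0 mulr0 add0r.
    rewrite RintegralB; [|by []|by cint|by cint].
    rewrite !int_kerZ (kerI_recE _ n.+1) -!natr1.
    have n0 : 0 <= n%:R :> R by [].
    by field; apply: lt0r_neq0; lra.
  rewrite -RintegralZl; [|by []|by cint].
  rewrite -RintegralD; [|by []|by cint|by cint].
  rewrite -RintegralB; [|by []|by cint|by cint].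
  apply: eq_Rintegral => t _.
  have e1 : r * ksin x t * dker x n t =
      n.+1%:R * (2 * (1 + kcos x t) ^+ n.+1 - (1 + kcos x t) ^+ n.+2).
    rewrite /dker; transitivity (n.+1%:R * (1 + kcos x t) ^+ n * ksin x t ^+ 2).
      by field; exact: lt0r_neq0.
    by rewrite kcos_sin2 !exprS; ring.
  by rewrite [RHS]mulrBl -(mulrA g (r * _)) e1 mulrBl; ring.
apply: le_trans (le_normr_Rintegral _ _) _; [by []|by cint|].
(* The new integrand is [n.+1 / r * (1 + kcos) ^ n * (e + C * (1 - kcos)) * (1 - kcos)], expanded in
   powers of [1 + kcos]. *)
apply: (@le_trans _ _ (int (fun t => n.+1%:R / r * (
    (2 * e + 4 * C) * (1 + kcos x t) ^+ n - (e + 4 * C) * (1 + kcos x t) ^+ n.+1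
    + C * (1 + kcos x t) ^+ n.+2)))).
  apply: le_Rintegral => //.
  - by apply: continuous_integ; apply: within_norm; wcont.
  - by cint.
  move=> t Jt; rewrite normrM.
  apply: le_trans (ler_wpM2r (normr_ge0 _) (fb t Jt)) _.
  rewrite /dker !normrM normfV (gtr0_norm r0) (ger0_norm (ler0n _ _)).
  rewrite [`|_ ^+ n|]ger0_norm; last by rewrite exprn_ge0// kcos_geN1.
  have := hsin_ksin x t; have := kcos_le1 x t; have := kcos_geN1 x t.
  rewrite !exprS.
  have : 0 <= (1 + kcos x t) ^+ n by rewrite exprn_ge0// kcos_geN1.
  move: (kcos x t) `|hsin x t| `|ksin x t| => c h s p0 c1 c2 hs.
  apply: (@le_trans _ _ (n.+1%:R / r * (1 + c) ^+ n * (e + C * (1 - c)) * (h * s))).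
    rewrite le_eqVlt; by apply/orP; left; apply/eqP; ring.
  apply: (@le_trans _ _ (n.+1%:R / r * (1 + c) ^+ n * (e + C * (1 - c)) * (1 - c))).
    apply: ler_wpM2l => //.
    by rewrite !mulr_ge0 ?invr_ge0 ?addr_ge0 ?mulr_ge0 ?(ltW r0).
  by rewrite le_eqVlt; apply/orP; left; apply/eqP; ring.
rewrite RintegralZl; [|by []|by cint].
rewrite RintegralD; [|by []|by cint|by cint].
rewrite RintegralB; [|by []|by cint|by cint].
rewrite !int_kerZ.
apply: (@le_trans _ _ ((e + 3 * C / n.+2%:R) / r * kerI x n)); last first.
  apply: ler_wpM2l (kerI_le _ _).
  by rewrite mulr_ge0 ?invr_ge0 ?addr_ge0 ?mulr_ge0 ?(ltW r0).
rewrite (kerI_recE _ n.+1) (kerI_recE _ n) le_eqVlt; apply/orP; left; apply/eqP.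
have n0 : 0 <= n%:R :> R by [].
by rewrite -!natr1; field; rewrite !lt0r_neq0//; lra.
Qed.

End TrigKernel.

(** * Convergence of the kernel averages and of their derivatives at interior points *)

Section PointwiseLimits.
Context {R : realType}.
Variable r : R.
Hypothesis r0 : 0 < r.
Local Notation leb := (@lebesgue_measure R).
Local Notation J := (circle_dom r).
Local Notation integ f := (leb.-integrable J (EFin \o f)).
Local Notation int f := (\int[leb]_(x in J) f x).

Ltac rlra := have ? := r0; lra.

(** The mean value theorem on [[0, a / 2]] and the double angle formula give
    [sin a >= a * cos (a / 2) ^ 2], and [cos (a / 2) ^ 2 >= 1 / 2] because [cos a >= 0]. *)
Lemma sin_ge_half (a : R) : 0 <= a <= pi / 2 -> a / 2 <= sin a.
Proof.
move=> /andP[a0 api].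
have [->|a1] := eqVneq a 0; first by rewrite sin0 mul0r.
have {a1}a0 : 0 < a by rewrite lt_neqAle eq_sym a1.
have y0 : 0 < a / 2 by rewrite divr_gt0.
have cs : {within `[0, (a / 2)], continuous (@sin R)}.
  by apply: continuous_subspaceT; exact: continuous_sin.
have [c + sE] := MVT y0 (fun x _ => is_derive_sin x) cs.
move: sE; rewrite in_itv/= sin0 !subr0 => sE /andP[c0 c1].
have cc : cos (a / 2) <= cos c.
  by apply/ltW; rewrite ltr_cos// in_itv/=; apply/andP; split; have := @pi_gt0 R; rlra.
have ca : 0 <= cos a by apply: cos_ge0_pihalf; apply/andP; split; have := @pi_gt0 R; rlra.
have aE : a = (a / 2) *+ 2 by rewrite mulr2n; rlra.
rewrite [in sin a]aE sin_mulr2n sE.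
have c2 : cos a = cos (a / 2) ^+ 2 *+ 2 - 1 by rewrite -cos_mulr2n -aE.
have cp : 0 <= cos (a / 2) by apply: cos_ge0_pihalf; apply/andP; split; have := @pi_gt0 R; rlra.
have : cos (a / 2) * (cos (a / 2) * (a / 2)) <= cos (a / 2) * (cos c * (a / 2)).
  by apply: ler_wpM2l => //; apply: ler_wpM2r => //; exact: ltW.
rewrite mulr2n in c2 *; rewrite c2 expr2 in ca.
move: (cos (a / 2)) (cos c) ca => k l ca h.
have : a * (1 / 2) <= a * (k * k) by apply: ler_wpM2l; [exact: ltW|rlra].
by move: h; rewrite !mulrA => h h'; rlra.
Qed.

Lemma circle_domP t : J t <-> `|t| <= pi * r.
Proof. by rewrite /circle_dom/= in_itv/= ler_norml. Qed.

Lemma circle_dom_dist t x : J t -> J x -> `|t - x| <= 2 * pi * r.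
Proof.
move=> /circle_domP ht /circle_domP hx.
by rewrite (le_trans (ler_normB _ _))//; rlra.
Qed.

Lemma hsin_norm x t : J t -> J x -> `|hsin r x t| = sin (`|t - x| / (2 * r)).
Proof.
move=> Jt Jx; have D := circle_dom_dist Jt Jx.
have pos : 0 <= sin (`|t - x| / (2 * r)).
  apply: sin_ge0_pi; apply/andP; split.
    by apply: divr_ge0 => //; rlra.
  by rewrite ler_pdivrMr ?mulr_gt0//; rlra.
have [h|h] := leP 0 (t - x).
  by rewrite (ger0_norm h) in pos *; rewrite ger0_norm.
by rewrite (ltr0_norm h) mulNr sinN in pos *; rewrite -normrN ger0_norm.
Qed.

Lemma hsin_ge_near x t : J t -> J x -> `|t - x| <= pi * r ->
  `|t - x| <= 4 * r * `|hsin r x t|.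
Proof.
move=> Jt Jx h; rewrite hsin_norm//.
have := @sin_ge_half (`|t - x| / (2 * r)).
rewrite divr_ge0 ?mulr_ge0 ?(ltW r0)//= ler_pdivrMr ?mulr_gt0//.
have -> : `|t - x| <= pi / 2 * (2 * r) by rlra.
move=> /(_ isT); rewrite ler_pdivrMr// ler_pdivrMr ?mulr_gt0//.
by move=> H; apply: le_trans H _; rewrite le_eqVlt; apply/orP; left; apply/eqP; ring.
Qed.

Lemma hsin_ge_far x t : J t -> J x -> pi * r <= `|t - x| ->
  2 * pi * r - `|t - x| <= 4 * r * `|hsin r x t|.
Proof.
move=> Jt Jx h; rewrite hsin_norm//; have D := circle_dom_dist Jt Jx.
have := @sin_ge_half (pi - `|t - x| / (2 * r)).
have r2 : 0 < 2 * r by rlra.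
have rr : 2 * r != 0 by exact: lt0r_neq0.
have -> : 0 <= pi - `|t - x| / (2 * r) <= pi / 2.
  apply/andP; split; first by rewrite subr_ge0 ler_pdivrMr//; rlra.
  rewrite lerBlDr -lerBlDl ler_pdivlMr//; rlra.
move=> /(_ isT).
have -> : sin (pi - `|t - x| / (2 * r)) = sin (`|t - x| / (2 * r)).
  by rewrite sinB sinpi cospi; ring.
have -> : pi - `|t - x| / (2 * r) = (2 * pi * r - `|t - x|) / (2 * r).
  by field; exact: lt0r_neq0.
rewrite ler_pdivrMr// ler_pdivrMr//.
by move=> H; apply: le_trans H _; rewrite le_eqVlt; apply/orP; left; apply/eqP; ring.
Qed.

Lemma pir_in : J (pi * r) /\ J (- (pi * r)).
Proof. by have := pir_gt0 r0; split; apply/circle_domP; rewrite ?normrN ger0_norm// ltW. Qed.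

(** Points further apart than half the circle are joined through the cut, where the two end values
    of [f] agree. *)
Lemma lipschitz_hsin (f : R -> R) : f (pi * r) = f (- (pi * r)) ->
  (forall t x, J t -> J x -> `|f t - f x| <= `|t - x|) ->
  forall t x, J t -> J x -> `|f t - f x| <= 4 * r * `|hsin r x t|.
Proof.
move=> fp fL t x Jt Jx; have [Ja Jb] := pir_in.
have [h|h] := leP `|t - x| (pi * r).
  by apply: le_trans (fL _ _ Jt Jx) _; exact: hsin_ge_near.
apply: (le_trans _ (hsin_ge_far Jt Jx (ltW h))).
have H t' x' : J t' -> J x' -> t' <= x' -> `|f t' - f x'| <= 2 * pi * r - `|t' - x'|.
  move=> Jt' Jx' tx; rewrite (@ler0_norm _ (t' - x')) ?subr_le0//.
  have -> : f t' - f x' = (f t' - f (- (pi * r))) + (f (pi * r) - f x') by rewrite fp; ring.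
  apply: le_trans (ler_normD _ _) _.
  have h1 := fL _ _ Jt' Jb; have h2 := fL _ _ Ja Jx'.
  have /andP[? ?] : - (pi * r) <= t' <= pi * r by rewrite -ler_norml; apply/circle_domP.
  have /andP[? ?] : - (pi * r) <= x' <= pi * r by rewrite -ler_norml; apply/circle_domP.
  rewrite (@ger0_norm _ (t' - _)) in h1; last by rlra.
  by rewrite (@ger0_norm _ (pi * r - x')) in h2; rlra.
have [tx|/ltW xt] := leP t x; first exact: H.
by rewrite distrC (distrC t); exact: H.
Qed.

Lemma hsin_away x t d : J t -> 0 < d -> `|x| <= pi * r - d -> d <= `|t - x| ->
  d <= 4 * r * `|hsin r x t|.
Proof.
move=> Jt d0 xd dt.
have Jx : J x by apply/circle_domP; rlra.
have [h|h] := leP `|t - x| (pi * r).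
  by apply: le_trans dt _; exact: hsin_ge_near.
apply: (le_trans _ (hsin_ge_far Jt Jx (ltW h))).
move/circle_domP : Jt => Jt; by have := ler_normB t x => ?; rlra.
Qed.

Lemma within_bounded (f : R -> R) : {within J, continuous f} ->
  exists2 M, 0 <= M & forall t, J t -> `|f t| <= M.
Proof.
move=> cf.
have [c cJ Hc] := EVT_max (ltW (Npir_lt r0)) (within_norm cf).
by exists `|f c|.
Qed.

Lemma interiorP x : x \in `](- (pi * r)), (pi * r)[ ->
  exists2 d, 0 < d & `|x| <= pi * r - d.
Proof.
rewrite in_itv/= => /andP[h1 h2]; exists (pi * r - `|x|); last by rewrite opprB addrCA subrr addr0.
by rewrite subr_gt0 ltr_norml h1.
Qed.

(** Near [x] continuity gives [e]; elsewhere the chord is bounded below, so a large multiple of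
    [1 - kcos] exceeds the oscillation of [f]. *)
Lemma continuous_modulus (f : R -> R) x : {within J, continuous f} ->
  x \in `](- (pi * r)), (pi * r)[ -> forall e, 0 < e ->
  exists2 C, 0 <= C & forall t, J t -> `|f t - f x| <= e + C * (1 - kcos r x t).
Proof.
move=> cf xJ e e0; have [M M0 fM] := within_bounded cf.
have [d d0 xd] := interiorP xJ.
have cfx : {for x, continuous f}.
  by have [+ _ _] := (continuous_within_itvP f (Npir_lt r0)).1 cf; apply.
have [d' /= d'0 Hd'] : exists2 d', 0 < d' & forall t, `|t - x| < d' -> `|f t - f x| <= e.
  have /cvgrPdist_le /(_ _ e0) [d' /= d'0 H] := cfx.
  by exists d' => // t td; rewrite distrC; apply: H => /=; rewrite distrC.
pose b := Num.min d d'.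
have b0 : 0 < b by rewrite lt_min d0.
have bd : b <= d by rewrite ge_min lexx.
have bd' : b <= d' by rewrite ge_min lexx orbT.
exists (16 * r ^+ 2 * M / b ^+ 2).
  by rewrite !mulr_ge0// ?invr_ge0 ?exprn_ge0// ltW.
move=> t Jt; have Jx : J x by apply/circle_domP; rlra.
have [h|h] := ltP `|t - x| b.
  apply: (le_trans (Hd' _ _)); first exact: lt_le_trans h _.
  by rewrite lerDl mulr_ge0 ?kcos_le1// !mulr_ge0// ?invr_ge0 ?exprn_ge0// ltW.
have hb : b <= 4 * r * `|hsin r x t| by apply: hsin_away => //; rlra.
apply: (@le_trans _ _ (2 * M)).
  by apply: le_trans (ler_normB _ _) _; have h1 := fM _ Jt; have h2 := fM _ Jx; rlra.
rewrite -[X in X <= _]add0r; apply: lerD; first exact: ltW.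
rewrite kcos_hsin// -(real_normK (num_real (hsin r x t))).
have b2 : b ^+ 2 <= (4 * r * `|hsin r x t|) ^+ 2.
  by rewrite ler_sqr// ?nnegrE ?mulr_ge0// ltW.
rewrite mulrAC ler_pdivlMr ?exprn_gt0//.
have : 2 * M * b ^+ 2 <= 2 * M * (4 * r * `|hsin r x t|) ^+ 2.
  by apply: ler_wpM2l => //; rewrite mulr_ge0.
move=> H; apply: le_trans H _; rewrite le_eqVlt; apply/orP; left; apply/eqP; ring.
Qed.


Lemma derivative_modulus (f : R -> R) x g : {within J, continuous f} ->
  x \in `](- (pi * r)), (pi * r)[ -> is_derive x 1 f g -> forall e, 0 < e ->
  exists2 C, 0 <= C & forall t, J t ->
    `|f t - f x - g * (r * ksin r x t)| <=
      (e + C * (1 - kcos r x t)) * `|hsin r x t|.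
Proof.
move=> cf xJ fg e e0; have [M M0 fM] := within_bounded cf.
have [d d0 xd] := interiorP xJ.
have Jx : J x by apply/circle_domP; rlra.
pose rho t := f t - f x - g * (r * ksin r x t).
have ksin0 : ksin r x x = 0 by rewrite /ksin subrr mul0r sin0.
have rho0 : rho x = 0 by rewrite /rho subrr ksin0 !mulr0 subr0.
have drho : is_derive x 1 rho 0.
  have -> : rho = f - cst (f x) - (g * r) *: ksin r x.
    by apply/funext => t; rewrite /rho /= !fctE /= mulrA.
  have ds := is_derive_ksin r x x.
  apply: is_derive_eq; rewrite subr0 /GRing.scale/=.
  rewrite /kcos subrr mul0r cos0; field; exact: lt0r_neq0.
have e1 : 0 < e / (4 * r) by rewrite divr_gt0// mulr_gt0.
have [d' d'0 Hd'] : exists2 d', 0 < d' & forall t, `|t - x| < d' -> `|rho t| <= e / (4 * r) * `|t - x|.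
  have [dv dE] := drho.
  have : h^-1 *: ((rho \o shift x) (h *: 1) - rho x) @[h --> 0^'] --> 'D_1 rho x by exact: dv.
  rewrite dE => /cvgrPdist_le /(_ _ e1) [d' /= d'0 H].
  exists d' => // t td; have [->|tx] := eqVneq t x.
    by rewrite rho0 normr0 mulr_ge0// ltW.
  have := H (t - x); rewrite /= sub0r normrN => /(_ td).
  rewrite subr_eq0 => /(_ tx); rewrite sub0r normrN normrM normfV.
  have -> : (t - x)%:A + x = t by rewrite /GRing.scale/= mulr1 subrK.
  by rewrite rho0 subr0 ler_pdivrMl ?normr_gt0 ?subr_eq0// mulrC.
pose b := Num.min d d'.
have b0 : 0 < b by rewrite lt_min d0.
have bd : b <= d by rewrite ge_min lexx.
have bd' : b <= d' by rewrite ge_min lexx orbT.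
pose M' := 2 * M + `|g| * r.
have M'0 : 0 <= M' by rewrite addr_ge0 ?mulr_ge0 ?(ltW r0).
(* Away from [x] the left side is at most [M'], while the right side contains [2 * C * |hsin| ^ 3]
   with [|hsin| >= b / (4 * r)]; this [C] makes the latter at least [M']. *)
exists (32 * r ^+ 3 * M' / b ^+ 3).
  by rewrite !mulr_ge0// ?invr_ge0 ?exprn_ge0// ltW.
move=> t Jt; rewrite -/(rho t).
have C0 : 0 <= 32 * r ^+ 3 * M' / b ^+ 3 * (1 - kcos r x t).
  by rewrite mulr_ge0 ?kcos_le1// !mulr_ge0// ?invr_ge0 ?exprn_ge0// ltW.
have [h|h] := ltP `|t - x| b.
  apply: (le_trans (Hd' _ _)); first exact: lt_le_trans h _.
  have hn : `|t - x| <= 4 * r * `|hsin r x t|.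
    apply: hsin_ge_near => //; apply: le_trans (ltW h) _; apply: le_trans bd _.
    by have := normr_ge0 x => ?; rlra.
  apply: (@le_trans _ _ (e * `|hsin r x t|)).
    apply: le_trans (ler_wpM2l (ltW e1) hn) _.
    rewrite le_eqVlt; apply/orP; left; apply/eqP; field; exact: lt0r_neq0.
  by apply: ler_wpM2r => //; rewrite lerDl.
have hb : b <= 4 * r * `|hsin r x t| by apply: hsin_away => //; rlra.
apply: (@le_trans _ _ M').
  apply: le_trans (ler_normB _ _) _; apply: lerD.
    by apply: le_trans (ler_normB _ _) _; have h1 := fM _ Jt; have h2 := fM _ Jx; rlra.
  rewrite normrM; apply: ler_wpM2l => //; rewrite normrM gtr0_norm// ler_piMr ?(ltW r0)//.
  by rewrite ler_norml sin_geN1 sin_le1.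
apply: (@le_trans _ _ (32 * r ^+ 3 * M' / b ^+ 3 * (1 - kcos r x t) * `|hsin r x t|)); last first.
  by apply: ler_wpM2r => //; rewrite lerDr ltW.
rewrite kcos_hsin// -(real_normK (num_real (hsin r x t))).
have b3 : b ^+ 3 <= (4 * r * `|hsin r x t|) ^+ 3.
  by rewrite lerXn2r// ?nnegrE ?mulr_ge0// ltW.
apply: (@le_trans _ _ (M' * (4 * r * `|hsin r x t|) ^+ 3 / b ^+ 3)).
  by rewrite ler_pdivlMr ?exprn_gt0//; exact: ler_wpM2l.
by rewrite le_eqVlt; apply/orP; left; apply/eqP; ring.
Qed.

Lemma near_divn_le (K e : R) : 0 < e -> \forall n \near \oo, K / n.+1%:R <= e.
Proof.
move=> e0; near=> n; rewrite ler_pdivrMr// -ler_pdivrMl//.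
have : e^-1 * K <= n%:R by near: n; exact: nbhs_infty_ger.
by rewrite -natr1 => ?; lra.
Unshelve. all: by end_near. Qed.

Lemma ker_average_cvg (f : R -> R) x : {within J, continuous f} ->
  x \in `](- (pi * r)), (pi * r)[ ->
  int (fun t => f t * (1 + kcos r x t) ^+ n) / kerI r x n @[n --> \oo] --> f x.
Proof.
move=> cf xJ; apply/cvgrPdist_le => e e0.
have e2 : 0 < e / 2 by lra.
have [C C0 fC] := continuous_modulus cf xJ e2.
near=> n; rewrite distrC.
have I0 := kerI_gt0 r0 x n.
rewrite -[X in _ - X](mulfK (lt0r_neq0 I0)) -mulrBl normrM normfV (gtr0_norm I0).
rewrite ler_pdivrMr//; apply: le_trans (ker_average r0 n cf fC) _.
apply: ler_wpM2r; first exact: ltW.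
have : C / n.+1%:R <= e / 2.
  by near: n; apply: near_divn_le; rewrite divr_gt0.
move: (C / _) => C'; lra.
Unshelve. all: by end_near. Qed.

Lemma ker_derivative_cvg (f : R -> R) x g : {within J, continuous f} ->
  x \in `](- (pi * r)), (pi * r)[ -> is_derive x 1 f g ->
  int (fun t => f t * dker r x n t) / kerI r x n.+1 @[n --> \oo] --> g.
Proof.
move=> cf xJ fg; apply/cvgrPdist_le => e e0.
have e1 : 0 < r * (e / 2) by rewrite mulr_gt0// divr_gt0.
have [C C0 fC] := derivative_modulus cf xJ fg e1.
near=> n; rewrite distrC.
have I0 := kerI_gt0 r0 x n.+1.
rewrite -[X in _ - X](mulfK (lt0r_neq0 I0)) -mulrBl normrM normfV (gtr0_norm I0).
rewrite ler_pdivrMr//.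
have -> : int (fun t => f t * dker r x n t) - g * kerI r x n.+1 =
   (int (fun t => f t * dker r x n t) - g * (n.+1%:R / n.+2%:R) * kerI r x n.+1)
   - g / n.+2%:R * kerI r x n.+1.
  by rewrite -(@natr1 _ n.+1); have ? : 0 <= n.+1%:R :> R by []; field; apply: lt0r_neq0; lra.
apply: le_trans (ler_normB _ _) _.
apply: le_trans (lerD (ker_derivative r0 n cf (ltW e1) C0 fC) (lexx _)) _.
rewrite normrM (gtr0_norm I0) -mulrDl; apply: ler_wpM2r; first exact: ltW.
have : (3 * C / r + `|g|) / n.+1%:R <= e / 2.
  by near: n; apply: near_divn_le; rewrite divr_gt0.
have : (3 * C / r + `|g|) / n.+2%:R <= (3 * C / r + `|g|) / n.+1%:R.
  apply: ler_wpM2l; first by rewrite addr_ge0// mulr_ge0 ?invr_ge0 ?mulr_ge0// ltW.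
  by rewrite lef_pV2 ?posrE// ler_nat.
move=> h1 h2; rewrite normrM normfV (@ger0_norm _ n.+2%:R)//.
apply: (@le_trans _ _ (e / 2 + (3 * C / r + `|g|) / n.+2%:R)); last first.
  by apply: le_trans (lerD (lexx _) (le_trans h1 h2)) _; lra.
rewrite le_eqVlt; apply/orP; left; apply/eqP.
rewrite -(@natr1 _ n.+1); have ? : 0 <= n.+1%:R :> R by [].
by field; rewrite !lt0r_neq0//; lra.
Unshelve. all: by end_near. Qed.

End PointwiseLimits.

(** * Square integrable functions on a circle *)

Section ComplexParts.
Context {R : rcfType}.
Implicit Types z w : R[i].
Local Notation Re := complex.Re.
Local Notation Im := complex.Im.

Lemma ReD z w : Re (z + w) = Re z + Re w. Proof. by case: z; case: w. Qed.
Lemma ImD z w : Im (z + w) = Im z + Im w. Proof. by case: z; case: w. Qed.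
Lemma ReN z : Re (- z) = - Re z. Proof. by case: z. Qed.
Lemma ImN z : Im (- z) = - Im z. Proof. by case: z. Qed.
Lemma ReM z w : Re (z * w) = Re z * Re w - Im z * Im w.
Proof. by case: z; case: w. Qed.
Lemma ImM z w : Im (z * w) = Re z * Im w + Im z * Re w.
Proof. by case: z => a b; case: w => c d /=; rewrite addrC. Qed.
Lemma complex_eq z w : Re z = Re w -> Im z = Im w -> z = w.
Proof. by case: z => a b; case: w => c d /= -> ->. Qed.

Lemma Re_norm_sqr z : Re `|z| ^+ 2 = Re z ^+ 2 + Im z ^+ 2.
Proof. by rewrite normc_def /= sqr_sqrtr// addr_ge0 ?sqr_ge0. Qed.

End ComplexParts.

Section ComplexIntegral.
Context {R : realType}.
Variable r : R.
Hypothesis r0 : 0 < r.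
Local Notation leb := (@lebesgue_measure R).
Local Notation J := (circle_dom r).
Local Notation integ f := (leb.-integrable J (EFin \o f)).
Local Notation int f := (\int[leb]_(x in J) f x).
Local Notation Re := complex.Re.
Local Notation Im := complex.Im.
Implicit Types (f g h xi eta : R -> R[i]) (u v : R -> R).

Let mJ : measurable (J : set (measurableTypeR R)) := measurable_circle_dom r.
Hint Resolve mJ : core.

Definition cmeasurable f :=
  measurable_fun J (fun x => Re (f x)) /\ measurable_fun J (fun x => Im (f x)).

Definition cintegrable f :=
  integ (fun x => Re (f x)) /\ integ (fun x => Im (f x)).

Definition sqmod f x := Re (f x) ^+ 2 + Im (f x) ^+ 2.

Lemma sqmod_ge0 f x : 0 <= sqmod f x.
Proof. by rewrite addr_ge0 ?sqr_ge0. Qed.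

Lemma cmeasurableD f g : cmeasurable f -> cmeasurable g ->
  cmeasurable (fun x => f x + g x).
Proof.
move=> [? ?] [? ?]; split.
- by under eq_fun do rewrite ReD; exact: measurable_funD.
- by under eq_fun do rewrite ImD; exact: measurable_funD.
Qed.

Lemma cmeasurableM f g : cmeasurable f -> cmeasurable g ->
  cmeasurable (fun x => f x * g x).
Proof.
move=> [? ?] [? ?]; split.
- by under eq_fun do rewrite ReM; apply: measurable_funB; exact: measurable_funM.
- by under eq_fun do rewrite ImM; apply: measurable_funD; exact: measurable_funM.
Qed.

Lemma cmeasurable_cst (c : R[i]) : cmeasurable (fun _ => c).
Proof. by split; exact: measurable_cst. Qed.

Lemma cmeasurable_real u : measurable_fun J u -> cmeasurable (fun x => (u x)%:C%C).
Proof. by split => //; exact: measurable_cst. Qed.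

Lemma sqmod_measurable f : cmeasurable f -> measurable_fun J (sqmod f).
Proof. by move=> [? ?]; apply: measurable_funD; exact: measurable_funX. Qed.

Lemma circle_sqnormE f : circle_sqnorm r f =
  ((2 * pi * r)^-1%:E * \int[leb]_(x in J) (sqmod f x)%:E)%E.
Proof.
by rewrite /circle_sqnorm; under eq_integral do rewrite Re_norm_sqr.
Qed.

Lemma circle_sqnorm_ge0 f : (0 <= circle_sqnorm r f)%E.
Proof.
rewrite circle_sqnormE mule_ge0 ?lee_fin ?invr_ge0 ?mulr_ge0 ?(ltW r0) ?pi_ge0//.
by apply: integral_ge0 => x _; rewrite lee_fin sqmod_ge0.
Qed.

Lemma circle_L2P f : circle_L2 r f <-> cmeasurable f /\ integ (sqmod f).
Proof.
have k0 : (0 < (2 * pi * r)^-1)%R by rewrite invr_gt0 !mulr_gt0 ?pi_gt0.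
have H : cmeasurable f -> (integ (sqmod f) <-> (circle_sqnorm r f < +oo)%E).
  move=> mf; rewrite circle_sqnormE; split.
    move=> /integrable_fin_num; have i0 : (0 <= \int[leb]_(x in J) (sqmod f x)%:E)%E.
      by apply: integral_ge0 => x _; rewrite lee_fin sqmod_ge0.
    move=> /(_ mJ); case: (\int[leb]_(x in J) _)%E i0 => // s s0 _.
    by rewrite -EFinM ltry.
  move=> h; apply/integrableP; split.
    by apply/measurable_EFinP; exact: sqmod_measurable.
  under eq_integral do rewrite /= ger0_norm ?sqmod_ge0//.
  rewrite ltNge leye_eq; apply/negP => /eqP ii.
  by move: h; rewrite ii gt0_muley ?lte_fin.
split=> [[m1 m2 fo]|[mf i]]; first by split=> //; apply/H.
by case: (mf) => ? ?; split=> //; exact/H.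
Qed.

Lemma L2_cintegrable f : circle_L2 r f -> cintegrable f.
Proof.
move=> /circle_L2P[[m1 m2] i].
have i1 : integ (fun x => 1 + sqmod f x).
  have := @integrableD _ _ _ leb _ mJ (EFin \o cst 1) (EFin \o sqmod f).
  by apply => //; apply: continuous_integ; exact: within_cst.
have le1 (a b : R) : `|a| <= 1 + (a ^+ 2 + b ^+ 2).
  have := sqr_ge0 (`|a| - 1); have := sqr_ge0 b; have := normr_ge0 a.
  by rewrite -(real_normK (num_real a)); nra.
split; apply: (le_integrable mJ _ _ i1).
- exact/measurable_EFinP.
- move=> x _; rewrite /= lee_fin [X in _ <= X]ger0_norm; first exact: le1.
  by rewrite addr_ge0 ?sqmod_ge0.
- exact/measurable_EFinP.
- move=> x _; rewrite /= lee_fin [X in _ <= X]ger0_norm; last by rewrite addr_ge0 ?sqmod_ge0.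
  by rewrite /sqmod (addrC (_ ^+ 2)); exact: le1.
Qed.

Definition cbounded f := exists2 M, 0 <= M & forall x, J x -> sqmod f x <= M.

Lemma sqmodM f g x : sqmod (fun x => f x * g x) x = sqmod f x * sqmod g x.
Proof. by rewrite /sqmod ReM ImM; ring. Qed.

Lemma sqmodD f g x : sqmod (fun x => f x + g x) x <= 2 * (sqmod f x + sqmod g x).
Proof.
rewrite /sqmod ReD ImD; have := sqr_ge0 (Re (f x) - Re (g x)).
by have := sqr_ge0 (Im (f x) - Im (g x)); lra.
Qed.

Lemma L2_mul f g : cmeasurable f -> cbounded f -> circle_L2 r g ->
  circle_L2 r (fun x => f x * g x).
Proof.
move=> mf [M M0 fM] /circle_L2P[mg ig]; apply/circle_L2P; split.
  exact: cmeasurableM.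
have iM : integ (fun x => M * sqmod g x).
  by exact: (integrableZl mJ M ig).
apply: (le_integrable mJ _ _ iM).
  by apply/measurable_EFinP; apply: sqmod_measurable; exact: cmeasurableM.
move=> x Jx; rewrite /= lee_fin !ger0_norm ?sqmod_ge0 ?mulr_ge0 ?sqmod_ge0//.
by rewrite sqmodM; apply: ler_wpM2r; [exact: sqmod_ge0|exact: fM].
Qed.

Lemma L2_add f g : circle_L2 r f -> circle_L2 r g ->
  circle_L2 r (fun x => f x + g x).
Proof.
move=> /circle_L2P[mf jf] /circle_L2P[mg ig]; apply/circle_L2P; split.
  exact: cmeasurableD.
have iM : integ (fun x => 2 * (sqmod f x + sqmod g x)).
  have := @integrableD _ _ _ leb _ mJ (EFin \o sqmod f) (EFin \o sqmod g) jf ig.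
  by move=> /(@integrableZl _ _ _ leb _ mJ 2).
apply: (le_integrable mJ _ _ iM).
  by apply/measurable_EFinP; apply: sqmod_measurable; exact: cmeasurableD.
move=> x Jx; rewrite /= lee_fin ger0_norm ?sqmod_ge0//.
by apply: le_trans (sqmodD _ _ _) _; exact: ler_norm.
Qed.

Lemma cintD f g : cintegrable f -> cintegrable g ->
  cintegral J (fun x => f x + g x) = cintegral J f + cintegral J g.
Proof.
move=> [f1 f2] [g1 g2]; apply: complex_eq; rewrite ?ReD ?ImD /cintegral/=.
- by under eq_Rintegral do rewrite ReD; rewrite RintegralD.
- by under eq_Rintegral do rewrite ImD; rewrite RintegralD.
Qed.

Lemma integZl k u : integ u -> integ (fun x => k * u x).
Proof. by move=> iu; exact: (integrableZl mJ k iu). Qed.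

Lemma integD u v : integ u -> integ v -> integ (fun x => u x + v x).
Proof.
by move=> iu iv; exact: (integrableD mJ iu iv).
Qed.

Lemma integB u v : integ u -> integ v -> integ (fun x => u x - v x).
Proof.
by move=> iu iv; exact: (integrableB mJ iu iv).
Qed.

Lemma cintegrableZ (c : R[i]) f : cintegrable f -> cintegrable (fun x => c * f x).
Proof.
move=> [f1 f2]; split.
- by under [X in _ \o X]eq_fun do rewrite ReM; apply: integB; exact: integZl.
- by under [X in _ \o X]eq_fun do rewrite ImM; apply: integD; exact: integZl.
Qed.

Lemma cintegrableD f g : cintegrable f -> cintegrable g ->
  cintegrable (fun x => f x + g x).
Proof.
move=> [f1 f2] [g1 g2]; split.
- by under [X in _ \o X]eq_fun do rewrite ReD; exact: integD.
- by under [X in _ \o X]eq_fun do rewrite ImD; exact: integD.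
Qed.

Lemma cintegrable0 : cintegrable (fun _ => 0).
Proof. by split; apply: continuous_integ; exact: within_cst. Qed.

Lemma cintZ (c : R[i]) f : cintegrable f ->
  cintegral J (fun x => c * f x) = c * cintegral J f.
Proof.
move=> [f1 f2]; apply: complex_eq; rewrite ?ReM ?ImM /cintegral/=.
- under eq_Rintegral do rewrite ReM.
  by rewrite RintegralB ?RintegralZl//; exact: integZl.
- under eq_Rintegral do rewrite ImM.
  by rewrite RintegralD ?RintegralZl//; exact: integZl.
Qed.

Lemma cint0 : cintegral J (fun _ => 0) = 0.
Proof.
rewrite -[RHS](mul0r (cintegral J (fun _ => 0))) -(cintZ 0 cintegrable0).
by congr cintegral; apply/funext => x; rewrite mul0r.
Qed.

Lemma cint_sum (I : Type) (s : seq I) (F : I -> R -> R[i]) :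
  (forall i, cintegrable (F i)) ->
  cintegrable (fun x => \sum_(i <- s) F i x) /\
  cintegral J (fun x => \sum_(i <- s) F i x) = \sum_(i <- s) cintegral J (F i).
Proof.
move=> iF; elim: s => [|i s [ih1 ih2]].
  under eq_fun do rewrite big_nil; rewrite big_nil cint0; split => //.
  exact: cintegrable0.
under eq_fun do rewrite big_cons; split; first exact: cintegrableD.
by rewrite cintD// ih2 big_cons.
Qed.

End ComplexIntegral.

(** * Trigonometric polynomials as test functions *)

Section TrigPoly.
Context {R : realType}.
Variable r : R.
Hypothesis r0 : 0 < r.
Local Notation leb := (@lebesgue_measure R).
Local Notation J := (circle_dom r).
Local Notation integ f := (leb.-integrable J (EFin \o f)).
Local Notation Int f := (\int[leb]_(x in J) f x).
Local Notation Re := complex.Re.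
Local Notation Im := complex.Im.
Implicit Types (f g h xi eta : R -> R[i]) (u v : R -> R).
Local Notation trig := (seq (R[i] * int)).

Let mJ : measurable (J : set (measurableTypeR R)) := measurable_circle_dom r.
Hint Resolve mJ : core.

Lemma circle_expD (l m : int) (x : R) :
  circle_exp r (l + m) x = circle_exp r l x * circle_exp r m x.
Proof.
rewrite /circle_exp rmorphD/= !mulrDl.
by apply: complex_eq; rewrite ?ReM ?ImM/= ?cosD ?sinD// addrC.
Qed.

Lemma circle_exp0 (x : R) : circle_exp r 0 x = 1.
Proof. by rewrite /circle_exp !mul0r cos0 sin0. Qed.

Lemma circle_expN (l : int) (x : R) : circle_exp r (- l) x = ((circle_exp r l x)^*)%C.
Proof. by rewrite /circle_exp rmorphN/= !mulNr cosN sinN. Qed.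

Lemma circle_exp_opp (l : int) (x : R) : circle_exp r l (- x) = circle_exp r (- l) x.
Proof. by rewrite /circle_exp rmorphN/= mulrN !mulNr. Qed.

Lemma circle_exp_add (l : int) (x y : R) :
  circle_exp r l (x + y) = circle_exp r l x * circle_exp r l y.
Proof.
rewrite /circle_exp mulrDr mulrDl.
by apply: complex_eq; rewrite ?ReM ?ImM/= ?cosD ?sinD// addrC.
Qed.

Lemma circle_exp_measurable (l : int) : cmeasurable r (circle_exp r l).
Proof.
have c : continuous (fun x : R => l%:~R * x / r).
  by move=> x; apply: cvgM; [apply: cvgM; [exact: cvg_cst|exact: cvg_id]|exact: cvg_cst].
split; apply: measurable_funTS; apply: continuous_measurable_fun => x.
- by apply: (@continuous_comp _ _ _ (fun x : R => l%:~R * x / r) (@cos R)); [exact: c|exact: continuous_cos].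
- by apply: (@continuous_comp _ _ _ (fun x : R => l%:~R * x / r) (@sin R)); [exact: c|exact: continuous_sin].
Qed.

Lemma circle_exp_sqmod (l : int) x : sqmod (circle_exp r l) x = 1.
Proof. by rewrite /sqmod /= cos2Dsin2. Qed.

Lemma circle_exp_bounded (l : int) : cbounded r (circle_exp r l).
Proof. by exists 1 => // x _; rewrite circle_exp_sqmod. Qed.

Definition tpoly (s : trig) x : R[i] := \sum_(p <- s) p.1 * circle_exp r p.2 x.

Definition dtpoly (s : trig) x : R[i] :=
  \sum_(p <- s) p.1 * ((0 +i* (p.2%:~R / r))%C * circle_exp r p.2 x).

Lemma sum_measurable (s : trig) (F : R[i] * int -> R -> R[i]) :
  (forall p, cmeasurable r (F p)) -> cmeasurable r (fun x => \sum_(p <- s) F p x).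
Proof.
move=> mF; elim: s => [|p s ih].
  by under eq_fun do rewrite big_nil; exact: cmeasurable_cst.
by under eq_fun do rewrite big_cons; exact: cmeasurableD.
Qed.

Lemma tpoly_measurable s : cmeasurable r (tpoly s).
Proof.
apply: sum_measurable => p.
by apply: cmeasurableM; [exact: cmeasurable_cst|exact: circle_exp_measurable].
Qed.

Lemma dtpoly_measurable s : cmeasurable r (dtpoly s).
Proof.
apply: sum_measurable => p; do 2 (apply: cmeasurableM; first exact: cmeasurable_cst).
exact: circle_exp_measurable.
Qed.

Lemma circle_exp_L2 xi l : circle_L2 r xi -> circle_L2 r (fun x => circle_exp r l x * xi x).
Proof.
by move=> ?; apply: L2_mul => //; [exact: circle_exp_measurable|exact: circle_exp_bounded].
Qed.

(* Testing D xi = eta against trigonometric polynomials; by linearity this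
   follows from the relation between the Fourier coefficients. *)
Lemma weak_derivative xi eta s : circle_L2 r xi -> circle_L2 r eta ->
  (forall l : int, fourier_coef r eta l =
     ((l%:~R + 2^-1) / r)%:C%C * fourier_coef r xi l) ->
  cintegral J (fun x => tpoly s x * eta x) =
  cintegral J (fun x => ('i%C * dtpoly s x + ((2 * r)^-1)%:C%C * tpoly s x) * xi x).
Proof.
move=> Lxi Leta H.
(* Fourier coefficients pair with conjugate exponentials, hence the sign of [l]. *)
have E l : cintegral J (fun x => circle_exp r l x * eta x) =
    ((- l%:~R + 2^-1) / r)%:C%C * cintegral J (fun x => circle_exp r l x * xi x).
  have := H (- l); rewrite /fourier_coef mulrCA.
  have k0 : ((2 * pi * r)^-1)%:C%C != 0 :> R[i].
    by rewrite fmorph_eq0 invr_eq0 lt0r_neq0// !mulr_gt0// pi_gt0.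
  move=> /(mulfI k0); under [in X in X = _ -> _]eq_fun do rewrite -circle_expN opprK.
  under [in X in _ = X -> _]eq_fun do rewrite -circle_expN opprK.
  by rewrite rmorphN.
have ci f l : circle_L2 r f -> cintegrable r (fun x => circle_exp r l x * f x).
  by move=> Lf; apply: L2_cintegrable => //; exact: circle_exp_L2.
have -> : (fun x => tpoly s x * eta x) =
    (fun x => \sum_(p <- s) p.1 * (circle_exp r p.2 x * eta x)).
  by apply/funext => x; rewrite /tpoly mulr_suml; apply: eq_bigr => p _; rewrite mulrA.
have -> : (fun x => ('i%C * dtpoly s x + ((2 * r)^-1)%:C%C * tpoly s x) * xi x) =
    (fun x => \sum_(p <- s) p.1 * ((- p.2%:~R + 2^-1) / r)%:C%C * (circle_exp r p.2 x * xi x)).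
  apply/funext => x; rewrite /tpoly /dtpoly !mulr_sumr -big_split/= mulr_suml.
  apply: eq_bigr => p _.
  have -> : ((- p.2%:~R + 2^-1) / r)%:C%C =
      'i%C * (0 +i* (p.2%:~R / r))%C + ((2 * r)^-1)%:C%C :> R[i].
    by apply: complex_eq; rewrite ?ReD ?ImD ?ReM ?ImM/=; field; exact: lt0r_neq0.
  move: (_%:C)%C (0 +i* _)%C ('i%C) (circle_exp _ _ _) => k1 k2 k3 k4; ring.
rewrite (cint_sum s (fun p => cintegrableZ p.1 (ci _ p.2 Leta))).2.
rewrite (cint_sum s (fun p => cintegrableZ _ (ci _ p.2 Lxi))).2.
apply: eq_bigr => p _; rewrite !cintZ; [|exact: ci|exact: ci].
by rewrite E mulrA.
Qed.

(** The terms of the expansion of [(1 + cos) ^ n], as coefficients with frequencies. Frequencies may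
    repeat, which avoids binomial coefficients. *)
Fixpoint bker n : trig :=
  if n is n'.+1 then
    flatten [seq [:: p; (p.1 / 2, p.2 + 1); (p.1 / 2, p.2 - 1)] | p <- bker n']
  else [:: (1, 0)].

Lemma bker_sum n (F : R[i] * int -> R[i]) : \sum_(p <- bker n.+1) F p =
  \sum_(p <- bker n) (F p + (F (p.1 / 2, p.2 + 1) + F (p.1 / 2, p.2 - 1))).
Proof.
rewrite /= big_flatten big_map; apply: eq_bigr => p _.
by rewrite !big_cons big_nil /= addr0.
Qed.

Lemma cos_circle_exp (x : R) : (cos (x / r))%:C%C =
  (circle_exp r 1 x + circle_exp r (- 1) x) / 2.
Proof.
by rewrite circle_expN addcJ /circle_exp mul1r /= [RHS]mulrC mulKf//.
Qed.

Lemma sin_circle_exp (x : R) : (- sin (x / r) / r)%:C%C =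
  (0 +i* r^-1)%C * (circle_exp r 1 x - circle_exp r (- 1) x) / 2.
Proof.
rewrite circle_expN subcJ /circle_exp mul1r /=.
have -> : (- sin (x / r) / r)%:C%C = (0 +i* r^-1)%C * ((sin (x / r))%:C%C * 'i%C).
  by apply: complex_eq; rewrite ?ReM ?ImM/=; ring.
by move: (0 +i* r^-1)%C ((sin (x / r))%:C)%C ('i%C) => a b c; field.
Qed.

Lemma tpoly_bker n (u : R) : tpoly (bker n) u = ((1 + cos (u / r)) ^+ n)%:C%C.
Proof.
elim: n => [|n ih]; first by rewrite /tpoly big_seq1/= circle_exp0 mulr1.
rewrite exprSr rmorphM/= -ih /tpoly bker_sum mulr_suml; apply: eq_bigr => p _ /=.
rewrite !circle_expD rmorphD/= cos_circle_exp.
move: (circle_exp _ _ _) (circle_exp _ 1 _) (circle_exp _ (- 1) _) => c1 c2 c3.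
by rewrite rmorph1; field.
Qed.

Lemma dtpoly_bkerS n (u : R) : dtpoly (bker n.+1) u =
  dtpoly (bker n) u * (1 + cos (u / r))%:C%C +
  tpoly (bker n) u * (- sin (u / r) / r)%:C%C.
Proof.
rewrite /dtpoly bker_sum /tpoly !mulr_suml -big_split/=; apply: eq_bigr => p _.
have -> : (1 + cos (u / r))%:C%C = 1 + (circle_exp r 1 u + circle_exp r (- 1) u) / 2 :> R[i].
  by rewrite rmorphD/= cos_circle_exp rmorph1.
rewrite !circle_expD sin_circle_exp.
have -> : (0 +i* ((p.2 + 1)%:~R / r))%C = (0 +i* (p.2%:~R / r))%C + (0 +i* r^-1)%C :> R[i].
  by rewrite intrD; apply: complex_eq; rewrite ?ReD ?ImD/= ?addr0//; ring.
have -> : (0 +i* ((p.2 - 1)%:~R / r))%C = (0 +i* (p.2%:~R / r))%C - (0 +i* r^-1)%C :> R[i].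
  by rewrite intrB; apply: complex_eq; rewrite ?ReD ?ImD ?ReN ?ImN/= ?subr0//; ring.
move: (circle_exp _ _ _) (circle_exp _ 1 _) (circle_exp _ (- 1) _) => c1 c2 c3.
move: (0 +i* _)%C (0 +i* r^-1)%C => c4 c5.
by field.
Qed.

Lemma dtpoly_bker n (u : R) : dtpoly (bker n.+1) u =
  (- (n.+1%:R * (1 + cos (u / r)) ^+ n * sin (u / r) / r))%:C%C.
Proof.
elim: n => [|n ih].
  rewrite dtpoly_bkerS tpoly_bker expr0 {1}/dtpoly big_seq1/=.
  rewrite -[X in X * _ + _](_ : 0 = _); last first.
    by apply: complex_eq; rewrite ?ReM ?ImM/=; ring.
  by rewrite mul0r add0r -rmorphM/=; congr (_%:C)%C; ring.
rewrite dtpoly_bkerS ih tpoly_bker -!rmorphM -rmorphD/=; congr (_%:C)%C.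
by rewrite !exprS -(@natr1 _ n.+1); ring.
Qed.

Definition shiftp (x : R) (s : trig) : trig :=
  [seq (p.1 * circle_exp r (- p.2) x, p.2) | p <- s].

Lemma tpoly_shift x s t : tpoly (shiftp x s) t = tpoly s (t - x).
Proof.
rewrite /tpoly big_map; apply: eq_bigr => p _ /=.
by rewrite circle_exp_add circle_exp_opp; ring.
Qed.

Lemma dtpoly_shift x s t : dtpoly (shiftp x s) t = dtpoly s (t - x).
Proof.
rewrite /dtpoly big_map; apply: eq_bigr => p _ /=.
by rewrite circle_exp_add circle_exp_opp; ring.
Qed.

(* The average of u against the kernel, as a trigonometric polynomial. *)
Definition averagep (u : R -> R) (s : trig) : trig :=
  [seq (p.1 * cintegral J (fun t => (u t)%:C%C * circle_exp r (- p.2) t), p.2) | p <- s].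

Lemma real_circle_exp_cintegrable u l : {within J, continuous u} ->
  cintegrable r (fun t => (u t)%:C%C * circle_exp r l t).
Proof.
move=> cu; apply: L2_cintegrable => //; apply: L2_mul => //.
- by apply: cmeasurable_real; exact: subspace_continuous_measurable_fun.
- have [M M0 uM] := within_bounded r0 cu.
  exists (M ^+ 2); first by rewrite exprn_ge0.
  move=> x Jx; rewrite /sqmod/= expr0n addr0 -real_normK ?num_real// lerXn2r ?nnegrE//.
  exact: uM.
apply/circle_L2P => //; split; first exact: circle_exp_measurable.
have -> : sqmod (circle_exp r l) = cst 1.
  by apply/funext => x; rewrite circle_exp_sqmod.
by apply: continuous_integ; exact: within_cst.
Qed.

Lemma tpoly_average u s x : {within J, continuous u} ->
  tpoly (averagep u s) x = cintegral J (fun t => (u t)%:C%C * tpoly s (x - t)).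
Proof.
move=> cu.
have -> : (fun t => (u t)%:C%C * tpoly s (x - t)) = (fun t => \sum_(p <- s)
    (p.1 * circle_exp r p.2 x) * ((u t)%:C%C * circle_exp r (- p.2) t)).
  apply/funext => t; rewrite /tpoly mulr_sumr; apply: eq_bigr => p _.
  by rewrite circle_exp_add circle_exp_opp; ring.
rewrite (cint_sum s (fun p => cintegrableZ _ (real_circle_exp_cintegrable (- p.2) cu))).2.
rewrite /tpoly big_map; apply: eq_bigr => p _ /=.
by rewrite cintZ ?mulrA; [rewrite mulrAC|exact: real_circle_exp_cintegrable].
Qed.

Lemma dtpoly_average u s x : {within J, continuous u} ->
  dtpoly (averagep u s) x = cintegral J (fun t => (u t)%:C%C * dtpoly s (x - t)).
Proof.
move=> cu.
have -> : (fun t => (u t)%:C%C * dtpoly s (x - t)) = (fun t => \sum_(p <- s)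
    (p.1 * ((0 +i* (p.2%:~R / r))%C * circle_exp r p.2 x)) * ((u t)%:C%C * circle_exp r (- p.2) t)).
  apply/funext => t; rewrite /dtpoly mulr_sumr; apply: eq_bigr => p _.
  by rewrite circle_exp_add circle_exp_opp; ring.
rewrite (cint_sum s (fun p => cintegrableZ _ (real_circle_exp_cintegrable (- p.2) cu))).2.
rewrite /dtpoly big_map; apply: eq_bigr => p _ /=.
by rewrite cintZ ?mulrA; [rewrite -!mulrA; congr (_ * _); rewrite [LHS]mulrC mulrA|exact: real_circle_exp_cintegrable].
Qed.

Lemma cintegral_real u : cintegral J (fun t => (u t)%:C%C) = (Int u)%:C%C.
Proof.
apply: complex_eq => //=.
by rewrite Rintegral_cst// mul0r.
Qed.

End TrigPoly.

(** * Lipschitz functions on a circle *)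

Section LipschitzMultiplier.
Context {R : realType}.
Variable r : R.
Hypothesis r0 : 0 < r.
Local Notation leb := (@lebesgue_measure R).
Local Notation J := (circle_dom r).
Local Notation integ f := (leb.-integrable J (EFin \o f)).
Local Notation Int f := (\int[leb]_(x in J) f x).
Local Notation Re := complex.Re.
Local Notation Im := complex.Im.
Implicit Types (xi eta : R -> R[i]) (u v w : R -> R).
Local Notation trig := (seq (R[i] * int)).

Let mJ : measurable (J : set (measurableTypeR R)) := measurable_circle_dom r.
Hint Resolve mJ : core.

Lemma ae_circle_dom (P : R -> Prop) :
  {ae leb, forall x, x \in `](- (pi * r)), (pi * r)[ -> P x} ->
  {ae leb, forall x, J x -> P x}.
Proof.
have N1 : {ae leb, forall x, x <> pi * r}.
  exists [set pi * r]; split; [exact: measurable_set1|exact: lebesgue_measure_set1|].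
  by move=> x /= h; apply/not_notP => h'; apply: h.
have N2 : {ae leb, forall x, x <> - (pi * r)}.
  exists [set - (pi * r)]; split; [exact: measurable_set1|exact: lebesgue_measure_set1|].
  by move=> x /= h; apply/not_notP => h'; apply: h.
have F := (ae_filter_ringOfSetsType leb).
move=> H; have H' := @filterI _ _ F _ _ N1 (@filterI _ _ F _ _ N2 H).
apply: (@filterS _ _ F _ _ _ H') => x [h1 [h2 h3]] Jx; apply: h3.
move: Jx; rewrite /circle_dom/= !in_itv/= => /andP[a b].
rewrite !lt_neqAle a b !andbT; apply/andP; split; apply/eqP => // h.
by apply: h2.
Qed.

Lemma Rintegral_dominated_cvg (w_ : nat -> R -> R) w v (C : R) :
  (forall n, measurable_fun J (w_ n)) -> measurable_fun J w -> integ v ->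
  (forall n x, J x -> `|w_ n x| <= C) ->
  {ae leb, forall x, J x -> w_ n x @[n --> \oo] --> w x} ->
  Int (fun x => w_ n x * v x) @[n --> \oo] --> Int (fun x => w x * v x).
Proof.
move=> mw_ mw iv wC wcvg.
have mv : measurable_fun J v by apply/measurable_EFinP; exact: measurable_int iv.
have iCv : integ (fun x => C * `|v x|).
  apply: integZl => //; have := integrable_norm iv.
  by apply: eq_integrable.
have ae1 : {ae leb, forall x, J x ->
    (w_ n x * v x)%:E @[n --> \oo] --> (w x * v x)%:E}.
  move: wcvg; apply: filterS; first exact: (ae_filter_ringOfSetsType leb).
  move=> x wx Jx; apply/fine_cvgP; split; first exact: nearW.
  by apply: cvgM; [exact: wx|exact: cvg_cst].
have ae2 : {ae leb, forall x n, J x -> (`|(w_ n x * v x)%:E| <= (C * `|v x|)%:E)%E}.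
  by apply: aeW => x n Jx; rewrite lee_fin normrM ler_wpM2r// wC.
have [if_ _ H] := dominated_convergence mJ
  (fun n => (measurable_EFinP _ _).2 (measurable_funM (mw_ n) mv))
  ((measurable_EFinP _ _).2 (measurable_funM mw mv)) ae1 iCv ae2.
move: H; rewrite -[X in _ --> X]fineK; last exact: integrable_fin_num.
exact: fine_cvg.
Qed.

Lemma e_bounded_L2 xi l : circle_L2 r xi ->
  cintegrable r (fun x => circle_exp r l x * xi x).
Proof. by move=> ?; apply: L2_cintegrable => //; exact: circle_exp_L2. Qed.

(** The mass does not depend on the centre; writing it at centre 0 shows the average to be a
    trigonometric polynomial in [x]. *)
Definition average u n x : R :=
  Int (fun t => u t * (1 + kcos r x t) ^+ n.+1) / kerI r 0 n.+1.

Definition daverage u n x : R := Int (fun t => u t * dker r x n t) / kerI r 0 n.+1.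

Definition avgp u n : trig := averagep r u (bker n.+1).

Lemma tpoly_avgp u n x : {within J, continuous u} ->
  tpoly r (avgp u n) x = (average u n x * kerI r 0 n.+1)%:C%C.
Proof.
move=> cu; rewrite tpoly_average// divfK ?lt0r_neq0 ?kerI_gt0//.
rewrite -cintegral_real; congr cintegral; apply/funext => t.
rewrite tpoly_bker// -rmorphM/= /kcos.
have -> : (t - x) / r = - ((x - t) / r) by rewrite -mulNr opprB.
by rewrite cosN.
Qed.

Lemma dtpoly_avgp u n x : {within J, continuous u} ->
  dtpoly r (avgp u n) x = (daverage u n x * kerI r 0 n.+1)%:C%C.
Proof.
move=> cu; rewrite dtpoly_average// divfK ?lt0r_neq0 ?kerI_gt0//.
rewrite -cintegral_real; congr cintegral; apply/funext => t.
rewrite dtpoly_bker// -rmorphM/= /dker /kcos /ksin; congr (_%:C)%C.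
have -> : (t - x) / r = - ((x - t) / r) by rewrite -mulNr opprB.
by rewrite cosN sinN; ring.
Qed.

Definition mulp (l : int) (s : trig) : trig := [seq (p.1, l + p.2) | p <- s].

Lemma tpoly_mulp l s x : tpoly r (mulp l s) x = circle_exp r l x * tpoly r s x.
Proof.
rewrite /tpoly big_map mulr_sumr; apply: eq_bigr => p _ /=.
by rewrite circle_expD; ring.
Qed.

Lemma dtpoly_mulp l s x : dtpoly r (mulp l s) x =
  circle_exp r l x * ((0 +i* (l%:~R / r))%C * tpoly r s x + dtpoly r s x).
Proof.
rewrite /dtpoly /tpoly big_map mulr_sumr -big_split/= mulr_sumr.
apply: eq_bigr => p _ /=; rewrite circle_expD.
have -> : (0 +i* ((l + p.2)%:~R / r))%C =
    (0 +i* (l%:~R / r))%C + (0 +i* (p.2%:~R / r))%C :> R[i].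
  by rewrite intrD; apply: complex_eq; rewrite ?ReD ?ImD/= ?addr0//; ring.
by ring.
Qed.

Lemma average_le u n x (M : R) : {within J, continuous u} -> 0 <= M ->
  (forall t, J t -> `|u t| <= M) -> J x -> `|average u n x| <= 3 * M.
Proof.
move=> cu M0 uM Jx; have I0 := kerI_gt0 r0 0 n.+1.
rewrite normrM normfV (gtr0_norm I0) ler_pdivrMr//.
have := @ker_average R r r0 u x n.+1 (2 * M) 0 cu; rewrite mul0r addr0.
have H t : J t -> `|u t - u x| <= 2 * M + 0 * (1 - kcos r x t).
  move=> Jt; rewrite mul0r addr0; apply: le_trans (ler_normB _ _) _.
  by have h1 := uM _ Jt; have h2 := uM _ Jx; lra.
move=> /(_ H); rewrite (kerI_center r0 x 0) => h.
have h2 : `|u x * kerI r 0 n.+1| <= M * kerI r 0 n.+1.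
  by rewrite normrM (gtr0_norm I0) ler_wpM2r ?uM// ltW.
have := ler_normD (Int (fun t => u t * (1 + kcos r x t) ^+ n.+1) -
  u x * kerI r 0 n.+1) (u x * kerI r 0 n.+1).
rewrite subrK => h3; apply: le_trans h3 _; apply: le_trans (lerD h h2) _.
by rewrite -mulrDl; apply: ler_wpM2r; [exact: ltW|lra].
Qed.

(** The case [g = 0], [e = 4 * r] of [ker_derivative], by the chord bound. Independence of [n] is
    what dominated convergence asks for. *)
Lemma daverage_le u n x : {within J, continuous u} -> u (pi * r) = u (- (pi * r)) ->
  (forall t y, J t -> J y -> `|u t - u y| <= `|t - y|) -> J x ->
  `|daverage u n x| <= 4.
Proof.
move=> cu up uL Jx; have I0 := kerI_gt0 r0 0 n.+1.
rewrite normrM normfV (gtr0_norm I0) ler_pdivrMr//.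
have r4 : 0 <= 4 * r by rewrite mulr_ge0// ltW.
have := @ker_derivative R r r0 u x n 0 (4 * r) 0 cu r4 (lexx 0).
have H t : J t -> `|u t - u x - 0 * (r * ksin r x t)| <=
    (4 * r + 0 * (1 - kcos r x t)) * `|hsin r x t|.
  by move=> Jt; rewrite !mul0r subr0 addr0; exact: lipschitz_hsin.
move=> /(_ H); rewrite !mul0r subr0 mulr0 mul0r addr0 mulfK ?lt0r_neq0//.
by rewrite (kerI_center r0 x 0).
Qed.


Definition scalep (c : R[i]) (s : trig) : trig := [seq (c * p.1, p.2) | p <- s].

Lemma tpoly_scalep c s x : tpoly r (scalep c s) x = c * tpoly r s x.
Proof.
by rewrite /tpoly big_map mulr_sumr; apply: eq_bigr => p _ /=; rewrite -!mulrA.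
Qed.

Lemma dtpoly_scalep c s x : dtpoly r (scalep c s) x = c * dtpoly r s x.
Proof.
by rewrite /dtpoly big_map mulr_sumr; apply: eq_bigr => p _ /=; rewrite -!mulrA.
Qed.

Definition navgp u n : trig := scalep ((kerI r 0 n.+1)^-1)%:C%C (avgp u n).

Lemma tpoly_navgp u n x : {within J, continuous u} ->
  tpoly r (navgp u n) x = (average u n x)%:C%C.
Proof.
move=> cu; rewrite tpoly_scalep tpoly_avgp// -rmorphM/= mulrC mulfK//.
by rewrite lt0r_neq0// kerI_gt0.
Qed.

Lemma dtpoly_navgp u n x : {within J, continuous u} ->
  dtpoly r (navgp u n) x = (daverage u n x)%:C%C.
Proof.
move=> cu; rewrite dtpoly_scalep dtpoly_avgp// -rmorphM/= mulrC mulfK//.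
by rewrite lt0r_neq0// kerI_gt0.
Qed.

Lemma average_measurable u n : {within J, continuous u} ->
  measurable_fun J (average u n).
Proof.
move=> cu; have [+ _] := tpoly_measurable r (navgp u n).
by congr measurable_fun; apply/funext => x; rewrite tpoly_navgp.
Qed.

Lemma daverage_measurable u n : {within J, continuous u} ->
  measurable_fun J (daverage u n).
Proof.
move=> cu; have [+ _] := dtpoly_measurable r (navgp u n).
by congr measurable_fun; apply/funext => x; rewrite dtpoly_navgp.
Qed.

Lemma bounded_integ w v (C : R) : measurable_fun J w ->
  (forall x, J x -> `|w x| <= C) -> integ v -> integ (fun x => w x * v x).
Proof.
move=> mw wC iv.
have mv : measurable_fun J v by apply/measurable_EFinP; exact: measurable_int iv.
have iCv : integ (fun x => C * `|v x|) by apply: integZl => //; exact: integrable_norm iv.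
apply: (le_integrable mJ _ _ iCv).
  by apply/measurable_EFinP; exact: measurable_funM.
move=> x Jx; rewrite /= lee_fin normrM [X in _ <= X]ger0_norm ?ler_wpM2r ?wC//.
by rewrite mulr_ge0// (le_trans _ (wC _ Jx)).
Qed.

Section Limit.
Variables (u g : R -> R).
Hypothesis cu : {within J, continuous u}.
Hypothesis up : u (pi * r) = u (- (pi * r)).
Hypothesis uL : forall t y, J t -> J y -> `|u t - u y| <= `|t - y|.
Hypothesis mg : measurable_fun J g.
Hypothesis g1 : forall x, J x -> `|g x| <= 1.
Hypothesis dg : {ae leb, forall x, x \in `](- (pi * r)), (pi * r)[ -> is_derive x 1 u (g x)}.

Lemma Int_average_cvg v : integ v ->
  Int (fun x => average u n x * v x) @[n --> \oo] --> Int (fun x => u x * v x).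
Proof.
move=> iv; have [M M0 uM] := within_bounded r0 cu.
apply: (@Rintegral_dominated_cvg _ _ _ (3 * M)) => //.
- by move=> n; exact: average_measurable.
- exact: subspace_continuous_measurable_fun.
- by move=> n x Jx; exact: average_le.
apply: ae_circle_dom; apply: aeW => x xJ.
have := ker_average_cvg r0 cu xJ.
rewrite -cvg_shiftS; apply: cvg_trans; apply: near_eq_cvg; apply: nearW => n.
by rewrite /average (kerI_center r0 0 x).
Qed.

Lemma Int_daverage_cvg v : integ v ->
  Int (fun x => daverage u n x * v x) @[n --> \oo] --> Int (fun x => g x * v x).
Proof.
move=> iv; apply: (@Rintegral_dominated_cvg _ _ _ 4) => //.
- by move=> n; exact: daverage_measurable.
- by move=> n x Jx; exact: daverage_le.
apply: ae_circle_dom.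
move: dg; apply: filterS; first exact: (ae_filter_ringOfSetsType leb).
move=> x dx xJ; have := ker_derivative_cvg r0 cu xJ (dx xJ).
apply: cvg_trans; apply: near_eq_cvg; apply: nearW => n.
by rewrite /daverage (kerI_center r0 0 x).
Qed.

Variables xi eta : R -> R[i].
Hypothesis Lxi : circle_L2 r xi.
Hypothesis Leta : circle_L2 r eta.
Hypothesis H : forall l : int, fourier_coef r eta l =
     ((l%:~R + 2^-1) / r)%:C%C * fourier_coef r xi l.

Let p l x := circle_exp r (- l) x * xi x.
Let v l x := circle_exp r (- l) x * eta x.

(** The averages are trigonometric polynomials, so [weak_derivative] applies to their product with
    an exponential; the product rule produces the complex factor on the right. *)
Lemma average_weak l n :
  cintegral J (fun x => (average u n x)%:C%C * v l x) =
  cintegral J (fun x => (((l%:~R + 2^-1) / r * average u n x) +i* daverage u n x)%C * p l x).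
Proof.
have := weak_derivative r0 (mulp (- l) (navgp u n)) Lxi Leta H.
under [in X in X = _ -> _]eq_fun do rewrite tpoly_mulp tpoly_navgp// -mulrA mulrCA.
move=> ->; congr cintegral; apply/funext => x.
rewrite tpoly_mulp dtpoly_mulp tpoly_navgp// dtpoly_navgp// /p [RHS]mulrA; congr (_ * _).
have -> : (((l%:~R + 2^-1) / r * average u n x) +i* daverage u n x)%C =
    'i%C * ((0 +i* ((- l)%:~R / r))%C * (average u n x)%:C%C + (daverage u n x)%:C%C) +
    ((2 * r)^-1)%:C%C * (average u n x)%:C%C.
  rewrite rmorphN/=.
  by apply: complex_eq; rewrite ?(ReD, ImD, ReM, ImM)/=; field; exact: lt0r_neq0.
ring.
Qed.

(** Dominated convergence in [average_weak], one real integral at a time: almost everywhere the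
    averages tend to [u] and their derivatives to [g]. *)
Lemma limit_weak l :
  cintegral J (fun x => (u x)%:C%C * v l x) =
  cintegral J (fun x => (((l%:~R + 2^-1) / r * u x) +i* g x)%C * p l x).
Proof.
have [ip1 ip2] : cintegrable r (p l) by exact: e_bounded_L2.
have [iv1 iv2] : cintegrable r (v l) by exact: e_bounded_L2.
set k := (l%:~R + 2^-1) / r.
have [M M0 uM] := within_bounded r0 cu.
have ia w n : integ w -> integ (fun x => average u n x * w x).
  apply: (@bounded_integ _ _ (3 * M)) => [|x Jx]; first exact: average_measurable.
  exact: average_le.
have id w n : integ w -> integ (fun x => daverage u n x * w x).
  apply: (@bounded_integ _ _ 4) => [|x Jx]; first exact: daverage_measurable.
  exact: daverage_le.
have iu w : integ w -> integ (fun x => u x * w x).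
  by apply: (@bounded_integ _ _ M) => //; exact: subspace_continuous_measurable_fun.
have ig w : integ w -> integ (fun x => g x * w x).
  by apply: (@bounded_integ _ _ 1).
have linB (w1 w2 : R -> R) : integ w1 -> integ w2 ->
    Int (fun x => k * w1 x - w2 x) = k * Int w1 - Int w2.
  by move=> i1 i2; rewrite RintegralB ?RintegralZl//; exact: integZl.
have linD (w1 w2 : R -> R) : integ w1 -> integ w2 ->
    Int (fun x => k * w1 x + w2 x) = k * Int w1 + Int w2.
  by move=> i1 i2; rewrite RintegralD ?RintegralZl//; exact: integZl.
apply: complex_eq; rewrite /cintegral/=.
- have c1 := Int_average_cvg iv1.
  have c2 : k * Int (fun x => average u n x * Re (p l x)) -
       Int (fun x => daverage u n x * Im (p l x)) @[n --> \oo] -->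
     k * Int (fun x => u x * Re (p l x)) - Int (fun x => g x * Im (p l x)).
    by apply: cvgB; [apply: cvgMr; exact: Int_average_cvg|exact: Int_daverage_cvg].
  have E : (fun n => Int (fun x => average u n x * Re (v l x))) =
      (fun n => k * Int (fun x => average u n x * Re (p l x)) -
                Int (fun x => daverage u n x * Im (p l x))).
    apply/funext => n; have /(congr1 (@complex.Re R)) := average_weak l n; rewrite /cintegral/=.
    under eq_Rintegral do rewrite ReM /= mul0r subr0.
    move=> ->; under eq_Rintegral do rewrite ReM /= -/k -mulrA.
    exact: linB (ia _ n ip1) (id _ n ip2).
  under eq_Rintegral do rewrite ReM /= mul0r subr0.
  under [RHS]eq_Rintegral do rewrite ReM /= -mulrA.
  rewrite (linB _ _ (iu _ ip1) (ig _ ip2)).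
  by move: c1; rewrite E => c1; exact: (cvg_unique _ c1 c2).
- have c1 := Int_average_cvg iv2.
  have c2 : k * Int (fun x => average u n x * Im (p l x)) +
       Int (fun x => daverage u n x * Re (p l x)) @[n --> \oo] -->
     k * Int (fun x => u x * Im (p l x)) + Int (fun x => g x * Re (p l x)).
    by apply: cvgD; [apply: cvgMr; exact: Int_average_cvg|exact: Int_daverage_cvg].
  have E : (fun n => Int (fun x => average u n x * Im (v l x))) =
      (fun n => k * Int (fun x => average u n x * Im (p l x)) +
                Int (fun x => daverage u n x * Re (p l x))).
    apply/funext => n; have /(congr1 (@complex.Im R)) := average_weak l n; rewrite /cintegral/=.
    under eq_Rintegral do rewrite ImM /= mul0r addr0.
    move=> ->; under eq_Rintegral do rewrite ImM /= -/k -mulrA.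
    exact: linD (ia _ n ip2) (id _ n ip1).
  under eq_Rintegral do rewrite ImM /= mul0r addr0.
  under [RHS]eq_Rintegral do rewrite ImM /= -mulrA.
  rewrite (linD _ _ (iu _ ip2) (ig _ ip1)).
  by move: c1; rewrite E => c1; exact: (cvg_unique _ c1 c2).
Qed.

End Limit.

Lemma lipschitz_within u : (forall t y, J t -> J y -> `|u t - u y| <= `|t - y|) ->
  {within J, continuous u}.
Proof.
move=> uL; apply/subspace_continuousP => x Jx; apply/cvgrPdist_le => e e0.
rewrite near_withinE; near=> y => Jy; apply: le_trans (uL _ _ Jx Jy) _.
by near: y; apply: cvgr_dist_le.
Unshelve. all: by end_near. Qed.

(** The commutator with [u] is multiplication by [- i g], where [g] is the derivative of [u] almost
    everywhere, and [|g| <= 1] bounds its norm. So [zeta] is [u eta - i g xi]. *)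
Lemma lipschitz_multiplier u xi eta : u (pi * r) = u (- (pi * r)) ->
  (forall t y, J t -> J y -> `|u t - u y| <= `|t - y|) ->
  circle_L2 r xi -> circle_L2 r eta ->
  (forall l : int, fourier_coef r eta l =
     ((l%:~R + 2^-1) / r)%:C%C * fourier_coef r xi l) ->
  exists zeta, [/\ circle_L2 r (fun x => (u x)%:C%C * xi x), circle_L2 r zeta,
    (forall l : int, fourier_coef r zeta l =
       ((l%:~R + 2^-1) / r)%:C%C * fourier_coef r (fun x => (u x)%:C%C * xi x) l) &
    (circle_sqnorm r (fun x => (zeta x - (u x)%:C%C * eta x)%R) <= circle_sqnorm r xi)%E].
Proof.
move=> up uL Lxi Leta H.
have cu := lipschitz_within uL.
have [M M0 uM] := within_bounded r0 cu.
have uL' : {in `[- (pi * r), pi * r] &, forall x y, `|u x - u y| <= `|x - y|}.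
  by move=> x y xJ yJ; exact: uL.
have [g [mg g1 dg]] := lipschitz_ae_derivable (Npir_lt r0) uL'.
have mgJ : measurable_fun J g by exact: measurable_funTS.
have mu : measurable_fun J u by exact: subspace_continuous_measurable_fun.
have mult w f (C : R) : measurable_fun J w -> 0 <= C -> (forall x, J x -> `|w x| <= C) ->
    circle_L2 r f -> circle_L2 r (fun x => (w x)%:C%C * f x).
  move=> mw C0 wC Lf; apply: L2_mul => //.
  exists (C ^+ 2); first by rewrite exprn_ge0.
  move=> x Jx; rewrite /sqmod/= expr0n addr0 -real_normK ?num_real// lerXn2r ?nnegrE//.
  exact: wC.
have Lu f : circle_L2 r f -> circle_L2 r (fun x => (u x)%:C%C * f x).
  by move=> Lf; apply: (mult _ _ M).
have Lg f : circle_L2 r f -> circle_L2 r (fun x => (0 +i* (- g x))%C * f x).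
  move=> Lf; have -> : (fun x => (0 +i* (- g x))%C * f x) = (fun x => (0 +i* -1)%C * ((g x)%:C%C * f x)).
    by apply/funext => x; rewrite mulrA; congr (_ * _); apply: complex_eq; rewrite ?ReM ?ImM/=; ring.
  apply: L2_mul => //.
    by exists 1 => // x _; rewrite /sqmod/=; lra.
  by apply: (mult _ _ 1).
exists (fun x => (u x)%:C%C * eta x + (0 +i* (- g x))%C * xi x).
split; [exact: Lu|apply: L2_add => //; [exact: Lu|exact: Lg]| |].
  move=> l; rewrite /fourier_coef mulrCA; congr (_ * _).
  have -> : (fun x => (circle_exp r l x)^*%C * ((u x)%:C%C * eta x + (0 +i* (- g x))%C * xi x)) =
    (fun x => (u x)%:C%C * (circle_exp r (- l) x * eta x) + (0 +i* (- g x))%C * (circle_exp r (- l) x * xi x)).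
    by apply/funext => x; rewrite circle_expN; ring.
  have -> : (fun x => (circle_exp r l x)^*%C * ((u x)%:C%C * xi x)) =
      (fun x => (u x)%:C%C * (circle_exp r (- l) x * xi x)).
    by apply/funext => x; rewrite circle_expN mulrCA.
  rewrite cintD; [|by apply: L2_cintegrable => //; apply: Lu; exact: circle_exp_L2|
    by apply: L2_cintegrable => //; apply: Lg; exact: circle_exp_L2].
  rewrite (limit_weak cu up uL mgJ (fun x _ => g1 x) dg Lxi Leta H).
  have Lk : circle_L2 r (fun x => (((l%:~R + 2^-1) / r * u x) +i* g x)%C * (circle_exp r (- l) x * xi x)).
    have -> : (fun x => (((l%:~R + 2^-1) / r * u x) +i* g x)%C * (circle_exp r (- l) x * xi x)) =
      (fun x => (((l%:~R + 2^-1) / r)%:C%C * ((u x)%:C%C * (circle_exp r (- l) x * xi x))) +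
         ((0 +i* 1)%C * ((g x)%:C%C * (circle_exp r (- l) x * xi x)))).
      apply/funext => x; rewrite !mulrA -mulrDl; congr (_ * _); rewrite -mulrDl; congr (_ * _).
      by apply: complex_eq; rewrite ?(ReD, ImD, ReM, ImM)/=; ring.
    have Lp := circle_exp_L2 r0 (- l) Lxi.
    apply: L2_add => //; apply: L2_mul => //; try exact: cmeasurable_cst.
    - by exists (sqmod (fun _ => ((l%:~R + 2^-1) / r)%:C%C) 0); [exact: sqmod_ge0|].
    - exact: Lu.
    - by exists 1 => // x _; rewrite /sqmod/=; lra.
    - by apply: (mult _ _ 1).
  rewrite -cintD; [|exact: L2_cintegrable|
    by apply: L2_cintegrable => //; apply: Lg; exact: circle_exp_L2].
  rewrite -cintZ; [|by apply: L2_cintegrable => //; apply: Lu; exact: circle_exp_L2].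
  congr cintegral; apply/funext => x.
  rewrite [RHS]mulrA -mulrDl; congr (_ * _).
  by apply: complex_eq; rewrite ?(ReD, ImD, ReM, ImM)/=; ring.
have -> : (fun x => (u x)%:C%C * eta x + (0 +i* (- g x))%C * xi x - (u x)%:C%C * eta x) =
    (fun x => (0 +i* (- g x))%C * xi x).
  by apply/funext => x; rewrite addrAC subrr add0r.
rewrite !circle_sqnormE//; apply: lee_wpmul2l.
  by rewrite lee_fin invr_ge0 !mulr_ge0 ?pi_ge0// ltW.
apply: ge0_le_integral => //.
- by move=> x _; rewrite lee_fin sqmod_ge0.
- by have /circle_L2P[|/sqmod_measurable + _] := Lg _ Lxi => // ?; exact/measurable_EFinP.
- by have /circle_L2P[|/sqmod_measurable + _] := Lxi => // ?; exact/measurable_EFinP.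
move=> x Jx; rewrite lee_fin sqmodM -[X in _ <= X]mul1r.
apply: ler_wpM2r; first exact: sqmod_ge0.
rewrite /sqmod/= expr0n add0r sqrrN -real_normK ?num_real//.
by rewrite expr_le1.
Qed.

End LipschitzMultiplier.

(** * From a commutator bound to a Lipschitz bound *)

Section MultiplierLipschitz.
Context {R : realType}.
Variable r : R.
Hypothesis r0 : 0 < r.
Local Notation leb := (@lebesgue_measure R).
Local Notation J := (circle_dom r).
Local Notation integ f := (leb.-integrable J (EFin \o f)).
Local Notation Int f := (\int[leb]_(x in J) f x).
Local Notation Re := complex.Re.
Local Notation Im := complex.Im.
Implicit Types (xi eta : R -> R[i]) (u v w : R -> R).
Local Notation trig := (seq (R[i] * int)).

Let mJ : measurable (J : set (measurableTypeR R)) := measurable_circle_dom r.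
Hint Resolve mJ : core.

Lemma circle_exp_periodic (l : int) : circle_exp r l (pi * r) = circle_exp r l (- (pi * r)).
Proof.
have e1 : circle_exp r 1 (pi * r) = circle_exp r 1 (- (pi * r)).
  rewrite /circle_exp !mul1r mulNr mulfK ?lt0r_neq0//.
  by rewrite cosN sinN sinpi oppr0.
have e2 (n : nat) : circle_exp r n (pi * r) = circle_exp r n (- (pi * r)).
  elim: n => [|n ih]; first by rewrite !circle_exp0.
  by rewrite -addn1 PoszD !circle_expD ih e1.
case: l => n; first exact: e2.
by rewrite NegzE !circle_expN e2.
Qed.

Lemma is_derive_Re_tpoly (s : trig) (x : R) :
  is_derive x 1 (fun x : R => Re (tpoly r s x)) (Re (dtpoly r s x)).
Proof.
have dE (l : int) : is_derive x 1 (fun x : R => cos (l%:~R * x / r)) (- sin (l%:~R * x / r) * (l%:~R / r)) /\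
    is_derive x 1 (fun x : R => sin (l%:~R * x / r)) (cos (l%:~R * x / r) * (l%:~R / r)).
  have dA : is_derive x 1 (fun x : R => l%:~R * x / r) (l%:~R / r).
    have -> : (fun x : R => l%:~R * x / r) = (l%:~R / r) *: id.
      by apply/funext => y; rewrite /GRing.scale/= mulrAC.
    by apply: is_derive_eq; rewrite /GRing.scale/= mulr1.
  split.
    exact: (@is_derive1_comp _ cos (fun x => l%:~R * x / r) x _ _ (is_derive_cos _) dA).
  exact: (@is_derive1_comp _ sin (fun x => l%:~R * x / r) x _ _ (is_derive_sin _) dA).
elim: s => [|p s ih].
  have -> : (fun x => Re (tpoly r [::] x)) = cst 0.
    by apply/funext => y; rewrite /tpoly big_nil.
  by rewrite /dtpoly big_nil; exact: is_derive_cst.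
have [dc ds] := dE p.2.
have -> : (fun x => Re (tpoly r (p :: s) x)) =
    (Re p.1 *: (fun x => cos (p.2%:~R * x / r)) - Im p.1 *: (fun x => sin (p.2%:~R * x / r)))
    + (fun x => Re (tpoly r s x)).
  apply/funext => y; rewrite /tpoly big_cons ReD ReM /circle_exp/=.
  by [].
apply: is_derive_eq; rewrite /GRing.scale/=.
rewrite {2}/dtpoly big_cons ReD; congr (_ + _).
rewrite !ReM !ImM /circle_exp/=; ring.
Qed.

Lemma circle_exp_int0 (l : int) : l != 0 -> cintegral J (circle_exp r l) = 0.
Proof.
move=> l0.
have cE (s : trig) : continuous (fun x => Re (tpoly r s x)).
  move=> x; apply: differentiable_continuous; apply/derivable1_diffP.
  by case: (is_derive_Re_tpoly s x).
have lr0 : l%:~R / r != 0 by apply: mulf_neq0; [rewrite intr_eq0|rewrite invr_eq0; exact: lt0r_neq0].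
have H (c : R[i]) : Re (c * circle_exp r l (pi * r)) - Re (c * circle_exp r l (- (pi * r))) =
    Int (fun x => Re (c * ((0 +i* (l%:~R / r))%C * circle_exp r l x))).
  have e1 : (fun x => Re (tpoly r [:: (c, l)] x)) = (fun x => Re (c * circle_exp r l x)).
    by apply/funext => x; rewrite /tpoly big_seq1.
  have e2 : (fun x => Re (dtpoly r [:: (c, l)] x)) =
      (fun x => Re (c * ((0 +i* (l%:~R / r))%C * circle_exp r l x))).
    by apply/funext => x; rewrite /dtpoly big_seq1.
  have e3 : (fun x => Re (dtpoly r [:: (c, l)] x)) =
      (fun x => Re (tpoly r [:: (c * (0 +i* (l%:~R / r))%C, l)] x)).
    by apply/funext => x; rewrite /dtpoly /tpoly !big_seq1 mulrA.
  rewrite -e2 (Rintegral_derive r0 (is_derive_Re_tpoly [:: (c, l)])).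
    by rewrite /tpoly !big_seq1.
  by rewrite e3; exact: cE.
have K (c : R[i]) : Int (fun x => Re (c * circle_exp r l x)) = 0.
  have := H (c / (0 +i* (l%:~R / r))%C); rewrite circle_exp_periodic subrr => /esym.
  have -> // : (fun x => Re (c / (0 +i* (l%:~R / r))%C * ((0 +i* (l%:~R / r))%C * circle_exp r l x))) =
      (fun x => Re (c * circle_exp r l x)).
  apply/funext => x; congr complex.Re; rewrite mulrA divfK//.
  by apply/eqP => /(congr1 (@complex.Im R))/= /eqP; apply/negP.
apply: complex_eq; rewrite /cintegral/=.
  by rewrite -[RHS](K 1); apply: eq_Rintegral => x _; rewrite mul1r.
rewrite -[RHS](K (0 -i* 1)%C); apply: eq_Rintegral => x _; rewrite ReM /=; ring.
Qed.

(* Trigonometric polynomials lie in the domain of D. *)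
Lemma tpoly_fourier (s : trig) (l : int) :
  fourier_coef r (fun x => - 'i%C * dtpoly r s x + ((2 * r)^-1)%:C%C * tpoly r s x) l =
  ((l%:~R + 2^-1) / r)%:C%C * fourier_coef r (tpoly r s) l.
Proof.
have L1 : circle_L2 r (fun _ => 1).
  apply/circle_L2P => //; split; first exact: cmeasurable_cst.
  by rewrite /sqmod/=; apply: continuous_integ; exact: within_cst.
have ci k : cintegrable r (circle_exp r k).
  have := e_bounded_L2 r0 k L1.
  by congr cintegrable; apply/funext => x; rewrite mulr1.
rewrite /fourier_coef mulrCA; congr (_ * _).
have -> : (fun x => (circle_exp r l x)^*%C * (- 'i%C * dtpoly r s x + ((2 * r)^-1)%:C%C * tpoly r s x)) =
    (fun x => \sum_(p <- s) p.1 * ((p.2%:~R + 2^-1) / r)%:C%C * circle_exp r (p.2 - l) x).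
  apply/funext => x; rewrite -circle_expN /dtpoly /tpoly !mulr_sumr -big_split/= mulr_sumr.
  apply: eq_bigr => p _; rewrite circle_expD.
  have -> : ((p.2%:~R + 2^-1) / r)%:C%C =
      - 'i%C * (0 +i* (p.2%:~R / r))%C + ((2 * r)^-1)%:C%C :> R[i].
    by apply: complex_eq; rewrite ?(ReD, ImD, ReM, ImM, ReN, ImN)/=; field; exact: lt0r_neq0.
  move: (circle_exp r (- l) x) (0 +i* (p.2%:~R / r))%C (((2 * r)^-1)%:C)%C ('i%C) (circle_exp r p.2 x) => k1 k2 k3 k4 k5; ring.
have -> : (fun x => (circle_exp r l x)^*%C * tpoly r s x) =
    (fun x => \sum_(p <- s) p.1 * circle_exp r (p.2 - l) x).
  apply/funext => x; rewrite -circle_expN /tpoly mulr_sumr.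
  by apply: eq_bigr => p _; rewrite circle_expD; ring.
rewrite (cint_sum s (fun p => cintegrableZ _ (ci (p.2 - l)))).2.
rewrite (cint_sum s (fun p => cintegrableZ p.1 (ci (p.2 - l)))).2 mulr_sumr.
apply: eq_bigr => p _; rewrite !cintZ//.
have [->|pl] := eqVneq p.2 l; first by rewrite mulrCA mulrA.
by rewrite circle_exp_int0 ?subr_eq0// !mulr0.
Qed.


Lemma tpoly_L2 s : circle_L2 r (tpoly r s).
Proof.
have L1 : circle_L2 r (fun _ => 1).
  apply/circle_L2P => //; split; first exact: cmeasurable_cst.
  by rewrite /sqmod/=; apply: continuous_integ; exact: within_cst.
elim: s => [|p s ih].
  have -> : tpoly r [::] = (fun x => (0 : R[i]) * (1 : R[i])).
    by apply/funext => x; rewrite /tpoly big_nil mul0r.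
  by apply: L2_mul => //; exists 0 => // x _; rewrite /sqmod/=; lra.
have -> : tpoly r (p :: s) = (fun x => p.1 * (circle_exp r p.2 x * 1) + tpoly r s x).
  by apply/funext => x; rewrite /tpoly big_cons mulr1.
apply: L2_add => //; apply: L2_mul => //.
  by exists (sqmod (fun=> p.1) 0); [exact: sqmod_ge0|].
exact: circle_exp_L2.
Qed.

Lemma dtpoly_tpoly s : dtpoly r s =
  tpoly r [seq (p.1 * (0 +i* (p.2%:~R / r))%C, p.2) | p <- s].
Proof.
by apply/funext => x; rewrite /dtpoly /tpoly big_map; apply: eq_bigr => p _ /=; rewrite mulrA.
Qed.

Lemma cmul_L2 (c : R[i]) f : circle_L2 r f -> circle_L2 r (fun x => c * f x).
Proof.
move=> Lf; apply: L2_mul => //.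
by exists (sqmod (fun=> c) 0); [exact: sqmod_ge0|].
Qed.

Lemma mulr_le_half_sqr (a b c : R) : b ^+ 2 <= c -> a * b <= 2^-1 * (a ^+ 2 + c).
Proof. by have := sqr_ge0 (a - b); nra. Qed.

Lemma within_modulus u x : {within J, continuous u} -> J x -> forall e, 0 < e ->
  exists2 d, 0 < d & forall z, J z -> `|x - z| < d -> `|u x - u z| <= e.
Proof.
move=> /subspace_continuousP cu Jx e e0.
have /cvgrPdist_le /(_ _ e0) := cu _ Jx; rewrite near_withinE => -[d /= d0 H].
by exists d => // z Jz zd; exact: H.
Qed.

(** Up to the mass, the integral in the hypothesis is the derivative of the average at [x], which is
    thus at most 1 in absolute value. *)
Lemma average_lipschitz u n : {within J, continuous u} ->
  (forall x, `|Int (fun t => u t * dker r x n t)| <= kerI r x n.+1) ->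
  forall x y, `|average r u n x - average r u n y| <= `|x - y|.
Proof.
move=> cu H x y.
have dA (z : R) : is_derive z 1 (average r u n) (daverage r u n z).
  have -> : average r u n = (fun x => Re (tpoly r (navgp r u n) x)).
    by apply/funext => t; rewrite tpoly_navgp.
  have -> : daverage r u n z = Re (dtpoly r (navgp r u n) z) by rewrite dtpoly_navgp.
  exact: is_derive_Re_tpoly.
have dle z : `|daverage r u n z| <= 1.
  rewrite normrM normfV (gtr0_norm (kerI_gt0 r0 _ _)) ler_pdivrMr ?kerI_gt0// mul1r.
  by rewrite (kerI_center r0 0 z).
wlog xy : x y / y <= x => [W|].
  have [/W//|/ltW /W] := leP y x.
  by rewrite distrC (distrC x).
have cA : {within `[y, x], continuous (average r u n)}.
  apply: continuous_subspaceT => z; apply: differentiable_continuous; apply/derivable1_diffP.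
  by case: (dA z).
have [c _ ->] := MVT_segment xy (fun z _ => dA z) cA.
by rewrite normrM ler_piMl.
Qed.

(** The index is odd because the kernel has to be the square of a test vector; a subsequence
    suffices for the limit. The averages converge at interior points, and the end points follow by
    continuity. *)
Lemma averages_lipschitz u : {within J, continuous u} ->
  (forall x m, `|Int (fun t => u t * dker r x m.*2.+1 t)| <= kerI r x m.*2.+2) ->
  forall x y, J x -> J y -> `|u x - u y| <= `|x - y|.
Proof.
move=> cu H.
have Hi x y : x \in `](- (pi * r)), (pi * r)[ -> y \in `](- (pi * r)), (pi * r)[ ->
    `|u x - u y| <= `|x - y|.
  have c z : z \in `](- (pi * r)), (pi * r)[ -> average r u m.*2.+1 z @[m --> \oo] --> u z.
    move=> zJ; have := ker_average_cvg r0 cu zJ.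
    have sub : (fun m => m.*2.+2) @ \oo --> \oo.
      apply/cvgnyPge => A; near=> m; have : (A <= m)%N by near: m; exact: nbhs_infty_ge.
      by move=> Am; apply: (leq_trans Am); rewrite -addnn; do 2 apply: leqW; exact: leq_addr.
    move=> h; have := cvg_comp _ _ sub h.
    apply: cvg_trans; apply: near_eq_cvg; apply: nearW => m /=.
    by rewrite /average (kerI_center r0 0 z).
  move=> xJ yJ.
  have h : `|average r u m.*2.+1 x - average r u m.*2.+1 y| @[m --> \oo] --> `|u x - u y|.
    by apply: cvg_norm; apply: cvgB; exact: c.
  apply: (cvgr_to_le h); apply: nearW => m /=.
  by apply: average_lipschitz => // z; exact: H.
move=> x y Jx Jy; apply/ler_addgt0Pr => e e0.
have e2 : 0 < e / 2 by rewrite divr_gt0.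
have [d1 d10 H1] := within_modulus cu Jx e2.
have [d2 d20 H2] := within_modulus cu Jy e2.
have pr0 := pir_gt0 r0.
have pr2 : 0 < 2 * (pi * r) by rewrite mulr_gt0.
(* Contraction by [1 - t] moves [x] and [y] into the interior and changes [u] by at most [e / 2] at
   each of them. *)
pose t := Num.min (1 / 2) (Num.min d1 d2 / (2 * (pi * r))).
have dm0 : 0 < Num.min d1 d2 by rewrite lt_min d10.
have t0 : 0 < t by rewrite lt_min divr_gt0//= divr_gt0.
have t1 : t <= 1 / 2 by rewrite ge_min lexx.
have t2 : t * (pi * r) < Num.min d1 d2.
  have : t <= Num.min d1 d2 / (2 * (pi * r)) by rewrite ge_min lexx orbT.
  rewrite ler_pdivlMr// => h; apply: lt_le_trans h.
  by rewrite (ltr_pM2l t0); lra.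
have key z d : J z -> Num.min d1 d2 <= d -> `|z - (1 - t) * z| < d /\
    (1 - t) * z \in `](- (pi * r)), (pi * r)[.
  move=> /circle_domP zJ zd.
  have zt : `|t * z| <= t * (pi * r) by rewrite normrM (gtr0_norm t0) ler_wpM2l// ltW.
  split.
    have -> : z - (1 - t) * z = t * z by ring.
    by apply: le_lt_trans zt _; exact: lt_le_trans t2 zd.
  rewrite in_itv/= -ltr_norml normrM ger0_norm; last by lra.
  apply: le_lt_trans (ler_wpM2l _ zJ) _; first by lra.
  by rewrite gtr_pMl//; lra.
have m1 : Num.min d1 d2 <= d1 by rewrite ge_min lexx.
have m2 : Num.min d1 d2 <= d2 by rewrite ge_min lexx orbT.
have [x1 x2] := key _ _ Jx m1; have [y1 y2] := key _ _ Jy m2.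
have sub z : z \in `](- (pi * r)), (pi * r)[ -> J z by exact: subset_itv_oo_cc.
have a1 := H1 _ (sub _ x2) x1; have a2 := H2 _ (sub _ y2) y1.
have a3 := Hi _ _ x2 y2.
have -> : u x - u y = (u x - u ((1 - t) * x)) + (u ((1 - t) * x) - u ((1 - t) * y)) - (u y - u ((1 - t) * y)).
  by ring.
apply: le_trans (ler_normB _ _) _.
have a4 := ler_normD (u x - u ((1 - t) * x)) (u ((1 - t) * x) - u ((1 - t) * y)).
have a5 : `|(1 - t) * x - (1 - t) * y| <= `|x - y|.
  rewrite -mulrBr normrM ler_piMl// ger0_norm; lra.
move: a1 a2 a3 a4 a5.
move: (`|u x - u ((1 - t) * x)|) (`|u y - u ((1 - t) * y)|) => b1 b2 h1 h2 h3 h4 h5.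
have : e = e / 2 + e / 2 by rewrite -splitr.
by move=> ee; apply: le_trans (lerD h4 (lexx _)) _; lra.
Unshelve. all: by end_near. Qed.

Section Bound.
Variable F : R -> R[i].
Hypothesis cRe : {within J, continuous (fun x => Re (F x))}.
Hypothesis cIm : {within J, continuous (fun x => Im (F x))}.
Hypothesis comm : forall xi eta, circle_L2 r xi -> circle_L2 r eta ->
  (forall l : int, fourier_coef r eta l =
     ((l%:~R + 2^-1) / r)%:C%C * fourier_coef r xi l) ->
  exists zeta, [/\ circle_L2 r (fun x => F x * xi x), circle_L2 r zeta,
    (forall l : int, fourier_coef r zeta l =
       ((l%:~R + 2^-1) / r)%:C%C * fourier_coef r (fun x => F x * xi x) l) &
    (circle_sqnorm r (fun x => (zeta x - F x * eta x)%R) <= circle_sqnorm r xi)%E].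

Lemma cF : cmeasurable r F.
Proof. by split; exact: subspace_continuous_measurable_fun. Qed.

Lemma bF : cbounded r F.
Proof.
have [M M0 HM] := within_bounded r0 cRe; have [N N0 HN] := within_bounded r0 cIm.
exists (M ^+ 2 + N ^+ 2); first by rewrite addr_ge0 ?sqr_ge0.
move=> x Jx; apply: lerD.
  by rewrite -real_normK ?num_real// lerXn2r ?nnegrE//; exact: HM.
by rewrite -real_normK ?num_real// lerXn2r ?nnegrE//; exact: HN.
Qed.

(* Take xi = psi, the square root of the kernel centred at x0, and pair the
   commutator with psi: what remains is the integral of F (psi^2)'. *)
Lemma commutator_pairing x0 m (w := fun x => (1 + kcos r x0 x) ^+ m.+1) :
  exists omega : R -> R[i], [/\ circle_L2 r omega,
    (\int[leb]_(x in J) (sqmod omega x)%:E <= \int[leb]_(x in J) ((w x) ^+ 2)%:E)%E &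
    cintegral J (fun x => (w x)%:C%C * omega x) =
    cintegral J (fun x => (0 +i* (- dker r x0 m.*2.+1 x))%C * F x)].
Proof.
pose s := shiftp r x0 (bker m.+1).
have tE x : tpoly r s x = (w x)%:C%C by rewrite tpoly_shift tpoly_bker.
have dE x : dtpoly r s x = (- dker r x0 m x)%:C%C by rewrite dtpoly_shift dtpoly_bker.
pose xi := tpoly r s.
pose eta := fun x => - 'i%C * dtpoly r s x + ((2 * r)^-1)%:C%C * tpoly r s x.
have Lxi : circle_L2 r xi by exact: tpoly_L2.
have Leta : circle_L2 r eta.
  by apply: L2_add => //; apply: cmul_L2; rewrite ?dtpoly_tpoly; exact: tpoly_L2.
have [zeta [L1 Lz H1 H2]] := comm Lxi Leta (tpoly_fourier s).
have LFe : circle_L2 r (fun x => F x * eta x) by apply: L2_mul => //; [exact: cF|exact: bF].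
have omegaE : (fun x => zeta x - F x * eta x) = (fun x => zeta x + (-1) * (F x * eta x)).
  by apply/funext => x; rewrite mulN1r.
have Lo : circle_L2 r (fun x => zeta x - F x * eta x).
  by rewrite omegaE; apply: L2_add => //; exact: cmul_L2.
exists (fun x => zeta x - F x * eta x); split => //.
  move: H2; rewrite !circle_sqnormE// lee_pmul2l//; last first.
    by rewrite lte_fin invr_gt0 !mulr_gt0// pi_gt0.
  have -> // : (fun x => (sqmod xi x)%:E) = (fun x => ((w x) ^+ 2)%:E).
  by apply/funext => x; rewrite /sqmod /xi tE/= expr0n addr0.
have W := weak_derivative r0 s L1 Lz H1.
have Lw (v : R -> R) f : {within J, continuous v} -> circle_L2 r f ->
    circle_L2 r (fun x => (v x)%:C%C * f x).
  move=> cv Lf; apply: L2_mul => //.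
    by apply: cmeasurable_real; exact: subspace_continuous_measurable_fun.
  have [M M0 vM] := within_bounded r0 cv.
  exists (M ^+ 2); first exact: sqr_ge0.
  move=> x Jx; rewrite /sqmod/= expr0n addr0 -real_normK ?num_real// lerXn2r ?nnegrE//.
  exact: vM.
have cw : {within J, continuous w} by exact: within_ker.
have cd : {within J, continuous (fun x => - dker r x0 m x)}.
  by move=> t; apply: cvgN; exact: within_dker.
have -> : (fun x => (w x)%:C%C * (zeta x - F x * eta x)) =
    (fun x => tpoly r s x * zeta x + (-1) * ((w x)%:C%C * (F x * eta x))).
  by apply/funext => x; rewrite tE mulN1r mulrBr.
have i1 : cintegrable r (fun x => tpoly r s x * zeta x).
  have -> : (fun x => tpoly r s x * zeta x) = (fun x => (w x)%:C%C * zeta x).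
    by apply/funext => x; rewrite tE.
  by apply: L2_cintegrable => //; exact: Lw.
have i2 : cintegrable r (fun x => (-1) * ((w x)%:C%C * (F x * eta x))).
  by apply: cintegrableZ; apply: L2_cintegrable => //; exact: Lw.
rewrite (cintD i1 i2) W.
have i3 : cintegrable r (fun x => ('i%C * dtpoly r s x + ((2 * r)^-1)%:C%C * tpoly r s x) * (F x * xi x)).
  have -> : (fun x => ('i%C * dtpoly r s x + ((2 * r)^-1)%:C%C * tpoly r s x) * (F x * xi x)) =
      (fun x => 'i%C * ((- dker r x0 m x)%:C%C * (F x * xi x)) +
                ((2 * r)^-1)%:C%C * ((w x)%:C%C * (F x * xi x))).
    by apply/funext => x; rewrite tE dE mulrDl !mulrA.
  by apply: cintegrableD; apply: cintegrableZ; apply: L2_cintegrable => //; exact: Lw.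
(* The multiples of [1 / (2 * r)] cancel in the difference, and the two derivative terms, of equal
   sign, add up to [2 i w w'] times [F]. *)
rewrite -(cintD i3 i2); congr cintegral; apply/funext => x; rewrite /eta /xi !tE dE.
have -> : dker r x0 m.*2.+1 x = 2 * (w x * dker r x0 m x).
  rewrite /dker /w.
  have -> : m.*2.+1 = (m.+1 + m)%N by rewrite addSn addnn.
  have -> : (m.+1 + m).+1%:R = 2 * m.+1%:R :> R.
    by rewrite addSn addnn -natrM mul2n doubleS.
  by rewrite exprD; ring.
have -> : (0 +i* (- (2 * (w x * dker r x0 m x))))%C =
    2 * ('i%C * ((w x)%:C%C * (- dker r x0 m x)%:C%C)) :> R[i].
  by apply: complex_eq; rewrite ?(ReD, ImD, ReM, ImM, ReN, ImN)/=; ring.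
move: ((w x)%:C)%C ((- dker r x0 m x)%:C)%C (((2 * r)^-1)%:C)%C ('i%C) (F x) => k1 k2 k3 k4 k5; ring.
Qed.

(** The integrals of [w ^ 2] and of [sqmod omega] are both at most [kerI r x0 n.+1], so
    [a b <= (a ^ 2 + b ^ 2) / 2] bounds the pairing by the same number and replaces the
    Cauchy-Schwarz inequality. *)
Lemma int_dker_le x0 m (n := m.*2.+1) :
  `|Int (fun x => Re (F x) * dker r x0 n x)| <= kerI r x0 n.+1 /\
  `|Int (fun x => Im (F x) * dker r x0 n x)| <= kerI r x0 n.+1.
Proof.
have [omega [Lo oE wE]] := commutator_pairing x0 m.
set w := fun x => (1 + kcos r x0 x) ^+ m.+1 in oE wE.
have cw : {within J, continuous w} by exact: within_ker.
have [mo io] := (circle_L2P r0 omega).1 Lo.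
have iw2 : integ (fun x => w x ^+ 2).
  by apply: continuous_integ; under eq_fun do rewrite expr2; exact: withinM.
have wI : Int (fun x => w x ^+ 2) = kerI r x0 n.+1.
  apply: eq_Rintegral => x _; rewrite /w -exprM.
  by rewrite muln2 doubleS.
have oI : Int (sqmod omega) <= kerI r x0 n.+1.
  rewrite -wI /Rintegral fine_le//; exact: integrable_fin_num.
have bound (v : R -> R) : measurable_fun J v -> (forall x, v x ^+ 2 <= sqmod omega x) ->
    `|Int (fun x => w x * v x)| <= kerI r x0 n.+1.
  move=> mv vo.
  have ih : integ (fun x => 2^-1 * (w x ^+ 2 + sqmod omega x)).
    by apply: integZl => //; exact: integD.
  have le2 x : `|w x * v x| <= 2^-1 * (w x ^+ 2 + sqmod omega x).
    rewrite normrM -(real_normK (num_real (w x))); apply: mulr_le_half_sqr.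
    by rewrite real_normK ?num_real.
  have mwv : measurable_fun J (fun x => w x * v x).
    by apply: measurable_funM => //; exact: subspace_continuous_measurable_fun.
  have iwv : integ (fun x => w x * v x).
    apply: (le_integrable mJ _ _ ih); first exact/measurable_EFinP.
    move=> x Jx; rewrite /= lee_fin [X in _ <= X]ger0_norm//.
    by apply: le_trans (le2 x); exact: normr_ge0.
  apply: le_trans (le_normr_Rintegral mJ iwv) _.
  apply: (@le_trans _ _ (Int (fun x => 2^-1 * (w x ^+ 2 + sqmod omega x)))).
    apply: le_Rintegral => //; exact: integrable_norm.
  rewrite RintegralZl//; last exact: integD.
  by rewrite RintegralD// wI mulrC ler_pdivrMr// mulr_natr mulr2n lerD2l.
have /(congr1 (@complex.Re R)) := wE; rewrite /cintegral/=.
under eq_Rintegral do rewrite ReM /= mul0r subr0.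
under [in X in _ = X -> _]eq_Rintegral do rewrite ReM /= mul0r sub0r mulNr opprK mulrC.
move=> e1.
have /(congr1 (@complex.Im R)) := wE; rewrite /cintegral/=.
under eq_Rintegral do rewrite ImM /= mul0r addr0.
under [in X in _ = X -> _]eq_Rintegral do rewrite ImM /= mul0r add0r mulNr mulrC -mulrN.
move=> e2.
split; last first.
  rewrite -e1; apply: bound; first by case: mo.
  by move=> x; rewrite lerDl sqr_ge0.
have -> : Int (fun x => Re (F x) * dker r x0 n x) = - Int (fun x => Re (F x) * - dker r x0 n x).
  have id : integ (fun x => Re (F x) * dker r x0 n x).
    by apply: continuous_integ; apply: withinM => //; exact: within_dker.
  rewrite -[RHS]mulN1r -RintegralZl//; last first.
    have -> : (fun x => Re (F x) * - dker r x0 n x) = (fun x => (-1) * (Re (F x) * dker r x0 n x)).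
      by apply/funext => x; ring.
    exact: integZl.
  by apply: eq_Rintegral => x _; ring.
rewrite normrN -e2; apply: bound; first by case: mo.
by move=> x; rewrite lerDr sqr_ge0.
Qed.

Lemma multiplier_lipschitz x y : J x -> J y ->
  `|Re (F x) - Re (F y)| <= `|x - y| /\ `|Im (F x) - Im (F y)| <= `|x - y|.
Proof.
move=> Jx Jy; split.
  by apply: (averages_lipschitz cRe) => // x0 m; exact: (int_dker_le x0 m).1.
by apply: (averages_lipschitz cIm) => // x0 m; exact: (int_dker_le x0 m).2.
Qed.

End Bound.
End MultiplierLipschitz.

(** * Direct sums *)

Section DirectSum.
Context {R : realType}.
Local Notation J r := (circle_dom r).
Local Notation Re := complex.Re.
Local Notation Im := complex.Im.

Lemma esumZ_lty (I : choiceType) (k : R) (a : I -> \bar R) : 0 <= k ->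
  (forall i, (0 <= a i)%E) -> (\esum_(i in [set: I]) a i < +oo)%E ->
  (\esum_(i in [set: I]) (k%:E * a i) < +oo)%E.
Proof.
move=> k0 a0 afin.
apply: (@le_lt_trans _ _ (k%:E * \esum_(i in [set: I]) a i)%E).
  apply: ge_ereal_sup => _ [X [finX XI]] <-.
  rewrite -ge0_mule_fsumr//; apply: lee_wpmul2l; first by rewrite lee_fin.
  by apply: esum_ge; exists X.
have : (0 <= \esum_(i in [set: I]) a i)%E by apply: esum_ge0.
by case: (\esum_(i in [set: I]) a i)%E afin => // x _ _; rewrite -EFinM ltry.
Qed.

Lemma esum_component (I : choiceType) (a : I -> \bar R) i :
  (forall i, (0 <= a i)%E) -> (a i <= \esum_(i in [set: I]) a i)%E.
Proof.
move=> a0; apply: esum_ge; exists [set i]; first by split.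
by rewrite fsbig_set1.
Qed.

Lemma esum_single (I : choiceType) (a : I -> \bar R) i : (0 <= a i)%E ->
  (forall j, j != i -> a j = 0%E) -> (\esum_(i in [set: I]) a i = a i)%E.
Proof.
move=> a0 aj; rewrite -(esum_set1 a0) [RHS]esum_mkcond; apply: eq_esum => j _.
by case: ifPn => //; rewrite notin_setE/= => /eqP; exact: aj.
Qed.

Variables (I : choiceType) (r : I -> R) (rho : I -> R -> R * R).
Hypothesis r0 : forall i, 0 < r i.
Let M : fredholm_data R := direct_sum (fun i => curve_module (r i) (rho i)).

Lemma sqnorm_mul_le (k : R) (s : R) (u : R -> R) (f : R -> R[i]) : 0 < s -> 0 <= k ->
  circle_L2 s f -> measurable_fun (J s) u ->
  (forall x, J s x -> `|u x| <= k) ->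
  circle_L2 s (fun x => (u x)%:C%C * f x) /\
  (circle_sqnorm s (fun x => ((u x)%:C%C * f x)%R) <= (k ^+ 2)%:E * circle_sqnorm s f)%E.
Proof.
move=> s0 k0 Lf mu uk.
have uk2 x : J s x -> sqmod (fun x => (u x)%:C%C) x <= k ^+ 2.
  move=> Jx; rewrite /sqmod/= expr0n addr0 -real_normK ?num_real// lerXn2r ?nnegrE//.
  exact: uk.
have Luf : circle_L2 s (fun x => (u x)%:C%C * f x).
  apply: L2_mul => //.
  by exists (k ^+ 2); [exact: sqr_ge0|exact: uk2].
split => //.
have [mf jf] := (circle_L2P s0 _).1 Lf; have [mg jg] := (circle_L2P s0 _).1 Luf.
rewrite !circle_sqnormE// muleCA; apply: lee_wpmul2l.
  by rewrite lee_fin invr_ge0 !mulr_ge0 ?pi_ge0// ltW.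
rewrite -ge0_integralZl//; last 4 first.
- exact: measurable_circle_dom.
- by apply/measurable_EFinP; exact: sqmod_measurable.
- by move=> x _; rewrite lee_fin sqmod_ge0.
- by rewrite lee_fin sqr_ge0.
apply: ge0_le_integral => //.
- exact: measurable_circle_dom.
- by move=> x _; rewrite lee_fin sqmod_ge0.
- by apply/measurable_EFinP; exact: sqmod_measurable.
- by apply/measurable_EFinP; apply: measurable_funM => //; exact: sqmod_measurable.
- move=> x Jx; rewrite -EFinM lee_fin sqmodM; apply: ler_wpM2r; first exact: sqmod_ge0.
  exact: uk2.
Qed.

Lemma sqnorm_add_le (s : R) (f g : R -> R[i]) : 0 < s ->
  circle_L2 s f -> circle_L2 s g ->
  (circle_sqnorm s (fun x => (f x + g x)%R) <=
    2%:E * (circle_sqnorm s f + circle_sqnorm s g))%E.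
Proof.
move=> s0 Lf Lg; have Lh := L2_add s0 Lf Lg.
have [mf jf] := (circle_L2P s0 _).1 Lf; have [mg jg] := (circle_L2P s0 _).1 Lg.
have [mh jh] := (circle_L2P s0 _).1 Lh.
have mJ := @measurable_circle_dom R s.
rewrite !circle_sqnormE// -ge0_muleDr; last 2 first.
- by apply: integral_ge0 => x _; rewrite lee_fin sqmod_ge0.
- by apply: integral_ge0 => x _; rewrite lee_fin sqmod_ge0.
rewrite muleCA; apply: lee_wpmul2l.
  by rewrite lee_fin invr_ge0 !mulr_ge0 ?pi_ge0// ltW.
have mE h : cmeasurable s h -> measurable_fun (J s) (fun x => (sqmod h x)%:E).
  by move=> ?; apply/measurable_EFinP; exact: sqmod_measurable.
have gE h x : (0 <= (sqmod h x)%:E :> \bar R)%E by rewrite lee_fin sqmod_ge0.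
rewrite -ge0_integralD//; [|exact: mE|exact: mE].
rewrite -ge0_integralZl//; last 2 first.
- by apply: emeasurable_funD; exact: mE.
- by move=> x _; rewrite adde_ge0.
apply: ge0_le_integral => //.
- exact: mE.
- by apply: measurable_funeM; apply: emeasurable_funD; exact: mE.
- by move=> x Jx; rewrite -EFinD -EFinM lee_fin; exact: sqmodD.
Qed.

(** [lipschitz_multiplier] acts on every circle separately. The common bound [B] keeps the results
    square summable, since [zeta] is the commutator applied to [xi] plus [b] times [eta]. *)
Lemma commutator_le1_lipschitz (b : R * R -> R) (B : R) :
  (forall i x, J (r i) x -> `|b (rho i x)| <= B) ->
  (forall i, b (rho i (pi * r i)) = b (rho i (- (pi * r i)))) ->
  (forall i t y, J (r i) t -> J (r i) y ->
     `|b (rho i t) - b (rho i y)| <= `|t - y|) ->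
  commutator_le1 M (fun p => (b p)%:C%C).
Proof.
move=> bB bp bL xi eta [[Lxi nxi] [Leta neta] D].
(* The empty index set is treated apart, because [0 <= B] is read off from a point of some
   circle. *)
have [i1|noI] := pselect (exists i : I, True); last first.
  have nf (i : I) : False by apply: noI; exists i.
  have e0 (f : I -> \bar R) : (\esum_(i in [set: I]) f i = 0)%E.
    by apply: esum1 => i; case: (nf i).
  exists eta; split; last by rewrite /= !e0.
  by split; [split|split|]; first [by move=> i; case: (nf i)|by rewrite e0 ltry].
have B0 : 0 <= B.
  have [i _] := i1; apply: le_trans (bB i 0 _); first exact: normr_ge0.
  by apply/circle_domP => //; rewrite normr0 mulr_ge0 ?pi_ge0// ltW.
have H i : exists zeta : R -> R[i], [/\ circle_L2 (r i) (fun x => (b (rho i x))%:C%C * xi i x),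
    circle_L2 (r i) zeta,
    (forall l : int, fourier_coef (r i) zeta l =
       ((l%:~R + 2^-1) / r i)%:C%C * fourier_coef (r i) (fun x => (b (rho i x))%:C%C * xi i x) l) &
    (circle_sqnorm (r i) (fun x => (zeta x - (b (rho i x))%:C%C * eta i x)%R) <= circle_sqnorm (r i) (xi i))%E].
  have [l1 l2 l3] := D i.
  exact: (lipschitz_multiplier (r0 i) (bp i) (bL i) l1 l2 l3).
have [zeta Hz] := choice H.
have mu i : measurable_fun (J (r i)) (fun x => b (rho i x)).
  apply: subspace_continuous_measurable_fun; first exact: measurable_circle_dom.
  exact: lipschitz_within (bL i).
have mul i f : circle_L2 (r i) f -> _ := fun Lf => sqnorm_mul_le (r0 i) B0 Lf (mu i) (bB i).
have s0 i f : (0 <= circle_sqnorm (r i) f)%E by exact: circle_sqnorm_ge0.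
have B2 : 0 <= B ^+ 2 by exact: sqr_ge0.
exists zeta; split.
  split; last by move=> i; have [] := Hz i.
  - split; first by move=> i; have [] := Hz i.
    apply: (@le_lt_trans _ _ (\esum_(i in [set: I]) ((B ^+ 2)%:E * circle_sqnorm (r i) (xi i)))%E).
      by apply: le_esum => i _; exact: (mul _ _ (Lxi i)).2.
    exact: esumZ_lty.
  - split; first by move=> i; have [] := Hz i.
    apply: (@le_lt_trans _ _ (\esum_(i in [set: I]) (2%:E * (circle_sqnorm (r i) (xi i) + (B ^+ 2)%:E * circle_sqnorm (r i) (eta i))))%E).
      apply: le_esum => i _; have [_ Lz _ z1] := Hz i.
      have [Lm m1] := mul _ _ (Leta i).
      have Ld : circle_L2 (r i) (fun x => zeta i x - (b (rho i x))%:C%C * eta i x).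
        have -> : (fun x => zeta i x - (b (rho i x))%:C%C * eta i x) =
          (fun x => zeta i x + (-1) * ((b (rho i x))%:C%C * eta i x)).
          by apply/funext => x; rewrite mulN1r.
        by apply: L2_add => //; exact: cmul_L2.
      have := sqnorm_add_le (r0 i) Ld Lm.
      have -> : (fun x => zeta i x - (b (rho i x))%:C%C * eta i x + (b (rho i x))%:C%C * eta i x) = zeta i.
        by apply/funext => x; rewrite subrK.
      move=> h; apply: le_trans h _; apply: lee_wpmul2l; first by rewrite lee_fin.
      exact: leeD.
    apply: esumZ_lty => //.
      by move=> i; rewrite adde_ge0// mule_ge0// lee_fin.
    rewrite esumD//; last by move=> i _; rewrite mule_ge0// lee_fin.
    by apply: lte_add_pinfty => //; exact: esumZ_lty.
by apply: le_esum => i _; have [_ _ _] := Hz i.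
Qed.

(** The hypothesis is applied to vectors supported in the summand [i]; a component of the result has
    at most the norm of the whole. *)
Lemma commutator_le1_component (a : R * R -> R[i]) : commutator_le1 M a ->
  forall i xi eta, circle_L2 (r i) xi -> circle_L2 (r i) eta ->
  (forall l : int, fourier_coef (r i) eta l =
     ((l%:~R + 2^-1) / r i)%:C%C * fourier_coef (r i) xi l) ->
  exists zeta, [/\ circle_L2 (r i) (fun x => a (rho i x) * xi x), circle_L2 (r i) zeta,
    (forall l : int, fourier_coef (r i) zeta l =
       ((l%:~R + 2^-1) / r i)%:C%C * fourier_coef (r i) (fun x => a (rho i x) * xi x) l) &
    (circle_sqnorm (r i) (fun x => (zeta x - a (rho i x) * eta x)%R) <= circle_sqnorm (r i) xi)%E].
Proof.
move=> aM i xi eta Lxi Leta D.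
have L0 j : circle_L2 (r j) (fun=> 0).
  by have := @tpoly_L2 R (r j) (r0 j) [::]; rewrite /tpoly; under eq_fun do rewrite big_nil.
have n0 j : circle_sqnorm (r j) (fun=> 0) = 0%E.
  rewrite circle_sqnormE// integral0_eq ?mule0// => x _.
  by rewrite /sqmod/= expr0n addr0.
have f0 j l : fourier_coef (r j) (fun=> 0) l = 0.
  rewrite /fourier_coef; have -> : (fun x => (circle_exp (r j) l x)^*%C * 0) = (fun=> 0).
    by apply/funext => x; rewrite mulr0.
  by rewrite cint0 mulr0.
pose single (f : R -> R[i]) : vec M := fun j => if j == i then f else (fun=> 0).
have sE f : single f i = f by rewrite /single eqxx.
have sN f j : j != i -> single f j = (fun=> 0) by rewrite /single => /negbTE ->.
have snorm f : sqnorm (single f) = circle_sqnorm (r i) f.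
  rewrite /= (@esum_single _ _ i) ?sE//; first exact: circle_sqnorm_ge0.
  by move=> j ji; rewrite sN.
have smem f : circle_L2 (r i) f -> in_hilbert (single f).
  move=> Lf; split.
    by move=> j /=; have [->|ji] := eqVneq j i; rewrite ?sE// sN.
  by have := snorm f => /= ->; case: Lf.
have [zeta [[m1 m2 m3] nz]] : exists zeta : vec M, Defs.dirac (rep a (single xi)) zeta /\
   (sqnorm (zeta - rep a (single eta)) <= sqnorm (single xi))%E.
  apply: aM; split; [exact: smem|exact: smem|].
  move=> j /=; have [->|ji] := eqVneq j i; rewrite ?sE//.
  by rewrite !sN//; split => // l; rewrite f0 mulr0.
exists (zeta i); have [l1 l2 l3] := m3 i; rewrite /= sE in l1 l3.
split => //.
rewrite -(snorm xi); apply: le_trans nz => /=.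
have -> : (fun x => (zeta i x - a (rho i x) * eta x)%R) =
    (zeta - (fun i0 => (fun x => a (rho i0 x) * single eta i0 x) : vec (curve_module (r i0) (rho i0))) : vec M) i.
  by apply/funext => x; rewrite -{1}(sE eta).
apply: (@esum_component _ (fun j => circle_sqnorm (r j) _)).
by move=> j; exact: circle_sqnorm_ge0.
Qed.

End DirectSum.

(** * Cells of the gasket *)

Section Euclid.
Context {R : realType}.
Implicit Types p q v : R * R.

Lemma eucl_normc p q :
  (eucl_dist p q)%:C%C = `|((p.1 - q.1) +i* (p.2 - q.2))%C| :> R[i].
Proof. by rewrite normc_def. Qed.

Lemma eucl_ge0 p q : 0 <= eucl_dist p q.
Proof. exact: sqrtr_ge0. Qed.

Lemma eucl_sym p q : eucl_dist p q = eucl_dist q p.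
Proof. by rewrite /eucl_dist -(sqrrN (p.1 - _)) -(sqrrN (p.2 - _)) !opprB. Qed.

Lemma eucl_refl p : eucl_dist p p = 0.
Proof. by rewrite /eucl_dist !subrr expr0n addr0 sqrtr0. Qed.

Lemma eucl_triangle q p v : eucl_dist p v <= eucl_dist p q + eucl_dist q v.
Proof.
rewrite -lecR rmorphD/= !eucl_normc.
apply: le_trans (ler_normD _ _); rewrite le_eqVlt; apply/orP; left; apply/eqP.
by congr `|_|; apply/eqP; rewrite eq_complex/=; apply/andP; split; apply/eqP; ring.
Qed.

Lemma eucl_coord1 p q : `|p.1 - q.1| <= eucl_dist p q.
Proof. by rewrite -sqrtr_sqr ler_wsqrtr// lerDl sqr_ge0. Qed.

Lemma eucl_coord2 p q : `|p.2 - q.2| <= eucl_dist p q.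
Proof. by rewrite -sqrtr_sqr ler_wsqrtr// lerDr sqr_ge0. Qed.

Lemma eucl_le_coord p q : eucl_dist p q <= `|p.1 - q.1| + `|p.2 - q.2|.
Proof.
rewrite -(@ler_pXn2r _ 2)// ?nnegrE ?addr_ge0 ?eucl_ge0//.
rewrite /eucl_dist sqr_sqrtr ?addr_ge0 ?sqr_ge0// [X in _ <= X]sqrrD -(real_normK (num_real (p.1 - q.1))).
by rewrite -(real_normK (num_real (p.2 - q.2))) lerD2r lerDl mulrn_wge0// mulr_ge0.
Qed.

Lemma eucl_eq0 p q : eucl_dist p q = 0 -> p = q.
Proof.
move=> e; have := eucl_coord1 p q; have := eucl_coord2 p q.
rewrite e !normr_le0 !subr_eq0 => /eqP e2 /eqP e1.
by case: p q {e} e1 e2 => [? ?] [? ?] /= -> ->.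
Qed.

Lemma eucl_scale (a : R) p q v :
  eucl_dist (v + a *: p) (v + a *: q) = `|a| * eucl_dist p q.
Proof.
rewrite /eucl_dist -(sqrtr_sqr a) -sqrtrM ?sqr_ge0//; congr Num.sqrt.
by rewrite /GRing.scale/= /GRing.scale/=; ring.
Qed.

Lemma eucl_line p q (s t : R) :
  eucl_dist (p + s *: (q - p)) (p + t *: (q - p)) = `|s - t| * eucl_dist p q.
Proof.
rewrite /eucl_dist -(sqrtr_sqr (s - t)) -sqrtrM ?sqr_ge0//; congr Num.sqrt.
by rewrite /GRing.scale/= /GRing.scale/=; ring.
Qed.

End Euclid.

Inductive dir := DA | DB | DC.
Definition deqb (i j : dir) : bool :=
  match i, j with DA, DA | DB, DB | DC, DC => true | _, _ => false end.
Lemma deqbP : Equality.axiom deqb.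
Proof. by case; case; constructor. Qed.
HB.instance Definition _ := hasDecEq.Build dir deqbP.

Section Cells.
Context {R : realType}.
Implicit Types (T : triangle R) (p q y : R * R) (i j k d : dir) (w v u : seq dir).

Definition vtx T d := match d with DA => va T | DB => vb T | DC => vc T end.

Definition child T d : triangle R :=
  match d with
  | DA => Triangle (va T) (midpoint (va T) (vb T)) (midpoint (vc T) (va T))
  | DB => Triangle (midpoint (va T) (vb T)) (vb T) (midpoint (vb T) (vc T))
  | DC => Triangle (midpoint (vc T) (va T)) (midpoint (vb T) (vc T)) (vc T)
  end.

Lemma pair_eqP p q : p.1 = q.1 -> p.2 = q.2 -> p = q.
Proof. by case: p q => [? ?] [? ?] /= -> ->. Qed.

Lemma midpointC p q : midpoint p q = midpoint q p.
Proof. by rewrite /midpoint addrC. Qed.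

Lemma midpointE p q : midpoint p q = p + 2^-1 *: (q - p).
Proof.
by apply: pair_eqP; rewrite /midpoint /GRing.scale/= /GRing.scale/=; field.
Qed.

Lemma midpointxx p : midpoint p p = p.
Proof. by rewrite midpointE subrr scaler0 addr0. Qed.

Lemma vtx_child T i j : vtx (child T i) j = midpoint (vtx T i) (vtx T j).
Proof. by case: i; case: j => //=; rewrite ?midpointxx// midpointC. Qed.

(* Words address the solid triangles: cell w is reached from Delta01 by passing
   successively to the corners listed in w. *)
Definition cell w : triangle R := foldl child Delta01 w.

Lemma cell_rcons w d : cell (rcons w d) = child (cell w) d.
Proof. exact: foldl_rcons. Qed.

Definition side0 : R := 2 * pi / 3.
Definition side w : R := side0 / 2 ^+ size w.

Lemma side0_gt0 : 0 < side0.
Proof. by rewrite divr_gt0// mulr_gt0// pi_gt0. Qed.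

Lemma side_gt0 w : 0 < side w.
Proof. by rewrite divr_gt0 ?exprn_gt0// side0_gt0. Qed.

Lemma side_rcons w d : side (rcons w d) = side w / 2.
Proof. by rewrite /side size_rcons exprS invfM mulrCA mulrC. Qed.

Lemma vtx_dist w i j : i != j -> eucl_dist (vtx (cell w) i) (vtx (cell w) j) = side w.
Proof.
elim/last_ind: w i j => [|w d ih] i j ij.
  have p0 : 0 < pi :> R by exact: pi_gt0.
  have s3 : Num.sqrt 3 ^+ 2 = 3 :> R by rewrite sqr_sqrtr.
  have s30 : Num.sqrt 3 != 0 :> R by rewrite gt_eqF// sqrtr_gt0.
  have E : (pi / Num.sqrt 3) ^+ 2 = pi ^+ 2 / 3 :> R by rewrite expr_div_n s3.
  have side2 : side0 = Num.sqrt (side0 ^+ 2) by rewrite sqrtr_sqr gtr0_norm// side0_gt0.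
  rewrite /side expr0 divr1 side2 /eucl_dist; congr Num.sqrt; rewrite /side0.
  by case: i ij; case: j => //= _; rewrite ?subrr ?(sub0r, subr0, sqrrN, expr0n, addr0) ?E; field.
rewrite cell_rcons !vtx_child !midpointE side_rcons.
have := @eucl_scale R 2^-1 (vtx (cell w) i) (vtx (cell w) j) (2^-1 *: vtx (cell w) d).
rewrite ih// mulrC ger0_norm// => <-; congr eucl_dist.
- by apply: pair_eqP; rewrite /GRing.scale/= /GRing.scale/=; field.
- by apply: pair_eqP; rewrite /GRing.scale/= /GRing.scale/=; field.
Qed.

Definition lam0 p d : R :=
  let c := p.2 / (pi / Num.sqrt 3) in
  let b := p.1 / side0 - c / 2 in
  match d with DA => 1 - b - c | DB => b | DC => c end.

(* Barycentric coordinates of p with respect to cell w. *)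
Definition lam w : R * R -> dir -> R :=
  foldl (fun l i p j => 2 * l p j - (i == j)%:R) lam0 w.

Lemma lam_rcons w i p j : lam (rcons w i) p j = 2 * lam w p j - (i == j)%:R.
Proof. by rewrite /lam foldl_rcons. Qed.

Lemma lam_sum w p : lam w p DA + lam w p DB + lam w p DC = 1.
Proof.
elim/last_ind: w => [|w d ih]; first by rewrite /lam/=; ring.
by rewrite !lam_rcons; case: d => /=; rewrite ?(eqxx, subr0); lra.
Qed.

Definition comb T (a b c : R) := a *: va T + b *: vb T + c *: vc T.

Lemma lam_vtx w p : p = comb (cell w) (lam w p DA) (lam w p DB) (lam w p DC).
Proof.
have p0 : pi != 0 :> R by rewrite gt_eqF// pi_gt0.
have s30 : Num.sqrt 3 != 0 :> R by rewrite gt_eqF// sqrtr_gt0.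
elim/last_ind: w => [|w d ih].
  by apply: pair_eqP; rewrite /comb /lam /lam0 /side0 /GRing.scale/= /GRing.scale/=; move: (@pi R) (Num.sqrt 3 : R) p0 s30 => P S p0 s30; field; rewrite ?p0 ?s30.
rewrite cell_rcons !lam_rcons {1}ih.
have ls := lam_sum w p; move: (lam w p DA) (lam w p DB) (lam w p DC) ls => a b c ls.
have -> : a = 1 - b - c by lra.
by case: d => /=; apply: pair_eqP; rewrite /comb /midpoint /GRing.scale/= /GRing.scale/=; field.
Qed.

Lemma lam_comb w a b c : a + b + c = 1 ->
  [/\ lam w (comb (cell w) a b c) DA = a, lam w (comb (cell w) a b c) DB = b &
      lam w (comb (cell w) a b c) DC = c].
Proof.
have p0 : pi != 0 :> R by rewrite gt_eqF// pi_gt0.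
have s30 : Num.sqrt 3 != 0 :> R by rewrite gt_eqF// sqrtr_gt0.
elim/last_ind: w a b c => [|w d ih] a b c abc.
  have -> : a = 1 - b - c by lra.
  by split; rewrite /comb /lam /lam0 /side0 /GRing.scale/= /GRing.scale/=; move: (@pi R) (Num.sqrt 3 : R) p0 s30 => P S p0 s30; field; rewrite ?p0 ?s30.
rewrite cell_rcons.
pose e j : R := (d == j)%:R.
have es : e DA + e DB + e DC = 1 by rewrite /e; case: (d) => /=; ring.
have -> : comb (child (cell w) d) a b c =
    comb (cell w) ((a + e DA) / 2) ((b + e DB) / 2) ((c + e DC) / 2).
  have -> : a = 1 - b - c by lra.
  by rewrite /e; clear e es ih; case: d => /=; apply: pair_eqP; rewrite /comb /midpoint /GRing.scale/= /GRing.scale/=; field.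
have [|h1 h2 h3] := ih ((a + e DA) / 2) ((b + e DB) / 2) ((c + e DC) / 2); first by lra.
by rewrite !lam_rcons h1 h2 h3; split; rewrite -/(e _); lra.
Qed.

Lemma solidP w p : solid (cell w) p <-> forall d, 0 <= lam w p d.
Proof.
split=> [[a [b [c [[a0 b0 c0] abc ->]]]] d|h].
  by have [? ? ?] := lam_comb w abc; rewrite -/(comb _ _ _ _); case: d; lra.
exists (lam w p DA), (lam w p DB), (lam w p DC); split=> //.
  exact: lam_sum.
exact: lam_vtx.
Qed.

Lemma open_solidP w p : open_solid (cell w) p <-> forall d, 0 < lam w p d.
Proof.
split=> [[a [b [c [[a0 b0 c0] abc ->]]]] d|h].
  by have [? ? ?] := lam_comb w abc; rewrite -/(comb _ _ _ _); case: d; lra.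
exists (lam w p DA), (lam w p DB), (lam w p DC); split=> //.
  exact: lam_sum.
exact: lam_vtx.
Qed.

(** The corner at [d] is cut off by the line on which coordinate [d] equals 1/2; the hole lies
    between the three lines. *)
Lemma open_middleP w p : open_solid (middle (cell w)) p <-> forall d, lam w p d < 1 / 2.
Proof.
split=> [[a [b [c [[a0 b0 c0] abc ->]]]] d|h].
  have -> : a *: va (middle (cell w)) + b *: vb (middle (cell w)) + c *: vc (middle (cell w)) =
      comb (cell w) ((a + c) / 2) ((a + b) / 2) ((b + c) / 2).
    by apply: pair_eqP; rewrite /comb /middle /midpoint /GRing.scale/= /GRing.scale/=; field.
  have [|? ? ?] := @lam_comb w ((a + c) / 2) ((a + b) / 2) ((b + c) / 2); first by lra.
  by case: d; lra.
have ls := lam_sum w p; have hA := h DA; have hB := h DB; have hC := h DC.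
exists (1 - 2 * lam w p DC), (1 - 2 * lam w p DA), (1 - 2 * lam w p DB).
split; [by split; lra|by lra|].
rewrite {1}(lam_vtx w p); move: (lam w p DA) (lam w p DB) (lam w p DC) ls => a b c ls.
have -> : a = 1 - b - c by lra.
by apply: pair_eqP; rewrite /comb /middle /midpoint /GRing.scale/= /GRing.scale/=; field.
Qed.

End Cells.

(** * The gasket described by cells and barycentric coordinates *)

Section Gasket.
Context {R : realType}.
Implicit Types (T : triangle R) (p q y : R * R) (i j k d : dir) (w v u : seq dir).

Lemma lam_range w p d : solid (cell w) p -> 0 <= lam w p d <= 1.
Proof.
move=> /solidP h; have ls := lam_sum w p.
have hA := h DA; have hB := h DB; have hC := h DC.
by case: d; apply/andP; split; lra.
Qed.

Lemma lam_le2 w p i j : i != j -> solid (cell w) p -> lam w p i + lam w p j <= 1.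
Proof.
move=> + /solidP h; have ls := lam_sum w p.
have hA := h DA; have hB := h DB; have hC := h DC.
by case: i; case: j => // _; lra.
Qed.

Lemma solid_rcons w d p : solid (cell (rcons w d)) p ->
  solid (cell w) p /\ 1 / 2 <= lam w p d.
Proof.
move=> /solidP h; split.
  apply/solidP => j; have := h j; rewrite lam_rcons.
  by have ? : 0 <= (d == j)%:R :> R by []; lra.
by have h1 := h d; rewrite lam_rcons eqxx /= in h1; lra.
Qed.

Lemma solid_cat w u p : solid (cell (w ++ u)) p -> solid (cell w) p.
Proof.
elim: u w => [|d u ih] w; first by rewrite cats0.
by rewrite -cat_rcons => /ih /solid_rcons[].
Qed.

Lemma open_solid_rcons w d p : open_solid (cell (rcons w d)) p ->
  open_solid (cell w) p /\ 1 / 2 < lam w p d.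
Proof.
move=> /open_solidP h; split.
  apply/open_solidP => j; have := h j; rewrite lam_rcons.
  by have ? : 0 <= (d == j)%:R :> R by []; lra.
by have h1 := h d; rewrite lam_rcons eqxx /= in h1; lra.
Qed.

Lemma open_solid_cat w u p : open_solid (cell (w ++ u)) p -> open_solid (cell w) p.
Proof.
elim: u w => [|d u ih] w; first by rewrite cats0.
by rewrite -cat_rcons => /ih /open_solid_rcons[].
Qed.

Lemma open_middle_solid w p : open_solid (middle (cell w)) p -> open_solid (cell w) p.
Proof.
move=> /open_middleP h; apply/open_solidP => d; have ls := lam_sum w p.
have hA := h DA; have hB := h DB; have hC := h DC.
by case: d; lra.
Qed.

(** Where the words part, the cell asks for one coordinate to be at least 1/2 and the hole for
    another to exceed 1/2, but two coordinates add up to at most 1. If [v] runs out first, the cell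
    lies in a corner and thus outside the hole. *)
Lemma hole_disjoint w v u p : (size v < size u)%N -> solid (cell (w ++ u)) p ->
  ~ open_solid (middle (cell (w ++ v))) p.
Proof.
elim: v w u => [|e v ih] w [|d u]//= vu.
  rewrite -cat_rcons cats0 => /solid_cat /solid_rcons[_ h] /open_middleP /(_ d).
  by lra.
have [->|de] := eqVneq d e; first by rewrite -!cat_rcons; exact: ih.
rewrite -!cat_rcons => /solid_cat /solid_rcons[h1 h2] /open_middle_solid /open_solid_cat.
by move=> /open_solid_rcons[_ h3]; have h4 := lam_le2 de h1; lra.
Qed.

Fixpoint dnum d : nat := match d with DA => 0 | DB => 1 | DC => 2 end.

(* Position of cell w in the list remaining (size w). *)
Definition index w : nat := foldl (fun n d => (n * 3 + dnum d)%N) 0%N w.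

Lemma index_rcons w d : index (rcons w d) = (index w * 3 + dnum d)%N.
Proof. exact: foldl_rcons. Qed.

Lemma dnum_lt d : (dnum d < 3)%N. Proof. by case: d. Qed.

Lemma index_lt w : (index w < 3 ^ size w)%N.
Proof.
elim/last_ind: w => [|w d ih]//; rewrite index_rcons size_rcons expnSr.
by have := dnum_lt d; move: ih; rewrite -(ltn_pmul2r (isT : (0 < 3)%N)); lia.
Qed.

Lemma index_inj w v : size w = size v -> index w = index v -> w = v.
Proof.
elim/last_ind: w v => [|w d ih] v; first by case: v.
case/lastP: v => [|v e]; first by rewrite size_rcons.
rewrite !size_rcons !index_rcons => -[sz] h.
have hd := dnum_lt d; have he := dnum_lt e.
have iv : index w = index v by lia.
have de : dnum d = dnum e by lia.
rewrite (ih _ sz iv); congr rcons.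
by case: d de {hd h}; case: e {he}.
Qed.

Lemma index_surj m (k0 : nat) : (k0 < 3 ^ m)%N -> exists w, size w = m /\ index w = k0.
Proof.
elim: m k0 => [|m ih] k0; first by case: k0 => //; exists [::].
move=> hk; have [|w [sw iw]] := ih (k0 %/ 3)%N.
  by rewrite ltn_divLR// -expnSr.
have [d dk] : exists d, dnum d = (k0 %% 3)%N.
  have : (k0 %% 3 < 3)%N by rewrite ltn_mod.
  by case: (k0 %% 3)%N => [|[|[|]]]// _; [exists DA|exists DB|exists DC].
exists (rcons w d); rewrite size_rcons sw index_rcons iw dk.
by split=> //; rewrite -divn_eq.
Qed.

Lemma nth_corners (s : seq (triangle R)) n d : (n < size s)%N ->
  nth Delta01 (flatten [seq corners T | T <- s]) (n * 3 + dnum d) =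
  child (nth Delta01 s n) d.
Proof.
elim: s n => [|T s ih] [|n]// ns; first by case: (d).
by rewrite mulSn -addnA /= -ih.
Qed.

Lemma size_remaining m : size (@remaining R m) = (3 ^ m)%N.
Proof.
elim: m => [|m ih]//=; rewrite size_flatten /shape -map_comp expnSr -ih.
by elim: (remaining m) => [|T s ihs]//=; rewrite ihs mulSn.
Qed.

Lemma nth_remaining w : nth Delta01 (remaining (size w)) (index w) = cell w :> triangle R.
Proof.
elim/last_ind: w => [|w d ih]//.
rewrite index_rcons size_rcons/= nth_corners ?size_remaining ?index_lt//.
by rewrite ih cell_rcons.
Qed.

Lemma nabla_index w : nabla (size w) (index w) = middle (cell w) :> triangle R.
Proof. by rewrite /nabla nth_remaining. Qed.

Lemma stageS_child m w p : stage m.+1 p -> size w = m -> solid (cell w) p ->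
  exists d, solid (cell (rcons w d)) p.
Proof.
move=> [_ nh] sw sp.
have /existsNP[d /negP] : ~ (forall d, lam w p d < 1 / 2).
  move=> h; apply: nh; exists (index w); first by rewrite /= -sw index_lt.
  by rewrite -sw nabla_index; apply/open_middleP.
rewrite -leNgt => hd; exists d; apply/solidP => j; rewrite lam_rcons.
have [<-|dj] := eqVneq d j; first by rewrite ?eqxx /=; lra.
by have /andP[h _] := lam_range j sp; rewrite subr0; lra.
Qed.

Lemma SG_child w p : SG p -> solid (cell w) p -> exists d, solid (cell (rcons w d)) p.
Proof. by move=> Sp; apply: stageS_child => //; exact: Sp. Qed.

(** A point of a cell that is not in its hole lies in one of the corners, which gives the next
    letter. Conversely a cell of level [m.+1] avoids the holes of all cells of level [m]. *)
Lemma SG_cell p : SG p <-> forall n, exists w, size w = n /\ solid (cell w) p.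
Proof.
split=> [Sp n|h].
  elim: n => [|n [w [sw hw]]]; first by exists [::]; split => //; exact: (Sp 0%N I).
  by have [d hd] := SG_child Sp hw; exists (rcons w d); rewrite size_rcons sw.
move=> m _; elim: m => [|m ih] /=.
  by have [w [sw hw]] := h 0%N; case: w sw hw.
split=> // -[k /= km]; have [v [sv iv]] := index_surj km.
rewrite -iv -{1}sv nabla_index; have [w [sw hw]] := h m.+1.
by apply: (@hole_disjoint [::] v w) => //; rewrite sw sv.
Qed.

Lemma SG_solid p : SG p -> solid Delta01 p.
Proof. by move=> /SG_cell /(_ 0%N)[w [sw hw]]; case: w sw hw. Qed.

Definition epoint w j k (t : R) : R * R :=
  vtx (cell w) j + t *: (vtx (cell w) k - vtx (cell w) j).

Lemma epoint0 w j k : epoint w j k 0 = vtx (cell w) j.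
Proof. by rewrite /epoint scale0r addr0. Qed.

Lemma epoint1 w j k : epoint w j k 1 = vtx (cell w) k.
Proof. by rewrite /epoint scale1r addrC subrK. Qed.

Lemma epoint_sym w j k t : epoint w j k t = epoint w k j (1 - t).
Proof. by apply: pair_eqP; rewrite /epoint /GRing.scale/= /GRing.scale/=; ring. Qed.

Lemma epoint_dist w j k s t : j != k ->
  eucl_dist (epoint w j k s) (epoint w j k t) = `|s - t| * side w.
Proof. by move=> jk; rewrite eucl_line vtx_dist. Qed.

Lemma epoint_left w j k t : epoint (rcons w j) j k t = epoint w j k (t / 2).
Proof.
rewrite /epoint cell_rcons !vtx_child.
by apply: pair_eqP; rewrite /midpoint /GRing.scale/= /GRing.scale/=; field.
Qed.

Lemma epoint_right w j k t : epoint (rcons w k) j k t = epoint w j k ((1 + t) / 2).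
Proof.
rewrite /epoint cell_rcons !vtx_child.
by apply: pair_eqP; rewrite /midpoint /GRing.scale/= /GRing.scale/=; field.
Qed.

Lemma lam_epoint w j k t d :
  lam w (epoint w j k t) d = (1 - t) * (j == d)%:R + t * (k == d)%:R.
Proof.
have H a b c : a + b + c = 1 -> epoint w j k t = comb (cell w) a b c ->
    lam w (epoint w j k t) d = match d with DA => a | DB => b | DC => c end.
  by move=> abc ->; have [? ? ?] := lam_comb w abc; case: (d).
rewrite (H ((1 - t) * (j == DA)%:R + t * (k == DA)%:R)
  ((1 - t) * (j == DB)%:R + t * (k == DB)%:R) ((1 - t) * (j == DC)%:R + t * (k == DC)%:R)).
- by case: d {H}.
- by clear H; case: j; case: k => /=; ring.
- by clear H; case: j; case: k; apply: pair_eqP; rewrite /epoint /comb /GRing.scale/= /GRing.scale/=; ring.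
Qed.

Lemma solid_epoint w j k t : 0 <= t <= 1 -> solid (cell w) (epoint w j k t).
Proof.
move=> /andP[t0 t1]; apply/solidP => d; rewrite lam_epoint.
by rewrite addr_ge0// mulr_ge0// subr_ge0.
Qed.

(** The word follows the binary digits of [t]: [j] for the lower half, [k] for the upper half. *)
Lemma epoint_cells w j k t n : 0 <= t <= 1 ->
  exists u, size u = n /\ solid (cell (w ++ u)) (epoint w j k t).
Proof.
elim: n w t => [|n ih] w t t01.
  by exists [::]; rewrite cats0; split=> //; exact: solid_epoint.
have [h|h] := leP t (1 / 2).
  have t2 : 0 <= 2 * t <= 1 by apply/andP; split; move/andP: t01 => [? ?]; lra.
  have [u [su hu]] := ih (rcons w j) (2 * t) t2.
  exists (j :: u); rewrite /= su -cat_rcons; split=> //.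
  by rewrite epoint_left in hu; rewrite mulrC mulKf// in hu.
have t2 : 0 <= 2 * t - 1 <= 1 by apply/andP; split; move/andP: t01 => [? ?]; lra.
have [u [su hu]] := ih (rcons w k) (2 * t - 1) t2.
exists (k :: u); rewrite /= su -cat_rcons; split=> //.
have e : (1 + (2 * t - 1)) / 2 = t by field.
by rewrite epoint_right e in hu.
Qed.

Lemma SG_epoint w j k t : 0 <= t <= 1 -> SG (epoint w j k t).
Proof.
move=> t01; apply/SG_cell => n.
have [h|h] := leqP n (size w).
  exists (take n w); rewrite size_takel//; split=> //.
  by apply: (@solid_cat _ (drop n w)); rewrite cat_take_drop; exact: solid_epoint.
have [u [su hu]] := epoint_cells w j k (n - size w) t01.
by exists (w ++ u); rewrite size_cat su subnKC// ltnW.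
Qed.

Lemma SG_vtx w j : SG (vtx (cell w) j : R * R).
Proof. by rewrite -(epoint0 w j j); apply: SG_epoint; rewrite lexx ler01. Qed.

(** A generous slope for all three coordinates of the outer triangle: one term for the horizontal
    and one for the vertical direction. *)
Definition kappa : R := side0^-1 + 2 / (pi / Num.sqrt 3).

Lemma height_gt0 : 0 < pi / Num.sqrt 3 :> R.
Proof. by rewrite divr_gt0 ?pi_gt0// sqrtr_gt0. Qed.

Lemma kappa_gt0 : 0 < kappa.
Proof.
apply: addr_gt0; first by rewrite invr_gt0; exact: side0_gt0.
by apply: divr_gt0 => //; exact: height_gt0.
Qed.

Lemma lam_lipschitz w p q d : `|lam w p d - lam w q d| <= 2 ^+ size w * kappa * eucl_dist p q.
Proof.
elim/last_ind: w => [|w e ih]; last first.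
  rewrite !lam_rcons size_rcons exprS.
  have -> : 2 * lam w p d - (e == d)%:R - (2 * lam w q d - (e == d)%:R) =
    2 * (lam w p d - lam w q d) by ring.
  by rewrite normrM ger0_norm// -!mulrA ler_wpM2l// mulrA.
rewrite expr0 mul1r /lam/= /kappa /lam0.
set h := pi / Num.sqrt 3; have h0 : 0 < h^-1 by rewrite invr_gt0 height_gt0.
have L0 : 0 < (side0 : R)^-1 by rewrite invr_gt0 side0_gt0.
have e0 := eucl_ge0 p q.
have e1 : `|side0^-1 * (p.1 - q.1)| <= side0^-1 * eucl_dist p q.
  by rewrite normrM (gtr0_norm L0); apply: ler_wpM2l (eucl_coord1 p q); exact: ltW.
have e2 : `|h^-1 * (p.2 - q.2)| <= h^-1 * eucl_dist p q.
  by rewrite normrM (gtr0_norm h0); apply: ler_wpM2l (eucl_coord2 p q); exact: ltW.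
have e3 : 0 <= h^-1 * eucl_dist p q by rewrite mulr_ge0// ltW.
have e4 : 0 <= (side0 : R)^-1 * eucl_dist p q by rewrite mulr_ge0// ltW.
move: e1 e2; rewrite !ler_norml => /andP[? ?] /andP[? ?].
by case: d => /=; apply/andP; split; lra.
Qed.

(** Two segments parallel to the sides at [d] lead to [p]; their lengths are the other two
    coordinates times the side, and these coordinates add up to at most 1. *)
Lemma vtx_near w p d : solid (cell w) p -> eucl_dist (vtx (cell w) d) p <= side w.
Proof.
move=> sp; have ls := lam_sum w p; have s0 := @side_gt0 R w.
have H i j : i != d -> j != d -> i != j ->
    p = vtx (cell w) d + lam w p i *: (vtx (cell w) i - vtx (cell w) d) +
        lam w p j *: (vtx (cell w) j - vtx (cell w) d) ->
    eucl_dist (vtx (cell w) d) p <= side w.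
  move=> id jd ij pE.
  set a := lam w p i in pE; set b := lam w p j in pE.
  have a0 : 0 <= a by have /andP[] := lam_range i sp.
  have b0 : 0 <= b by have /andP[] := lam_range j sp.
  have ab : a + b <= 1 by exact: lam_le2.
  pose q := vtx (cell w) d + a *: (vtx (cell w) i - vtx (cell w) d).
  have q1 : eucl_dist (vtx (cell w) d) q = a * side w.
    rewrite -[X in eucl_dist X _]addr0 -(scale0r (vtx (cell w) i - vtx (cell w) d)).
    by rewrite eucl_line sub0r normrN ger0_norm// vtx_dist// eq_sym.
  have q2 : eucl_dist q p = b * side w.
    have := @eucl_scale R b (vtx (cell w) d) (vtx (cell w) j) (q - b *: vtx (cell w) d).
    rewrite subrK (ger0_norm b0) vtx_dist 1?eq_sym// => <-; congr eucl_dist.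
    by rewrite pE -/q scalerBr; ring.
  apply: le_trans (eucl_triangle q _ _) _; rewrite q1 q2 -mulrDl.
  by rewrite ler_piMl// ltW.
have pE := lam_vtx w p.
case: d H => H.
- apply: (H DB DC) => //; rewrite {1}pE.
  have -> : lam w p DA = 1 - lam w p DB - lam w p DC by lra.
  by apply: pair_eqP; rewrite /comb /GRing.scale/= /GRing.scale/=; ring.
- apply: (H DA DC) => //; rewrite {1}pE.
  have -> : lam w p DB = 1 - lam w p DA - lam w p DC by lra.
  by apply: pair_eqP; rewrite /comb /GRing.scale/= /GRing.scale/=; ring.
- apply: (H DA DB) => //; rewrite {1}pE.
  have -> : lam w p DC = 1 - lam w p DA - lam w p DB by lra.
  by apply: pair_eqP; rewrite /comb /GRing.scale/= /GRing.scale/=; ring.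
Qed.

End Gasket.

(** * Geodesic and Euclidean distance *)

Section GasketMetric.
Context {R : realType}.
Implicit Types (T : triangle R) (p q x y : R * R) (i j k d : dir) (w v u : seq dir).

Lemma exp2V_small (e : R) : 0 < e -> exists N, (2 ^+ N)^-1 <= e.
Proof.
move=> e0; exists (Num.bound e^-1).
rewrite invf_ple ?posrE ?exprn_gt0//; apply/ltW.
apply: lt_le_trans (archi_boundP _) _; first by rewrite invr_ge0 ltW.
by rewrite -natrX ler_nat ltnW// ltn_expl.
Qed.

Lemma exp2V_S N : (2 ^+ N.+1)^-1 = (2 ^+ N)^-1 / 2 :> R.
Proof. by rewrite exprS invfM mulrC. Qed.

Lemma side_cat w u : side (w ++ u) = side w / 2 ^+ size u :> R.
Proof. by rewrite /side size_cat exprD invfM mulrA. Qed.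

(* If x is close to the corner k of cell v, then x lies in a small cell with
   that corner, of relative size comparable to 1 - lam v x k; the error term
   2^-N covers the case where x is the corner itself. *)
Lemma corner_descent N v k x : SG x -> solid (cell v) x -> exists u,
  [/\ vtx (cell (v ++ u)) k = vtx (cell v) k :> R * R, solid (cell (v ++ u)) x &
      (2 ^+ size u)^-1 <= 2 * (1 - lam v x k) + (2 ^+ N)^-1].
Proof.
move=> Sx; elim: N v => [|N ih] v vx.
  exists [::]; rewrite cats0; split=> //=.
  by have /andP[_ h] := lam_range k vx; rewrite expr0 invr1; lra.
have [d dx] := SG_child Sx vx.
have [dk|dk] := eqVneq d k; last first.
  exists [::]; rewrite cats0; split=> //=.
  have [_ h1] := solid_rcons dx; have h2 := lam_le2 dk vx.
  have h3 : 0 <= (2 ^+ N.+1)^-1 :> R by rewrite invr_ge0 exprn_ge0.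
  by rewrite expr0 invr1; lra.
subst d; have [u [u1 u2 u3]] := ih _ dx.
exists (k :: u); rewrite -cat_rcons; split=> //.
  by rewrite u1 cell_rcons vtx_child midpointxx.
rewrite /= !exp2V_S; move: u3; rewrite lam_rcons eqxx /=.
by move: (2 ^+ size u)^-1 (2 ^+ N)^-1 => a b h; lra.
Qed.

Lemma separate x y n : SG x -> SG y ->
  (exists w i k, [/\ i != k, solid (cell (rcons w i)) x & solid (cell (rcons w k)) y]) \/
  (exists w, [/\ size w = n, solid (cell w) x & solid (cell w) y]).
Proof.
move=> Sx Sy; elim: n => [|n [|[w [sw wx wy]]]]; [|by left|].
  by right; exists [::]; split=> //; exact: SG_solid.
have [i ix] := SG_child Sx wx; have [k ky] := SG_child Sy wy.
have [ik|ik] := eqVneq i k; last by left; exists w, i, k.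
by right; exists (rcons w i); rewrite size_rcons sw; split=> //; rewrite ik.
Qed.

Lemma eucl_gt0 x y : x <> y -> 0 < eucl_dist x y.
Proof.
move=> xy; rewrite lt_neqAle eucl_ge0 andbT eq_sym; apply/eqP => /eucl_eq0.
exact: xy.
Qed.

(** The constant that comes out of [close_cells]: [4 * kappa] from the slope of the coordinates, 1
    from the errors [2 ^ -N] of the two descents. *)
Definition Kcell : R := side0 * (4 * kappa + 1).

Lemma Kcell_gt0 : 0 < Kcell.
Proof. by rewrite mulr_gt0 ?side0_gt0//; have := @kappa_gt0 R; lra. Qed.

(** Where [x] and [y] enter different children [i] and [k], these share a midpoint. Coordinate [k]
    is at least 1/2 at [y], hence at [x] it falls short of 1/2 by at most a multiple of the
    distance. So [x] is close to the shared vertex, likewise [y], and both descend to small cells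
    there. The words are nonempty since each passes through a child. *)
Lemma close_cells x y : SG x -> SG y -> x <> y ->
  exists w1 w2 j1 j2, [/\ (0 < size w1)%N, (0 < size w2)%N,
    vtx (cell w1) j1 = vtx (cell w2) j2 :> R * R,
    solid (cell w1) x /\ solid (cell w2) y &
    side w1 + side w2 <= Kcell * eucl_dist x y].
Proof.
move=> Sx Sy xy; have e0 := eucl_gt0 xy; set e := eucl_dist x y in e0 *.
have [w [i [k [ik wx wy]]]] : exists w i k,
    [/\ i != k, solid (cell (rcons w i)) x & solid (cell (rcons w k)) y].
  have s0 := @side0_gt0 R.
  have e1 : 0 < e / (4 * side0) by rewrite divr_gt0// mulr_gt0.
  have [n hn] := exp2V_small e1.
  have [//|[w [sw h1 h2]]] := separate n Sx Sy.
  have := eucl_triangle (vtx (cell w) DA) x y.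
  have := vtx_near DA h1; have := vtx_near DA h2.
  rewrite (eucl_sym _ x) -/e /side sw => a1 a2 a3.
  have : side0 / 2 ^+ n <= e / 4.
    have := ler_wpM2l (ltW s0) hn.
    have -> // : side0 * (e / (4 * side0)) = e / 4 by field; exact: lt0r_neq0.
  by move: (side0 / _) a1 a2 a3 => a; lra.
have [N hN] := exp2V_small e0.
have [u1 [a1 a2 a3]] := corner_descent N k Sx wx.
have [u2 [b1 b2 b3]] := corner_descent N i Sy wy.
exists (rcons w i ++ u1), (rcons w k ++ u2), k, i.
rewrite !size_cat !size_rcons; split => //.
  by rewrite a1 b1 !cell_rcons !vtx_child midpointC.
have n0 : 0 < 2 ^+ size w :> R by rewrite exprn_gt0.
have s0 := @side0_gt0 R.
have L1 := ler_norm (lam w x i - lam w y i).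
have L2 := ler_norm (lam w y k - lam w x k).
have L3 := lam_lipschitz w x y i; have L4 := lam_lipschitz w y x k.
rewrite (eucl_sym y) -/e in L4; rewrite -/e in L3.
have /andP[p1 _] := lam_range k wx; have /andP[p2 _] := lam_range i wy.
have /andP[p3 _] := lam_range i wx; have /andP[p4 _] := lam_range k wy.
have ki : k == i = false by rewrite eq_sym (negbTE ik).
move: a3 b3 p1 p2 p3 p4; rewrite !lam_rcons !eqxx ki (negbTE ik) /= => a3 b3 p1 p2 p3 p4.
rewrite !side_cat !side_rcons -mulrDr.
have ub : (2 ^+ size u1)^-1 + (2 ^+ size u2)^-1 <= 8 * (2 ^+ size w * kappa * e) + 2 * e.
  move: ((2 ^+ size u1)^-1) ((2 ^+ size u2)^-1) ((2 ^+ N)^-1) (2 ^+ size w * kappa * e) a3 b3 hN L3 L4 => A B C D.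
  lra.
apply: le_trans (ler_wpM2l _ ub) _.
  by rewrite divr_ge0// ltW// side_gt0.
rewrite /side /Kcell.
have -> : side0 / 2 ^+ size w / 2 * (8 * (2 ^+ size w * kappa * e) + 2 * e) =
  side0 * 4 * kappa * e + side0 * e * (2 ^+ size w)^-1 by field; exact: lt0r_neq0.
have : (2 ^+ size w)^-1 <= 1 :> R by rewrite invf_le1// exprn_ege1// ler1n.
move: ((2 ^+ size w)^-1) => A hA.
have : side0 * e * A <= side0 * e * 1 by apply: ler_wpM2l => //; rewrite mulr_ge0// ltW.
lra.
Qed.

(** A Lipschitz constant instead of a length: it is easily carried through a limit and yields
    continuity and rectifiability at once. *)
Definition reach (L : R) x y : Prop := exists g : R -> R * R,
  [/\ forall s t, 0 <= s <= 1 -> 0 <= t <= 1 -> eucl_dist (g s) (g t) <= L * `|s - t|,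
      g 0 = x, g 1 = y & forall t, 0 <= t <= 1 -> SG (g t)].

(** Segment [n] takes the time [2 ^ -(n + 1)], so segments of geometrically decreasing length are
    run through at bounded speed. *)
Fixpoint polyline N (p : nat -> R * R) (t : R) : R * R :=
  if N is N'.+1 then
    if t <= 1 / 2 then p 0%N + (2 * t) *: (p 1%N - p 0%N)
    else polyline N' (p \o succn) (2 * t - 1)
  else p 0%N.

Lemma polyline0 N (p : nat -> R * R) : polyline N p 0 = p 0%N.
Proof. by case: N => //= N; rewrite ifT ?mulr0 ?scale0r ?addr0//; lra. Qed.

Lemma polyline1 N (p : nat -> R * R) : polyline N p 1 = p N.
Proof.
elim: N p => //= N ih p; rewrite ifF; last by apply/negbTE; rewrite -ltNge; lra.
by have -> : 2 * 1 - 1 = 1 :> R by ring; rewrite ih.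
Qed.

Lemma polyline_half N (p : nat -> R * R) : polyline N.+1 p (1 / 2) = p 1%N.
Proof.
rewrite /= lexx; have -> : 2 * (1 / 2) = 1 :> R by field.
by rewrite scale1r addrC subrK.
Qed.

Lemma polyline_lipschitz N (p : nat -> R * R) (L : R) : 0 <= L ->
  (forall n, eucl_dist (p n) (p n.+1) <= L / 2 ^+ n.+1) ->
  forall s t, 0 <= s <= 1 -> 0 <= t <= 1 ->
  eucl_dist (polyline N p s) (polyline N p t) <= L * `|s - t|.
Proof.
elim: N p L => [|N ih] p L L0 pL s t s01 t01.
  by rewrite eucl_refl mulr_ge0.
wlog st : s t s01 t01 / s <= t => [W|].
  have [/W|/ltW /W] := leP s t; first exact.
  by rewrite eucl_sym distrC; apply.
have low a b : 0 <= a -> a <= b -> b <= 1 / 2 ->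
    eucl_dist (polyline N.+1 p a) (polyline N.+1 p b) <= L * (b - a).
  move=> a0 ab b1 /=; rewrite !ifT ?(le_trans ab)// eucl_line.
  have := pL 0%N; rewrite expr1 => h.
  have ba : 0 <= 2 * (b - a) by lra.
  have -> : `|2 * a - 2 * b| = 2 * (b - a) by rewrite distrC ger0_norm; lra.
  have := ler_wpM2l ba h; lra.
have hi a b : 1 / 2 <= a -> a <= b -> b <= 1 ->
    eucl_dist (polyline N.+1 p a) (polyline N.+1 p b) <= L * (b - a).
  move=> a0 ab b1.
  have E c : 1 / 2 <= c -> polyline N.+1 p c = polyline N (p \o succn) (2 * c - 1).
    rewrite le_eqVlt => /orP[/eqP <-|c1].
      rewrite polyline_half; have -> : 2 * (1 / 2) - 1 = 0 :> R by field.
      by rewrite polyline0.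
    by rewrite /= ifF//; apply/negbTE; rewrite -ltNge.
  rewrite !E//; last exact: le_trans ab.
  have h := ih (p \o succn) (L / 2) _ _ (2 * a - 1) (2 * b - 1).
  apply: le_trans (h _ _ _ _) _.
  - by rewrite divr_ge0.
  - move=> n /=; apply: le_trans (pL _) _; rewrite le_eqVlt; apply/orP; left; apply/eqP.
    by rewrite [2 ^+ n.+2]exprS invfM mulrA.
  - by apply/andP; split; lra.
  - by apply/andP; split; lra.
  - have -> : `|2 * a - 1 - (2 * b - 1)| = 2 * (b - a) by rewrite distrC ger0_norm; lra.
    by rewrite le_eqVlt; apply/orP; left; apply/eqP; field.
have -> : `|s - t| = t - s by rewrite distrC ger0_norm// subr_ge0.
move/andP: s01 => [s0 s1]; move/andP: t01 => [t0 t1].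
have [th|/ltW th] := leP t (1 / 2); first exact: low.
have [sh|/ltW sh] := leP (1 / 2) s; first exact: hi.
apply: le_trans (eucl_triangle (polyline N.+1 p (1 / 2)) _ _) _.
have h1 := low s (1 / 2) s0 sh (lexx _); have h2 := hi (1 / 2) t (lexx _) th t1.
by apply: le_trans (lerD h1 h2) _; rewrite -mulrDr; apply: ler_wpM2l => //; lra.
Qed.

Lemma polyline_stable N (p : nat -> R * R) (t : R) M : 0 <= t -> t <= 1 - (2 ^+ N)^-1 ->
  polyline (N + M) p t = polyline N p t.
Proof.
elim: N p t => [|N ih] p t t0 t1.
  have -> : t = 0 by rewrite expr0 invr1 in t1; lra.
  by rewrite !polyline0.
rewrite /=; case: ifPn => //; rewrite -ltNge => h; rewrite ih//; first by lra.
by move: t1; rewrite exp2V_S; move: ((2 ^+ N)^-1) => a; lra.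
Qed.

Lemma polyline_SG N (p : nat -> R * R) (t : R) :
  (forall n s, 0 <= s <= 1 -> SG (p n + s *: (p n.+1 - p n))) ->
  0 <= t <= 1 -> SG (polyline N p t).
Proof.
elim: N p t => [|N ih] p t h t01.
  by rewrite /= -[p 0%N]addr0 -(scale0r (p 1%N - p 0%N)); apply: h; rewrite lexx ler01.
move/andP: t01 => [t0 t1].
rewrite /=; case: ifPn => [t2|]; first by apply: h; apply/andP; split; lra.
rewrite -ltNge => t2; apply: ih; last by apply/andP; split; lra.
by move=> n s; exact: h.
Qed.

(** On [t <= 1 - 2 ^ -N] all polylines from the [N]-th on agree; this defines the curve before time
    1, and it tends to [y]. *)
Lemma reach_limit (p : nat -> R * R) (L K : R) y : 0 <= L -> SG y ->
  (forall n, eucl_dist (p n) (p n.+1) <= L / 2 ^+ n.+1) ->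
  (forall n, eucl_dist (p n) y <= K / 2 ^+ n) ->
  (forall n s, 0 <= s <= 1 -> SG (p n + s *: (p n.+1 - p n))) ->
  reach L (p 0%N) y.
Proof.
move=> L0 Sy pL py pS.
pose P t N := t <= 1 - (2 ^+ N)^-1 :> R.
have PS t N M : (N <= M)%N -> P t N -> P t M.
  move=> NM; rewrite /P => h; apply: le_trans h _.
  by rewrite lerD2l lerN2 lef_pV2 ?posrE ?exprn_gt0// ler_eXn2l// ltr1n.
have Pex t : t < 1 -> exists N, P t N.
  by rewrite -subr_gt0 => /exp2V_small[N hN]; exists N; rewrite /P; lra.
pose g t := if pselect (exists N, P t N) is left e then polyline (projT1 (cid e)) p t else y.
have gE t N : 0 <= t -> P t N -> g t = polyline N p t.
  move=> t0 tN; rewrite /g; case: pselect => [e|]; last by case; exists N.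
  case: (cid e) => M tM /=.
  have [NM|/ltnW NM] := leqP N M.
    by rewrite -(subnKC NM) polyline_stable.
  by rewrite -[in RHS](subnKC NM) polyline_stable.
have g1 : g 1 = y.
  rewrite /g; case: pselect => // -[N]; rewrite /P.
  have : 0 < (2 ^+ N)^-1 :> R by rewrite invr_gt0 exprn_gt0.
  by move=> h1 h2; exfalso; lra.
have gy s : 0 <= s <= 1 -> eucl_dist (g s) y <= L * (1 - s).
  move=> /andP[s0]; rewrite le_eqVlt => /orP[/eqP ->|s1].
    by rewrite g1 eucl_refl subrr mulr0.
  have [N0 hN0] := Pex _ s1.
  apply/ler_addgt0Pr => e e0.
  have e1 : 0 < e / (`|K| + 1) by rewrite divr_gt0// ltr_wpDl.
  have [N1 hN1] := exp2V_small e1.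
  pose N := maxn N0 N1.
  have sN : P s N by exact: PS (leq_maxl _ _) hN0.
  rewrite (gE _ _ s0 sN); apply: le_trans (eucl_triangle (p N) _ _) _.
  apply: lerD.
    rewrite -(polyline1 N p); apply: le_trans (polyline_lipschitz N L0 pL _ _) _.
    - by rewrite s0 ltW.
    - by rewrite ler01 lexx.
    by rewrite distrC ger0_norm// subr_ge0 ltW.
  apply: le_trans (py N) _.
  have K1 : 0 < `|K| + 1 by rewrite ltr_wpDl.
  have NN : (2 ^+ N)^-1 <= (2 ^+ N1)^-1 :> R.
    by rewrite lef_pV2 ?posrE ?exprn_gt0// ler_eXn2l ?ltr1n// leq_maxr.
  have := le_trans NN hN1; rewrite ler_pdivlMr// => h; apply: le_trans h.
  rewrite mulrC; apply: ler_wpM2l; first by rewrite invr_ge0 exprn_ge0.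
  by apply: le_trans (ler_norm _) _; rewrite lerDl.
exists g; split=> //.
- move=> s t s01 t01.
  move/andP: (s01) => [s0]; rewrite le_eqVlt => /orP[/eqP ->|s1].
    rewrite g1 eucl_sym; apply: le_trans (gy _ t01) _.
    by rewrite ger0_norm// subr_ge0; case/andP: t01.
  move/andP: (t01) => [t0]; rewrite le_eqVlt => /orP[/eqP ->|t1].
    rewrite g1; apply: le_trans (gy _ s01) _.
    by rewrite distrC ger0_norm// subr_ge0 ltW.
  have [N1 h1] := Pex _ s1; have [N2 h2] := Pex _ t1.
  rewrite (gE s (maxn N1 N2))//; last exact: PS (leq_maxl _ _) h1.
  rewrite (gE t (maxn N1 N2))//; last exact: PS (leq_maxr _ _) h2.
  exact: polyline_lipschitz.
- by rewrite (gE 0 0%N) ?polyline0// /P expr0 invr1 subrr.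
- move=> t /andP[t0]; rewrite le_eqVlt => /orP[/eqP ->|t1]; first by rewrite g1.
  have [N hN] := Pex _ t1; rewrite (gE _ _ t0 hN); apply: polyline_SG => //.
  by rewrite t0 ltW.
Qed.

End GasketMetric.

(** * Curves in the gasket and the geodesic distance *)

Section Geodesic.
Context {R : realType}.
Implicit Types (T : triangle R) (q x y z : R * R) (i j k d : dir) (w v u : seq dir).

(** Follow vertex [j] of nested cells around [x]. From one level to the next it stays or moves by
    half a side along a side, and the moves add up to at most [side w]. *)
Lemma reach_cell w j x : SG x -> solid (cell w) x -> reach (side w) (vtx (cell w) j) x.
Proof.
move=> Sx wx.
pose ch v := if pselect (exists d, solid (cell (rcons v d)) x) is left e
  then projT1 (cid e) else DA.
have chP v : solid (cell v) x -> solid (cell (rcons v (ch v))) x.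
  move=> vx; rewrite /ch; case: pselect => [e|[]]; first by case: (cid e).
  exact: SG_child.
pose ws n := iter n (fun v => rcons v (ch v)) w.
have wsx n : solid (cell (ws n)) x by elim: n => //= n; exact: chP.
have sws n : side (ws n) = side w / 2 ^+ n :> R.
  elim: n => [|n ih]; first by rewrite expr0 divr1.
  by rewrite /= side_rcons ih exp2V_S mulrA.
have step n (s : R) : vtx (cell (ws n)) j +
    s *: (vtx (cell (ws n.+1)) j - vtx (cell (ws n)) j) = epoint (ws n) j (ch (ws n)) (s / 2).
  rewrite /= cell_rcons vtx_child midpointC midpointE /epoint.
  by rewrite [X in s *: X](addrC _ (- _)) addKr scalerA.
apply: (@reach_limit R (fun n => vtx (cell (ws n)) j) (side w) (side w)) => //.
- by rewrite ltW// side_gt0.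
- move=> n; have := step n 1; rewrite scale1r addrC subrK => ->.
  rewrite -(epoint0 _ _ (ch (ws n))) exp2V_S mulrA -sws.
  have [<-|jc] := eqVneq j (ch (ws n)).
    rewrite /epoint subrr !scaler0 eucl_refl divr_ge0// ltW//; exact: side_gt0.
  by rewrite epoint_dist// sub0r normrN div1r ger0_norm// mulrC.
- by move=> n; rewrite -sws; exact: vtx_near.
- move=> n s /andP[s0 s1]; rewrite step; apply: SG_epoint.
  by apply/andP; split; lra.
Qed.

(** The first curve is run backwards, then the second one, each in half the time, which doubles the
    constants. *)
Lemma reach_cat (L M : R) z x y : 0 <= L -> 0 <= M ->
  reach L z x -> reach M z y -> reach (2 * (L + M)) x y.
Proof.
move=> L0 M0 [g [gL g0 g1 gS]] [h [hM h0 h1 hS]].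
pose f (t : R) := if t <= 1 / 2 then g (1 - 2 * t) else h (2 * t - 1).
have fh t : 1 / 2 <= t -> f t = h (2 * t - 1).
  rewrite le_eqVlt => /orP[/eqP <-|t1]; last by rewrite /f ifF// leNgt t1.
  rewrite /f lexx; have -> : 1 - 2 * (1 / 2) = 0 :> R by field.
  have -> : 2 * (1 / 2) - 1 = 0 :> R by field.
  by rewrite g0 h0.
have low a b : 0 <= a -> a <= b -> b <= 1 / 2 ->
    eucl_dist (f a) (f b) <= 2 * (L + M) * (b - a).
  move=> a0 ab b1; rewrite /f (le_trans ab b1) b1.
  apply: le_trans (gL _ _ _ _) _; try by apply/andP; split; lra.
  have -> : 1 - 2 * a - (1 - 2 * b) = 2 * (b - a) by ring.
  rewrite ger0_norm; last by lra.
  by rewrite [2 * (L + M)]mulrC -!mulrA; apply: ler_wpM2r; lra.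
have high a b : 1 / 2 <= a -> a <= b -> b <= 1 ->
    eucl_dist (f a) (f b) <= 2 * (L + M) * (b - a).
  move=> a0 ab b1; rewrite !fh//; last exact: le_trans ab.
  apply: le_trans (hM _ _ _ _) _; try by apply/andP; split; lra.
  have -> : 2 * a - 1 - (2 * b - 1) = - (2 * (b - a)) by ring.
  rewrite normrN ger0_norm; last by lra.
  by rewrite [2 * (L + M)]mulrC -!mulrA; apply: ler_wpM2r; lra.
exists f; split.
- move=> s t; wlog st : s t / s <= t => [W|].
    have [/W|/ltW /W] := leP s t; first exact.
    by rewrite eucl_sym distrC => h' *; apply: h'.
  move=> /andP[s0 s1] /andP[t0 t1].
  have -> : `|s - t| = t - s by rewrite distrC ger0_norm// subr_ge0.
  have [th|/ltW th] := leP t (1 / 2); first exact: low.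
  have [sh|/ltW sh] := leP (1 / 2) s; first exact: high.
  apply: le_trans (eucl_triangle (f (1 / 2)) _ _) _.
  have h1' := low s (1 / 2) s0 sh (lexx _); have h2 := high (1 / 2) t (lexx _) th t1.
  by apply: le_trans (lerD h1' h2) _; rewrite -mulrDr; apply: ler_wpM2l; lra.
- by rewrite /f ifT ?mulr0 ?subr0//; lra.
- rewrite fh; last by lra.
  by have -> : 2 * 1 - 1 = 1 :> R by ring.
- move=> t /andP[t0 t1]; rewrite /f; case: ifPn => [t2|]; first by apply: gS; apply/andP; split; lra.
  by rewrite -ltNge => t2; apply: hS; apply/andP; split; lra.
Qed.

Lemma norm_eucl x y : `|x - y| <= eucl_dist x y.
Proof. by rewrite prod_normE ge_max eucl_coord1 eucl_coord2. Qed.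

Lemma reach_geodesic (L : R) x y : 0 <= L -> reach L x y ->
  (geodesic_dist SG x y <= L%:E)%E.
Proof.
move=> L0 [g [gL g0 g1 gS]].
have len : (curve_length g <= L%:E)%E.
  apply: ge_ereal_sup => _ [s [ps /eqP ls] <-]; rewrite lee_fin.
  suff H (a : R) : 0 <= a -> path <%R a s -> last a s = 1 -> a <= 1 /\
      \sum_(0 <= k < size s) eucl_dist (g (nth 1 (a :: s) k)) (g (nth 1 s k)) <= L * (1 - a).
    by have [_] := H 0 (lexx _) ps ls; rewrite subr0 mulr1.
  elim: s a {ps ls} => [|b s ih] a a0; first by move=> _ /= ->; rewrite big_geq// subrr mulr0.
  move=> /= /andP[ab ps] ls.
  have [b1 hb] := ih b (le_trans a0 (ltW ab)) ps ls.
  split; first by rewrite (le_trans (ltW ab)).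
  rewrite big_nat_recl//=; apply: le_trans (lerD (gL a b _ _) hb) _.
  - by rewrite a0 (le_trans (ltW ab)).
  - by rewrite (le_trans a0 (ltW ab)).
  rewrite distrC gtr0_norm ?subr_gt0// -mulrDr; apply: ler_wpM2l => //; lra.
apply: (le_trans _ len); apply: ereal_inf_lbound; exists g => //; split.
- apply/subspace_continuousP => t t01; apply/cvgrPdist_le => e e0.
  have L1 : 0 < L + 1 by rewrite ltr_wpDl.
  rewrite near_withinE; near=> t2 => t201.
  apply: le_trans (norm_eucl _ _) _.
  apply: le_trans (gL _ _ _ _) _; [by move: t01; rewrite /= in_itv|by move: t201; rewrite /= in_itv|].
  have : `|t - t2| <= e / (L + 1).
    by near: t2; apply: cvgr_dist_le => //; exact: divr_gt0.
  rewrite ler_pdivlMr// mulrC; apply: le_trans; apply: ler_wpM2r => //.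
  by rewrite lerDl.
- by [].
- by move=> _ [t ht <-]; apply: gS; move: ht; rewrite /= in_itv.
- exact: le_lt_trans len (ltry _).
Unshelve. all: by end_near.
Qed.

Lemma eucl_geodesic x y : ((eucl_dist x y)%:E <= geodesic_dist SG x y)%E.
Proof.
apply: le_ereal_inf_tmp => _ [g [_ [g0 g1] _ _] <-].
apply: ereal_sup_ubound; exists [:: 1].
  by split => //=; rewrite ltr01.
by rewrite /= big_nat1/= g0 g1.
Qed.

Lemma geodesic_eucl x y : SG x -> SG y ->
  (geodesic_dist SG x y <= (2 * Kcell * eucl_dist x y)%:E)%E.
Proof.
move=> Sx Sy; have K0 := @Kcell_gt0 R; have e0 := eucl_ge0 x y.
have L0 : 0 <= 2 * Kcell * eucl_dist x y by rewrite mulr_ge0// mulr_ge0// ltW.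
apply: (reach_geodesic L0).
have [xy|xy] := pselect (x = y).
  exists (fun=> x); split=> // s t _ _.
  by rewrite eucl_refl mulr_ge0.
have [w1 [w2 [j1 [j2 [_ _ v12 [h1 h2] hs]]]]] := close_cells Sx Sy xy.
have r1 := reach_cell j1 Sx h1; have r2 := reach_cell j2 Sy h2.
rewrite -v12 in r2.
have [g [gL g0 g1 gS]] := reach_cat (ltW (side_gt0 w1)) (ltW (side_gt0 w2)) r1 r2.
exists g; split=> // s t hs' ht'; apply: le_trans (gL s t hs' ht') _.
by apply: ler_wpM2r => //; lra.
Qed.

Lemma geodesic_side w j k : (geodesic_dist SG (vtx (cell w) j) (vtx (cell w) k : R * R) <= (side w)%:E)%E.
Proof.
have s0 := ltW (@side_gt0 R w).
apply: reach_geodesic => //; exists (epoint w j k).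
rewrite epoint0 epoint1; split=> // [s t _ _|t]; last exact: SG_epoint.
have [->|jk] := eqVneq j k; last by rewrite epoint_dist// mulrC.
by rewrite /epoint subrr !scaler0 eucl_refl mulr_ge0.
Qed.

End Geodesic.

(** * Parametrized triangles *)

Section Parametrization.
Context {R : realType}.
Implicit Types (T : triangle R) (b : R * R -> R) (f g : R -> R).

Definition lip1 (m M : R) f := forall t u, m <= t -> t <= u -> u <= M -> `|f t - f u| <= u - t.

Lemma lip1_glue (c m M : R) f : lip1 m c f -> lip1 c M f -> lip1 m M f.
Proof.
move=> h1 h2 t u mt tu uM.
have [uc|/ltW cu] := leP u c; first exact: h1.
have [ct|/ltW tc] := leP c t; first exact: h2.
have := h1 t c mt tc (lexx _); have := h2 c u (lexx _) cu uM.
by rewrite !ler_norml => /andP[? ?] /andP[? ?]; apply/andP; split; lra.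
Qed.

Lemma lip1P (m M : R) f : lip1 m M f <->
  forall t u, m <= t <= M -> m <= u <= M -> `|f t - f u| <= `|t - u|.
Proof.
split=> [h t u|h t u mt tu uM]; last first.
  apply: le_trans (h t u _ _) _; first by rewrite mt (le_trans tu).
    by rewrite uM (le_trans mt).
  by rewrite distrC ger0_norm// subr_ge0.
wlog tu : t u / t <= u => [W|].
  have [/W|/ltW /W] := leP t u; first exact.
  by rewrite distrC (distrC t) => h' *; apply: h'.
move=> /andP[mt tM] /andP[mu uM]; apply: le_trans (h t u mt tu uM) _.
by rewrite distrC ler_norm.
Qed.

Lemma eq_lip1 (m M : R) f g : (forall t, m <= t -> t <= M -> f t = g t) ->
  lip1 m M f -> lip1 m M g.
Proof.
move=> fg h t u mt tu uM; rewrite -!fg ?(le_trans tu)// ?(le_trans mt)//.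
exact: h.
Qed.

Lemma lip1_shift (m M c : R) f : lip1 m M f -> lip1 (m - c) (M - c) (fun t => f (t + c)).
Proof.
move=> h t u mt tu uM; apply: le_trans (h _ _ _ _ _) _; lra.
Qed.

Arguments lip1_shift {m M} c {f}.

Lemma lip1_opp (m M : R) f : lip1 m M f -> lip1 (- M) (- m) (fun t => f (- t)).
Proof.
move=> h t u mt tu uM; rewrite distrC; apply: le_trans (h _ _ _ _ _) _; lra.
Qed.

Definition edge T j k (t : R) : R * R := vtx T j + t *: (vtx T k - vtx T j).

Definition elip b (l : R) T j k := lip1 0 1 (fun t => b (edge T j k t) / l).

Definition equilateral T (l : R) := forall j k, j != k -> eucl_dist (vtx T j) (vtx T k) = l.

Lemma edge_sym T j k t : edge T j k t = edge T k j (1 - t).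
Proof. by apply: pair_eqP; rewrite /edge /GRing.scale/= /GRing.scale/=; ring. Qed.

Lemma edge0 T j k : edge T j k 0 = vtx T j.
Proof. by rewrite /edge scale0r addr0. Qed.

Lemma edge1 T j k : edge T j k 1 = vtx T k.
Proof. by rewrite /edge scale1r addrC subrK. Qed.

Lemma elip_sym b l T j k : elip b l T j k -> elip b l T k j.
Proof.
move=> h; have := lip1_shift (-1) (lip1_opp h); rewrite /elip; have -> : - 1 - -1 = 0 :> R by ring.
have -> : - 0 - -1 = 1 :> R by ring.
by apply: eq_lip1 => t _ _; rewrite (edge_sym T k) opprD opprK addrC.
Qed.

Lemma elip_edges b l T : elip b l T DA DB -> elip b l T DB DC -> elip b l T DC DA ->
  forall j k, j != k -> elip b l T j k.
Proof. by move=> hab hbc hca; case; case=> //= _; apply: elip_sym. Qed.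

Section Equilateral.
Variables (T : triangle R) (l s0 : R).
Hypotheses (l0 : 0 < l) (eqT : equilateral T l) (s0l : 0 <= s0 < 3 * l).

Let lab : eucl_dist (va T) (vb T) = l. Proof. exact: (eqT (isT : DA != DB)). Qed.
Let lbc : eucl_dist (vb T) (vc T) = l. Proof. exact: (eqT (isT : DB != DC)). Qed.
Let lca : eucl_dist (vc T) (va T) = l. Proof. exact: (eqT (isT : DC != DA)). Qed.

Lemma circumferenceE : circumference T = 3 * l.
Proof. by rewrite /circumference lab lbc lca; ring. Qed.

Lemma pi_radius : pi * Defs.radius T = 3 * l / 2.
Proof.
have p0 : pi != 0 :> R by rewrite gt_eqF// pi_gt0.
rewrite /Defs.radius circumferenceE; move: (@pi R) p0 => P p0; field. exact: p0.
Qed.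

Lemma boundary_ab t : t <= l -> boundary T t = edge T DA DB (t / l).
Proof. by move=> tl; rewrite /boundary lab tl. Qed.

Lemma boundary_bc t : l <= t -> t <= 2 * l -> boundary T t = edge T DB DC (t / l - 1).
Proof.
have l0' := l0; have ln : l != 0 by rewrite gt_eqF.
rewrite le_eqVlt => /orP[/eqP <- _|t1 t2].
  by rewrite boundary_ab// divff// subrr edge0 edge1.
rewrite /boundary lab lbc leNgt t1/= ifT; last by lra.
by rewrite /edge; congr (_ + _ *: _); field.
Qed.

Lemma boundary_ca t : 2 * l <= t -> boundary T t = edge T DC DA (t / l - 2).
Proof.
have l0' := l0; have ln : l != 0 by rewrite gt_eqF.
rewrite le_eqVlt => /orP[/eqP <-|t1].
  rewrite boundary_bc//; last by lra.
  have -> : 2 * l / l - 1 = 1 by field.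
  have -> : 2 * l / l - 2 = 0 by field.
  by rewrite edge0 edge1.
rewrite /boundary lab lbc lca ifF; last by apply/negbTE; rewrite -ltNge; lra.
rewrite ifF; last by apply/negbTE; rewrite -ltNge; lra.
by rewrite /edge; congr (_ + _ *: _); field.
Qed.

Lemma boundary_closed : boundary T (3 * l) = boundary T 0.
Proof.
have l0' := l0; have ln : l != 0 by rewrite gt_eqF.
rewrite boundary_ca; last by lra.
rewrite boundary_ab; last exact: ltW.
have -> : 3 * l / l - 2 = 1 by field.
by rewrite mul0r edge0 edge1.
Qed.

Lemma boundary_edge t : 0 <= t <= 3 * l -> exists j k u,
  [/\ j != k, 0 <= u <= 1 & boundary T t = edge T j k u].
Proof.
have l0' := l0; move=> /andP[t0 t3]; have [t1|/ltW t1] := leP t l.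
  exists DA, DB, (t / l); split=> //; last exact: boundary_ab.
  by rewrite divr_ge0 ?(ltW l0)//= ler_pdivrMr// mul1r.
have [t2|/ltW t2] := leP t (2 * l).
  exists DB, DC, (t / l - 1); split=> //; last exact: boundary_bc.
  by rewrite subr_ge0 ler_pdivlMr// mul1r t1/= lerBlDr ler_pdivrMr.
exists DC, DA, (t / l - 2); split=> //; last exact: boundary_ca.
by rewrite subr_ge0 ler_pdivlMr// t2/= lerBlDr ler_pdivrMr//; lra.
Qed.

Lemma elip_scale b j k c : elip b l T j k <->
  lip1 (c * l) ((c + 1) * l) (fun t => b (edge T j k (t / l - c))).
Proof.
have l0' := l0; have ln : l != 0 by rewrite gt_eqF.
split=> h t u t0 tu u1.
  have := h (t / l - c) (u / l - c).
  rewrite subr_ge0 ler_pdivlMr// lerD2r ler_pM2r ?invr_gt0// lerBlDr ler_pdivrMr// [1 + c]addrC.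
  move=> /(_ t0 tu u1); rewrite -mulrBl normrM (gtr0_norm (x := l^-1)) ?invr_gt0// ler_pdivrMr//.
  by have -> : (u / l - c - (t / l - c)) * l = u - t by field.
have := h ((t + c) * l) ((u + c) * l).
rewrite !ler_pM2r// !mulfK// !addrK lerDr lerD2r [u + c]addrC lerD2l.
move=> /(_ t0 tu u1) h1; rewrite -mulrBl normrM (gtr0_norm (x := l^-1)) ?invr_gt0// ler_pdivrMr//.
by apply: le_trans h1 _; rewrite le_eqVlt; apply/orP; left; apply/eqP; ring.
Qed.

Lemma boundary_lip b : (forall j k, j != k -> elip b l T j k) <->
  lip1 0 (3 * l) (b \o boundary T).
Proof.
have l0' := l0.
split=> [h|h].
  apply: (@lip1_glue l); last apply: (@lip1_glue (2 * l)).
  - have /(elip_scale b DA DB 0) := h DA DB isT; rewrite mul0r add0r mul1r.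
    by apply: eq_lip1 => t t0 t1 /=; rewrite boundary_ab// subr0.
  - have /(elip_scale b DB DC 1) := h DB DC isT; rewrite mul1r.
    by apply: eq_lip1 => t t0 t1 /=; rewrite boundary_bc.
  - have /(elip_scale b DC DA 2) := h DC DA isT; have -> : 2 + 1 = 3 :> R by ring.
    by apply: eq_lip1 => t t0 t1 /=; rewrite boundary_ca.
have sub m M m' M' f : m <= m' -> M' <= M -> lip1 m M f -> lip1 m' M' f.
  by move=> mm MM h' t u mt tu uM; apply: h' => //; [exact: le_trans mt|exact: le_trans MM].
have hab : elip b l T DA DB.
  apply/(elip_scale b DA DB 0); rewrite mul0r add0r mul1r.
  apply: (@eq_lip1 _ _ (b \o boundary T)); last by apply: sub h; lra.
  by move=> t t0 t1 /=; rewrite boundary_ab// subr0.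
have hbc : elip b l T DB DC.
  apply/(elip_scale b DB DC 1); rewrite mul1r.
  apply: (@eq_lip1 _ _ (b \o boundary T)); last by apply: sub h; lra.
  by move=> t t0 t1 /=; rewrite boundary_bc.
have hca : elip b l T DC DA.
  apply/(elip_scale b DC DA 2); have -> : 2 + 1 = 3 :> R by ring.
  apply: (@eq_lip1 _ _ (b \o boundary T)); last by apply: sub h; lra.
  by move=> t t0 t1 /=; rewrite boundary_ca.
exact: elip_edges.
Qed.

Lemma paramE x : param T s0 x =
  boundary T (if x + (3 * l / 2 + s0) <= 3 * l then x + (3 * l / 2 + s0)
              else x + (3 * l / 2 + s0) - 3 * l).
Proof. by rewrite /param pi_radius circumferenceE addrA. Qed.

Lemma param_low x : x + (3 * l / 2 + s0) <= 3 * l -> param T s0 x = boundary T (x + (3 * l / 2 + s0)).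
Proof. by rewrite paramE => ->. Qed.

Lemma param_high x : 3 * l <= x + (3 * l / 2 + s0) ->
  param T s0 x = boundary T (x + (3 * l / 2 + s0) - 3 * l).
Proof.
rewrite paramE le_eqVlt => /orP[/eqP <-|h]; first by rewrite lexx subrr boundary_closed.
by rewrite leNgt h.
Qed.

Lemma param_closed : param T s0 (pi * Defs.radius T) = param T s0 (- (pi * Defs.radius T)).
Proof.
have l0' := l0; case/andP: s0l => h1 h2.
rewrite pi_radius param_high; last by lra.
by rewrite param_low; [congr boundary|]; lra.
Qed.

Lemma param_range x : circle_dom (Defs.radius T) x -> exists t, 0 <= t <= 3 * l /\ param T s0 x = boundary T t.
Proof.
rewrite /circle_dom /= in_itv/= pi_radius => /andP[h1 h2]; have l0' := l0; have /andP[s1 s2] := s0l.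
have [h|/ltW h] := leP (x + (3 * l / 2 + s0)) (3 * l).
  by rewrite param_low//; eexists; split; last reflexivity; apply/andP; split; lra.
by rewrite param_high//; eexists; split; last reflexivity; apply/andP; split; lra.
Qed.

Lemma param_edge x : circle_dom (Defs.radius T) x -> exists j k u,
  [/\ j != k, 0 <= u <= 1 & param T s0 x = edge T j k u].
Proof. by move=> /param_range[t [t0 ->]]; exact: boundary_edge. Qed.

Lemma lip1_sub (m M m' M' : R) f : m <= m' -> M' <= M -> lip1 m M f -> lip1 m' M' f.
Proof.
by move=> mm MM h' t u mt tu uM; apply: h' => //; [exact: le_trans mt|exact: le_trans MM].
Qed.

(** The parametrization is the boundary curve cut at [s0] instead of [va T]. Each direction shifts
    the two pieces between these points and glues them in the other order. *)
Lemma param_lip b : (forall j k, j != k -> elip b l T j k) <->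
  lip1 (- (pi * Defs.radius T)) (pi * Defs.radius T) (b \o param T s0).
Proof.
rewrite boundary_lip pi_radius; have /andP[s1 s2] := s0l; have l0' := l0.
pose c := 3 * l / 2 + s0.
split=> h.
  apply: (@lip1_glue (3 * l - c)).
    have := lip1_shift c (lip1_sub s1 (lexx _) h).
    have -> : s0 - c = - (3 * l / 2) by rewrite /c; ring.
    by apply: eq_lip1 => t _ t1 /=; rewrite param_low//; rewrite /c in t1; lra.
  have h1 := lip1_shift (c - 3 * l) (lip1_sub (lexx _) (ltW s2) h).
  have e1 : 0 - (c - 3 * l) = 3 * l - c by ring.
  have e2 : s0 - (c - 3 * l) = 3 * l / 2 by rewrite /c; field.
  rewrite e1 e2 in h1; apply: eq_lip1 h1 => t t1 _ /=; rewrite param_high; last by rewrite /c in t1; lra.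
  by rewrite addrA.
apply: (@lip1_glue s0).
  have h1 := lip1_shift (3 * l - c) (@lip1_sub _ _ (3 * l - c) (3 * l / 2) _ _ (lexx _) h).
  have e1 : 3 * l - c - (3 * l - c) = 0 by ring.
  have e2 : 3 * l / 2 - (3 * l - c) = s0 by rewrite /c; field.
  rewrite e1 e2 in h1; apply: eq_lip1 (h1 _) => [t t0 t1 /=|]; last by rewrite /c; lra.
  rewrite param_high; last by rewrite /c; lra.
  by congr (b (boundary _ _)); rewrite /c; ring.
have h1 := lip1_shift (- c) (@lip1_sub _ _ (- (3 * l / 2)) (3 * l - c) _ (lexx _) _ h).
have e1 : - (3 * l / 2) - - c = s0 by rewrite /c; ring.
have e2 : 3 * l - c - - c = 3 * l by ring.
rewrite e1 e2 in h1; apply: eq_lip1 (h1 _) => [t t0 t1 /=|]; last by rewrite /c; lra.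
rewrite param_low; last by rewrite /c; lra.
by congr (b (boundary _ _)); rewrite /c; ring.
Qed.

End Equilateral.
End Parametrization.

(** * Translation between commutator bounds and functions on retained edges *)

Section Link.
Context {R : realType}.
Implicit Types (T : triangle R) (p q : R * R) (b : R * R -> R) (j k d : dir) (w v u : seq dir).
Implicit Types (miss : option (seq dir)).
Local Notation Re := complex.Re.
Local Notation Im := complex.Im.
Local Notation radius := Defs.radius.

Definition word_index w : summand_index :=
  Some (existT (fun m => 'I_(3 ^ m)%N) (size w) (Ordinal (index_lt w))).

Definition index_of miss : summand_index := if miss is Some w then word_index w else None.

Lemma index_of_surj i : exists miss, i = index_of miss.
Proof.
case: i => [[m k]|]; last by exists None.
have [w [sw iw]] := index_surj (ltn_ord k); exists (Some w).
rewrite /index_of /word_index; case: m / sw k iw => k iw; congr (Some (existT _ _ _)).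
exact/val_inj.
Qed.

Lemma index_of_inj : injective index_of.
Proof.
case=> [w|] [v|]//= [sw iw]; congr Some; exact: index_inj.
Qed.

Lemma equilateral_cell w : equilateral (cell w) (side w : R).
Proof. by move=> j k jk; exact: vtx_dist. Qed.

(** Each side of a hole is the inner side of one of the three children; through this, conditions on
    middle triangles become conditions on sides of cells. *)
Lemma edge_middle w t :
  [/\ edge (middle (cell w)) DA DB t = epoint (rcons w DB) DA DC t :> R * R,
      edge (middle (cell w)) DB DC t = epoint (rcons w DC) DB DA t :> R * R &
      edge (middle (cell w)) DC DA t = epoint (rcons w DA) DC DB t :> R * R].
Proof. by rewrite /edge /epoint !cell_rcons. Qed.

Lemma equilateral_middle w : equilateral (middle (cell w)) (side w / 2 : R).
Proof.
move=> j k jk; have [h1 h2 h3] := edge_middle w 1; have [e1 e2 e3] := edge_middle w 0.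
have H T i1 i2 : eucl_dist (edge T i1 i2 0) (edge T i1 i2 1) =
    eucl_dist (vtx T i1) (vtx T i2) by rewrite edge0 edge1.
rewrite -H; case: j k jk; case=> //= _.
- by rewrite e1 h1 epoint_dist// sub0r normrN1 mul1r side_rcons.
- by rewrite H eucl_sym -H e3 h3 epoint_dist// sub0r normrN1 mul1r side_rcons.
- by rewrite H eucl_sym -H e1 h1 epoint_dist// sub0r normrN1 mul1r side_rcons.
- by rewrite e2 h2 epoint_dist// sub0r normrN1 mul1r side_rcons.
- by rewrite e3 h3 epoint_dist// sub0r normrN1 mul1r side_rcons.
- by rewrite H eucl_sym -H e2 h2 epoint_dist// sub0r normrN1 mul1r side_rcons.
Qed.

Lemma SG_edge_middle w j k t : j != k -> 0 <= t <= 1 -> SG (edge (middle (cell w)) j k t : R * R).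
Proof.
move=> jk t01.
have t01' : 0 <= 1 - t <= 1 by move/andP: t01 => [? ?]; apply/andP; split; lra.
have [h1 h2 h3] := edge_middle w t; have [e1 e2 e3] := edge_middle w (1 - t).
by case: j k jk; case=> //= _; rewrite ?h1 ?h2 ?h3 1?edge_sym ?e1 ?e2 ?e3; exact: SG_epoint.
Qed.

(* miss = None means that Delta01 is left out, miss = Some w that the triangle
   removed from cell w is. *)
Definition admissible miss b :=
  (miss <> None -> forall j k, j != k -> elip b (side [::]) (cell [::]) j k) /\
  (forall w, miss <> Some w -> forall j k, j != k -> elip b (side w / 2) (middle (cell w)) j k).

Definition tside miss : R := if miss is Some w then side w / 2 else side [::].

Lemma tside_gt0 miss : 0 < tside miss.
Proof. by case: miss => [w|]; [apply: divr_gt0 => //|]; exact: side_gt0. Qed.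

Lemma equilateral_summand miss : equilateral (summand_triangle (index_of miss)) (tside miss).
Proof.
case: miss => [w|] /=; last exact: (equilateral_cell [::]).
rewrite nabla_index; exact: equilateral_middle.
Qed.

Lemma SG_edge_summand miss j k t : j != k -> 0 <= t <= 1 ->
  SG (edge (summand_triangle (index_of miss)) j k t : R * R).
Proof.
case: miss => [w|] jk t01 /=; last exact: (@SG_epoint _ [::]).
rewrite nabla_index; exact: SG_edge_middle.
Qed.

Lemma admissibleP miss b : admissible miss b <->
  forall m, m <> miss -> forall j k, j != k ->
    elip b (tside m) (summand_triangle (index_of m)) j k.
Proof.
split=> [[h1 h2] [w|] hm j k jk|h].
- rewrite /= nabla_index; apply: h2 => //.
  by move=> e; apply: hm.
- by apply: h1 => // e; apply: hm.
- split=> [hm|w hm] j k jk; first by apply: (h None) => // e; apply: hm.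
  have := h (Some w) (fun e => hm (esym e)) j k jk.
  by rewrite /= nabla_index.
Qed.

Section Modules.
Variable s : @summand_index -> R.
Hypothesis hs : forall i, 0 <= s i < circumference (summand_triangle i).

Definition rho (i : summand_index) : R -> R * R :=
  if i is Some _ then param (summand_triangle i) (s i)
  else fun x => param (summand_triangle i) (s i) (- x).

Lemma RGT_curves i0 : RGT s i0 =
  direct_sum (fun i : {i : summand_index | i != i0} =>
    curve_module (radius (summand_triangle (val i))) (rho (val i))).
Proof. by congr direct_sum; apply/funext => -[[mk|] ?]. Qed.

Lemma base_range miss : 0 <= s (index_of miss) < 3 * tside miss.
Proof. by rewrite -(circumferenceE (equilateral_summand miss)) hs. Qed.

Lemma radius_gt0 i : 0 < radius (summand_triangle i : triangle R).
Proof.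
have [m ->] := index_of_surj i.
rewrite -(pmulr_rgt0 _ (@pi_gt0 R)) (pi_radius (equilateral_summand m)).
by rewrite divr_gt0// mulr_gt0// tside_gt0.
Qed.

Lemma circle_domN r (x : R) : circle_dom r x -> circle_dom r (- x).
Proof. by rewrite /circle_dom /= !in_itv/= => /andP[? ?]; apply/andP; split; lra. Qed.

(** The reversed orientation of the outer triangle only reflects the interval, which preserves the
    Lipschitz condition. *)
Lemma rho_lip m b :
  (forall j k, j != k -> elip b (tside m) (summand_triangle (index_of m)) j k) <->
  lip1 (- (pi * radius (summand_triangle (index_of m)))) (pi * radius (summand_triangle (index_of m)))
    (b \o rho (index_of m)).
Proof.
rewrite (param_lip (tside_gt0 m) (equilateral_summand m) (base_range m)).
case: m => [w|]//=; split=> h.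
- by have := lip1_opp h; rewrite opprK.
- have := lip1_opp h; rewrite opprK; apply: eq_lip1 => t _ _ /=.
  by rewrite opprK.
Qed.

Lemma rho_SG i x : circle_dom (radius (summand_triangle i)) x -> SG (rho i x).
Proof.
have [m ->] := index_of_surj i => Jx.
have [y [Jy ->]] : exists y, circle_dom (radius (summand_triangle (index_of m))) y /\
    rho (index_of m) x = param (summand_triangle (index_of m)) (s (index_of m)) y.
  by case: m Jx => [w|] Jx; [exists x|exists (- x); split => //; exact: circle_domN].
have [j [k [u [jk u01 ->]]]] :=
  param_edge (tside_gt0 m) (equilateral_summand m) (base_range m) Jy.
exact: SG_edge_summand.
Qed.

Lemma rho_closed i : rho i (pi * radius (summand_triangle i)) = rho i (- (pi * radius (summand_triangle i))).
Proof.
have [m ->] := index_of_surj i.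
have := param_closed (tside_gt0 m) (equilateral_summand m) (base_range m).
by case: m => [w|]//=; rewrite opprK => ->.
Qed.

Lemma coord_elip (c : R * R -> R) T (l : R) j k : 0 < l -> equilateral T l -> j != k ->
  (forall p q, `|c p - c q| <= eucl_dist p q) -> elip c l T j k.
Proof.
move=> l0 eT jk hc t u t0 tu u1.
rewrite -mulrBl normrM (gtr0_norm (x := l^-1)) ?invr_gt0// ler_pdivrMr//.
apply: le_trans (hc _ _) _; rewrite /edge eucl_line eT//.
by rewrite distrC ger0_norm// subr_ge0.
Qed.

Lemma rho_continuous i :
  {within circle_dom (radius (summand_triangle i)), continuous (rho i)}.
Proof.
have [m ->] := index_of_surj i; set r := radius _.
have H (c : R * R -> R) : (forall p q, `|c p - c q| <= eucl_dist p q) ->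
    {within circle_dom r, continuous (c \o rho (index_of m))}.
  move=> hc; apply: lipschitz_within; have /lip1P h : lip1 (- (pi * r)) (pi * r) (c \o rho (index_of m)).
    apply/rho_lip => j k jk; apply: coord_elip => //; first exact: tside_gt0.
    exact: equilateral_summand.
  by move=> t y; rewrite /circle_dom /= !in_itv/=; exact: h.
have h1 := H fst (@eucl_coord1 R); have h2 := H snd (@eucl_coord2 R).
apply/subspace_continuousP => t Jt.
rewrite [rho _](_ : _ = fun t => ((rho (index_of m) t).1, (rho (index_of m) t).2)); last first.
  by apply/funext => u; case: (rho _ u).
move/subspace_continuousP: h1 => /(_ t Jt) h1; move/subspace_continuousP: h2 => /(_ t Jt) h2.
exact: (cvg_pair h1 h2).
Qed.

Lemma part_continuous (h : R[i] -> R) (a : R * R -> R[i]^o) i :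
  (forall z z', (`|h z - h z'|)%:C%C <= `|z - z'|) ->
  {within SG, continuous a} ->
  {within circle_dom (radius (summand_triangle i)), continuous (fun x => h (a (rho i x)))}.
Proof.
move=> hh /subspace_continuousP ca; apply/subspace_continuousP => x Jx.
have /subspace_continuousP/(_ _ Jx) cr := @rho_continuous i.
apply/cvgrPdist_le => e e0.
have := ca _ (rho_SG Jx) => /cvgrPdist_le /(_ (e%:C%C)) hca.
have {}hca : \forall q \near rho i x, SG q -> `|a (rho i x) - a q| <= e%:C%C.
  have e1 : 0 < e%:C%C :> R[i] by rewrite ltcR.
  exact: (hca e1).
have := cr _ hca; rewrite /= => hr.
have JJ : \forall t \near within (circle_dom (radius (summand_triangle i))) (nbhs x),
    circle_dom (radius (summand_triangle i)) t by exact: withinT.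
near=> t.
have h1 : `|a (rho i x) - a (rho i t)| <= e%:C%C.
  have : SG (rho i t) by apply: rho_SG; near: t.
  by near: t.
by have := le_trans (hh _ _) h1; rewrite lecR.
Unshelve. all: by end_near.
Qed.

Lemma normc_ge_Im (z : R[i]) : (`|Im z|)%:C%C <= `|z|.
Proof. by rewrite normc_def lecR -sqrtr_sqr ler_wsqrtr// lerDr sqr_ge0. Qed.

(** Every retained summand is restricted to its circle. Real and imaginary parts are bounded
    separately, which costs a factor 2 in [induced_dist_le]. *)
Lemma commutator_admissible miss (a : R * R -> R[i]^o) :
  {within SG, continuous a} -> commutator_le1 (RGT s (index_of miss)) a ->
  admissible miss (fun p => Re (a p)) /\ admissible miss (fun p => Im (a p)).
Proof.
move=> ca; rewrite RGT_curves => ha.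
have H m : m <> miss -> let r := radius (summand_triangle (index_of m)) in
    forall x y, circle_dom r x -> circle_dom r y ->
    `|Re (a (rho (index_of m) x)) - Re (a (rho (index_of m) y))| <= `|x - y| /\
    `|Im (a (rho (index_of m) x)) - Im (a (rho (index_of m) y))| <= `|x - y|.
  move=> mm r x y Jx Jy.
  have ne : index_of m != index_of miss by apply/eqP => /index_of_inj.
  pose i : {i : summand_index | i != index_of miss} :=
    exist (fun i => is_true (i != index_of miss)) (index_of m) ne.
  apply: (@multiplier_lipschitz R r (radius_gt0 _) (fun x => a (rho (index_of m) x))) => //.
  - have hRe (z z' : R[i]) : (`|Re z - Re z'|)%:C%C <= `|z - z'|.
      by rewrite -raddfB; exact: normc_ge_Re.
    exact: (part_continuous (i := index_of m) hRe ca).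
  - have hIm (z z' : R[i]) : (`|Im z - Im z'|)%:C%C <= `|z - z'|.
      by rewrite -raddfB; exact: normc_ge_Im.
    exact: (part_continuous (i := index_of m) hIm ca).
  - exact: (@commutator_le1_component _ _ _ _ (fun i => radius_gt0 (val i)) a ha i).
split; apply/admissibleP => m mm; apply/rho_lip/lip1P => x y Jx Jy /=.
- have Jx' : circle_dom (radius (summand_triangle (index_of m))) x by rewrite /circle_dom /= in_itv.
  have Jy' : circle_dom (radius (summand_triangle (index_of m))) y by rewrite /circle_dom /= in_itv.
  by have [] := H m mm x y Jx' Jy'.
- have Jx' : circle_dom (radius (summand_triangle (index_of m))) x by rewrite /circle_dom /= in_itv.
  have Jy' : circle_dom (radius (summand_triangle (index_of m))) y by rewrite /circle_dom /= in_itv.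
  by have [] := H m mm x y Jx' Jy'.
Qed.

Lemma admissible_commutator miss b (B : R) : (forall p, SG p -> `|b p| <= B) ->
  admissible miss b -> commutator_le1 (RGT s (index_of miss)) (fun p => (b p)%:C%C).
Proof.
move=> bB /admissibleP h; rewrite RGT_curves.
apply: (@commutator_le1_lipschitz _ _ _ _ (fun i => radius_gt0 (val i)) b B).
- by move=> i x Jx; apply: bB; exact: rho_SG.
- by move=> i; rewrite rho_closed.
- move=> [i im]; have [m mi] := index_of_surj i; subst i; move=> t y Jt Jy /=.
  have /rho_lip/lip1P H : forall j k, j != k ->
      elip b (tside m) (summand_triangle (index_of m)) j k.
    by move=> j k jk; apply: h => // e; have /eqP := im; rewrite e.
  by apply: H; [move: Jt|move: Jy]; rewrite /circle_dom /= in_itv.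
Qed.

End Modules.
End Link.

(** * Chains of retained edges *)

Section Chain.
Context {R : realType}.
Implicit Types (x y p q : R * R) (i j k l d : dir) (w v u : seq dir).
Variables (miss : option (seq dir)) (b : R * R -> R).
Hypothesis adm : admissible miss b.

Definition edge_lip w j k := elip b (side w) (cell w) j k.

Lemma edge_lipP w j k : edge_lip w j k <-> forall t u : R, 0 <= t -> t <= u -> u <= 1 ->
  `|b (epoint w j k t) - b (epoint w j k u)| <= (u - t) * side w.
Proof.
have s0 := @side_gt0 R w.
split=> h t u t0 tu u1.
  have := h t u t0 tu u1.
  by rewrite -mulrBl normrM (gtr0_norm (x := (side w)^-1)) ?invr_gt0// ler_pdivrMr.
rewrite -mulrBl normrM (gtr0_norm (x := (side w)^-1)) ?invr_gt0// ler_pdivrMr//.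
exact: h.
Qed.

Lemma edge_lip_left w j k : edge_lip w j k -> edge_lip (rcons w j) j k.
Proof.
move=> /edge_lipP h; apply/edge_lipP => t u t0 tu u1.
rewrite !epoint_left side_rcons; apply: le_trans (h _ _ _ _ _) _; [lra|lra|lra|].
by rewrite le_eqVlt; apply/orP; left; apply/eqP; field.
Qed.

Lemma edge_lip_right w j k : edge_lip w j k -> edge_lip (rcons w k) j k.
Proof.
move=> /edge_lipP h; apply/edge_lipP => t u t0 tu u1.
rewrite !epoint_right side_rcons; apply: le_trans (h _ _ _ _ _) _; [lra|lra|lra|].
by rewrite le_eqVlt; apply/orP; left; apply/eqP; field.
Qed.

Lemma edge_lip_sym w j k : edge_lip w j k -> edge_lip w k j.
Proof. exact: elip_sym. Qed.

Lemma edge_lip_middle w i j k : miss <> Some w -> i != j -> i != k -> j != k ->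
  edge_lip (rcons w i) j k.
Proof.
move=> hw ij ik jk; have [_ /(_ w hw) h] := adm.
have H i1 j1 k1 j2 k2 : j1 != k1 ->
    (forall t, edge (middle (cell w)) j1 k1 t = epoint (rcons w i1) j2 k2 t :> R * R) ->
    edge_lip (rcons w i1) j2 k2.
  move=> jk1 e; have := h j1 k1 jk1; rewrite /edge_lip /elip side_rcons.
  by apply: eq_lip1 => t _ _; rewrite e.
have h1 : edge_lip (rcons w DB) DA DC by apply: (H DB DA DB) => // t; have [] := edge_middle w t.
have h2 : edge_lip (rcons w DC) DB DA by apply: (H DC DB DC) => // t; have [] := edge_middle w t.
have h3 : edge_lip (rcons w DA) DC DB by apply: (H DA DC DA) => // t; have [] := edge_middle w t.
by clear -h1 h2 h3 ij ik jk; case: i ij ik; case: j jk; case: k => //= _ _ _; apply: edge_lip_sym.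
Qed.

Lemma edge_lip_half w j k : edge_lip w j k ->
  `|b (vtx (cell w) j) - b (vtx (cell (rcons w j)) k)| <= side w / 2.
Proof.
move=> /edge_lipP h; rewrite -(epoint0 w j k) -(epoint1 (rcons w j) j k) epoint_left.
by apply: le_trans (h _ _ _ _ _) _; [lra|lra|lra|lra].
Qed.

Lemma edge_lip_full w j k : edge_lip w j k ->
  `|b (vtx (cell w) j) - b (vtx (cell w) k)| <= side w.
Proof.
move=> /edge_lipP h; rewrite -(epoint0 w j k) -(epoint1 w j k).
by apply: le_trans (h _ _ _ _ _) _; [lra|lra|lra|lra].
Qed.

(* From a linked vertex of a cell one can reach a linked vertex of any child
   along retained edges of total length at most side w; iterating, any point of
   the cell is within 2 * side w. *)
Definition linked w j := (exists k, j != k /\ edge_lip w j k) /\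
  ((forall k l, k != l -> edge_lip w k l) \/ (forall u, miss <> Some (w ++ u))).

Lemma vtx_rcons w i j : vtx (cell (rcons w i)) j = vtx (cell (rcons w j)) i :> R * R.
Proof. by rewrite !cell_rcons !vtx_child midpointC. Qed.

Lemma vtx_rcons_id w j : vtx (cell (rcons w j)) j = vtx (cell w) j :> R * R.
Proof. by rewrite cell_rcons vtx_child midpointxx. Qed.

Lemma dir_third j k : j != k -> exists l, [/\ l != j, l != k & forall i, [\/ i = j, i = k | i = l]].
Proof.
case: j; case: k => // _; [exists DC|exists DB|exists DC|exists DA|exists DB|exists DA];
  split=> //; by case; (try by constructor 1); (try by constructor 2); constructor 3.
Qed.

(** The case that needs a detour is the third child [l] when the side from [j] to [l] may be lost:
    go half way towards [k], then across the child at [j] along the middle triangle, half a side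
    each time. *)
Lemma linked_child w j i : linked w j -> exists j', linked (rcons w i) j' /\
  `|b (vtx (cell w) j) - b (vtx (cell (rcons w i)) j')| <= side w.
Proof.
have s0 := @side_gt0 R w; move=> [[k [jk gk]] hw].
(* If the hole of [w] is the triangle left out, no child contains it any more; otherwise its sides
   are retained and complete those of the children. *)
have inherit : (forall k l, k != l -> edge_lip (rcons w i) k l) \/
    (forall u, miss <> Some (rcons w i ++ u)).
  case: hw => [all|noext]; last by right=> u; rewrite cat_rcons.
  have [e|ne] := pselect (miss = Some w).
    right=> u; rewrite e => -[/(congr1 size)]; rewrite size_cat size_rcons => h.
    by have := leq_addr (size u) (size w).+1; rewrite -h ltnn.
  left=> k1 l1 kl; have [ki|ki] := eqVneq k1 i.
    by move: kl; rewrite ki => kl; apply/edge_lip_left/all.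
  have [li|li] := eqVneq l1 i.
    by move: kl; rewrite li => kl; apply/edge_lip_right/all.
  by apply: edge_lip_middle => //; rewrite eq_sym.
have stay : i = j -> exists j', linked (rcons w i) j' /\
    `|b (vtx (cell w) j) - b (vtx (cell (rcons w i)) j')| <= side w.
  move=> ij; exists j; split; last by rewrite ij vtx_rcons_id subrr normr0 ltW.
  by split=> //; exists k; rewrite ij; split=> //; exact: edge_lip_left.
have along m : i = m -> j != m -> edge_lip w j m -> exists j', linked (rcons w i) j' /\
    `|b (vtx (cell w) j) - b (vtx (cell (rcons w i)) j')| <= side w.
  move=> im jm gm; exists j; split; last first.
    by rewrite vtx_rcons im; apply: le_trans (edge_lip_half gm) _; lra.
  by split=> //; exists i; rewrite im; split=> //; exact: edge_lip_right.
have [l [lj lk dirs]] := dir_third jk.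
have [ij|ik|il] := dirs i; [exact: stay|exact: (along k)|].
case: hw => [all|noext]; first by apply: (along l) => //; [rewrite eq_sym|apply: all; rewrite eq_sym].
have wm : miss <> Some w by have := noext [::]; rewrite cats0.
exists j; split.
  split=> //; exists k; rewrite il; split=> //; exact: edge_lip_middle.
rewrite vtx_rcons il.
have h1 := edge_lip_half gk.
have h2 : `|b (vtx (cell (rcons w j)) k) - b (vtx (cell (rcons w j)) l)| <= side w / 2.
  by rewrite -(side_rcons w j); apply: edge_lip_full; apply: edge_lip_middle => //; rewrite eq_sym.
by move: h1 h2; rewrite !ler_norml => /andP[? ?] /andP[? ?]; apply/andP; split; lra.
Qed.

(** The empty word is excluded because, with the outer triangle left out, no side of [cell [::]] is
    retained. One level down the first middle triangle provides an edge. *)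
Lemma linked_exists w : (0 < size w)%N -> exists j, linked w j.
Proof.
elim/last_ind: w => [|w i ih]// _.
have [w0|/ih[j lj]] := posnP (size w); last by have [j' []] := linked_child i lj; exists j'.
rewrite (size0nil w0).
have [e|ne] := pselect (miss = None); last first.
  have [h _] := adm.
  have : linked [::] i.
    split; last by left=> k l kl; exact: h.
    have [k ik] : exists k, i != k by case: (i); [exists DB|exists DA|exists DA].
    by exists k; split=> //; exact: h.
  by move=> /(linked_child i)[j' [lj' _]]; exists j'.
have [k ik] : exists k, i != k by case: (i); [exists DB|exists DA|exists DA].
have [l [li lk _]] := dir_third ik.
exists k; split; last by right=> u; rewrite e.
exists l; split; first by rewrite eq_sym.
by apply: edge_lip_middle => //; rewrite 1?eq_sym// e.
Qed.

Hypothesis cb : forall y (e : R), SG y -> 0 < e -> exists d : R, 0 < d /\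
  forall q, SG q -> eucl_dist q y <= d -> `|b q - b y| <= e.

Lemma linked_near w j y n : SG y -> solid (cell w) y -> linked w j -> exists q,
  [/\ SG q, eucl_dist q y <= side w / 2 ^+ n &
      `|b (vtx (cell w) j) - b q| <= 2 * side w].
Proof.
move=> Sy; elim: n w j => [|n ih] w j wy lj; have s0 := @side_gt0 R w.
  exists (vtx (cell w) j); rewrite expr0 divr1 subrr normr0; split.
  - exact: SG_vtx.
  - exact: vtx_near.
  - by apply: mulr_ge0 => //; exact: ltW.
have [i iy] := SG_child Sy wy; have [j' [lj' h]] := linked_child i lj.
have [q [Sq qy hq]] := ih _ _ iy lj'; exists q; split=> //.
  by apply: le_trans qy _; rewrite side_rcons exprS invfM mulrA.
move: h hq; rewrite side_rcons !ler_norml => /andP[? ?] /andP[? ?]; apply/andP; split; lra.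
Qed.

(** Chains of edges only reach points as close to [y] as desired; continuity of [b] carries the
    bound over to [y]. *)
Lemma linked_osc w j y : SG y -> solid (cell w) y -> linked w j ->
  `|b (vtx (cell w) j) - b y| <= 2 * side w.
Proof.
move=> Sy wy lj; apply/ler_addgt0Pr => e e0; have s0 := @side_gt0 R w.
have [d [d0 hd]] := cb Sy e0.
have [n hn] := exp2V_small (divr_gt0 d0 s0).
have [q [Sq qy hq]] := linked_near n Sy wy lj.
apply: le_trans (ler_distD (b q) _ _) _; apply: lerD => //; apply: hd => //.
apply: le_trans qy _; rewrite mulrC; move: hn; by rewrite ler_pdivlMr.
Qed.

(** The linked vertex of a cell need not be the vertex shared by the two cells; passing through it
    costs [2 * side] twice, hence the factor 4. *)
Lemma admissible_lip x y : SG x -> SG y -> `|b x - b y| <= 4 * Kcell * eucl_dist x y.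
Proof.
move=> Sx Sy; have [->|xy] := pselect (x = y).
  by rewrite subrr normr0 eucl_refl mulr0.
have [w1 [w2 [j1 [j2 [n1 n2 v12 [h1 h2] hs]]]]] := close_cells Sx Sy xy.
have H w j z : (0 < size w)%N -> SG z -> solid (cell w) z ->
    `|b (vtx (cell w) j) - b z| <= 4 * side w.
  move=> nw Sz wz; have [i li] := linked_exists nw.
  have a1 := linked_osc Sz wz li.
  have a2 : `|b (vtx (cell w) i) - b (vtx (cell w) j)| <= 2 * side w.
    apply: linked_osc li; first exact: SG_vtx.
    by rewrite -(epoint0 w j j); apply: solid_epoint; rewrite lexx ler01.
  by move: a1 a2; rewrite !ler_norml => /andP[? ?] /andP[? ?]; apply/andP; split; lra.
have a1 := H w1 j1 x n1 Sx h1; have a2 := H w2 j2 y n2 Sy h2.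
rewrite -v12 in a2; apply: le_trans (_ : _ <= 4 * (side w1 + side w2)) _; last by rewrite -mulrA ler_wpM2l.
by move: a1 a2; rewrite !ler_norml => /andP[? ?] /andP[? ?]; apply/andP; split; lra.
Qed.

End Chain.

(** * The extremal function *)

(* Shape of the extremal function on a cell: Path u leads down to the cell
   of the missing middle triangle, D0 and D1 are the first two cells when the
   outer triangle is missing, Aff stands for harmless interpolation, and in a
   cell of shape Bad i the side opposite to vertex i lies on the missing
   triangle and is stretched by the factor 3/2. *)
Inductive mode := Aff | Bad of dir | Path of seq dir | D0 | D1.

Definition succ (d : dir) := match d with DA => DB | DB => DC | DC => DA end.

Definition third (i j : dir) : dir :=
  match i, j with
  | DA, DB | DB, DA => DC
  | DB, DC | DC, DB => DA
  | _, _ => DB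
  end.

Definition mode_child (m : mode) (d : dir) : mode :=
  match m with
  | Aff => Aff
  | Bad i => if d == i then Aff else Bad i
  | Path [::] => if d == DA then Bad DA else Aff
  | Path (e :: u) => if d == e then Path u else Aff
  | D0 => if d == DA then D1 else Aff
  | D1 => if d == DB then Bad DC else Aff
  end.

(** Marks sides on which the final function is 1-Lipschitz. It may include sides of the triangle
    left out, such as those through the top in shape [D0]. *)
Definition clean (m : mode) (j k : dir) : bool :=
  match m with
  | Aff | Path _ => true
  | Bad i => (j == i) || (k == i)
  | D0 | D1 => (j == DC) || (k == DC)
  end.

Section Extremal.
Context {R : realType}.
Implicit Types (p q y z : R * R) (i j k l d : dir) (w v u : seq dir) (m : mode) (x : dir -> R).

(* Value at the midpoint of the side opposite to vertex d, for vertex values x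
   and side s. With the weights 1/3, 2/3 a cell of shape Bad i has an
   interpolable child at vertex i, and the other two children are again of
   shape Bad i. *)
Definition mid m x (s : R) d : R :=
  match m with
  | Aff => (x (succ d) + x (succ (succ d))) / 2
  | Bad i => let a := x (succ i) in let c := x (succ (succ i)) in
      if d == i then (a + c) / 2 else if d == succ i then (a + 2 * c) / 3 else (2 * a + c) / 3
  | Path [::] => match d with DA => 0 | DB => 3 / 8 * s | DC => - (3 / 8 * s) end
  | Path (_ :: _) => 0
  | D0 => if d == DC then 3 / 16 * s else 0
  | D1 => if d == DC then - (3 / 8 * s) else 0
  end.

Record state := State { smode : mode; svals : dir -> R; sside : R }.

Definition step (S : state) d : state :=
  State (mode_child (smode S) d)
    (fun j => if j == d then svals S d else mid (smode S) (svals S) (sside S) (third d j))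
    (sside S / 2).

(** In shape [Bad i] the midpoints of the two sides at [i] receive [a + s / 2] and [a + s]. Keeping
    [x i] between them makes the child at [i] 1-Lipschitz. *)
Definition sane (S : state) : Prop :=
  let s := sside S in let x := svals S in 0 < s /\
  match smode S with
  | Aff => forall j k, `|x j - x k| <= s
  | Bad i => let a := x (succ i) in let c := x (succ (succ i)) in
      [/\ c - a = 3 / 2 * s, s / 2 <= x i - a & x i - a <= s]
  | Path _ | D0 => forall j, x j = 0
  | D1 => [/\ x DA = 0, x DB = 3 / 8 * s & x DC = 0]
  end.

Lemma norm_sub_le (a c s : R) : a - c <= s -> c - a <= s -> `|a - c| <= s.
Proof. by move=> h1 h2; rewrite ler_norml; apply/andP; split; lra. Qed.

Lemma norm_subP (a c s : R) : `|a - c| <= s -> a - c <= s /\ c - a <= s.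
Proof. by rewrite ler_norml => /andP[h1 h2]; split; lra. Qed.

Lemma osc3 x (s : R) : 0 <= s -> `|x DA - x DB| <= s -> `|x DA - x DC| <= s ->
  `|x DB - x DC| <= s -> forall j k, `|x j - x k| <= s.
Proof.
by move=> s0 h1 h2 h3; case; case; rewrite ?subrr ?normr0// distrC.
Qed.

(** This fixes the constants of [mid]: the values [3/8 s] and [- 3/8 s] differ by [3/4 s], which is
    3/2 of the side of a child; and [3/16] of the outer side is [3/8] of the side of the first
    child. *)
Lemma sane_step S d : sane S -> sane (step S d).
Proof.
case: S => m x s [/= s0]; have s2 : 0 < s / 2 by rewrite divr_gt0.
rewrite /step /sane /=.
case: m => [|i|[|e u]||] /= h; split => //.
- have [a1 a2] := norm_subP (h DA DB); have [b1 b2] := norm_subP (h DA DC).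
  have [c1 c2] := norm_subP (h DB DC).
  by apply: osc3; first exact: ltW; case: d; apply: norm_sub_le => /=; lra.
- have [h1 h2 h3] := h; case: i h h1 h2 h3 => _ /= h1 h2 h3;
  by case: d => /=; first [split; lra
    |apply: osc3 => /=; [lra|apply: norm_sub_le; lra..]].
- by case: d => /=; rewrite ?h; [split; lra
    |apply: osc3 => /=; rewrite ?h; [lra|apply: norm_sub_le; lra..]..].
- have z : forall j, (if j == d then x d else 0) = 0 :> R by move=> j; rewrite h if_same.
  by case: (d == e) => //= j k; rewrite !z subrr normr0 ltW.
- by case: d => /=; [split; rewrite ?h; lra
    |apply: osc3 => /=; rewrite ?h; [lra|apply: norm_sub_le; lra..]..].
- have [h1 h2 h3] := h; case: d => /=;
  by first [split; lra|apply: osc3 => /=; rewrite ?h1 ?h2 ?h3; [lra|apply: norm_sub_le; lra..]].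
Qed.

Lemma sane_osc S j k : sane S -> `|svals S j - svals S k| <= 3 / 2 * sside S.
Proof.
case: S => m x s [/= s0]; case: m => [|i|u||] /= h.
- by have [? ?] := norm_subP (h j k); apply: norm_sub_le; lra.
- have [h1 h2 h3] := h; case: i h h1 h2 h3 => _ /= h1 h2 h3;
  by case: j; case: k; apply: norm_sub_le; lra.
- by rewrite !h subrr normr0 mulr_ge0// ltW.
- by rewrite !h subrr normr0 mulr_ge0// ltW.
- by have [h1 h2 h3] := h; case: j; case: k; rewrite ?h1 ?h2 ?h3; apply: norm_sub_le; lra.
Qed.

Lemma sane_clean S j k : sane S -> clean (smode S) j k -> `|svals S j - svals S k| <= sside S.
Proof.
case: S => m x s [/= s0]; case: m => [|i|u||] /= h.
- by move=> _; exact: h.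
- have [h1 h2 h3] := h; case: i h h1 h2 h3 => _ /= h1 h2 h3;
  by case: j; case: k => //= _; apply: norm_sub_le; lra.
- by rewrite !h subrr normr0 ltW.
- by rewrite !h subrr normr0 ltW.
- by have [h1 h2 h3] := h; case: j; case: k; rewrite ?h1 ?h2 ?h3 => //= _; apply: norm_sub_le; lra.
Qed.

Lemma clean_left m j k : j != k -> clean m j k -> clean (mode_child m j) j k.
Proof. by case: m => [|i|[|e u]||] //=; case: j; case: k => //; try case: i; try case: e. Qed.

Lemma clean_sym m j k : clean m j k = clean m k j.
Proof. by case: m => //= *; rewrite orbC. Qed.

(** [Path [::]] is the shape of the cell whose middle triangle is left out; only there may the inner
    side of a child be stretched. *)
Lemma clean_middle m i j k : m <> Path [::] -> i != j -> i != k -> j != k ->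
  clean (mode_child m i) j k.
Proof.
case: m => [|i0|[|e u]||] //= _; case: i; case: j => //; case: k => //; do ?[by case: i0 | by case: e].
Qed.

Variable miss : option (seq dir).

Definition init : state := State (if miss is Some w then Path w else D0) (fun=> 0) side0.

Definition state_at w : state := foldl step init w.

Local Notation vals w := (svals (state_at w)).

Lemma state_rcons w d : state_at (rcons w d) = step (state_at w) d.
Proof. exact: foldl_rcons. Qed.

Lemma state_side w : sside (state_at w) = side w.
Proof.
elim/last_ind: w => [|w d ih]; first by rewrite /side expr0 divr1.
by rewrite state_rcons /= ih side_rcons.
Qed.

Lemma state_sane w : sane (state_at w).
Proof.
elim/last_ind: w => [|w d ih]; last by rewrite state_rcons; exact: sane_step.
by split; [exact: side0_gt0|rewrite /= /init; case: miss].
Qed.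

Lemma vals_corner w d : vals (rcons w d) d = vals w d.
Proof. by rewrite state_rcons /= eqxx. Qed.

Lemma vals_mid w i j : vals (rcons w i) j = vals (rcons w j) i.
Proof.
rewrite !state_rcons /= [i == j]eq_sym; case: eqVneq => [->//|ij].
by congr mid; case: i j ij => -[].
Qed.

Lemma vals_osc w j k : `|vals w j - vals w k| <= 3 / 2 * side w.
Proof. by rewrite -state_side; apply: sane_osc; exact: state_sane. Qed.

Lemma state_path w u : miss = Some (w ++ u) <-> smode (state_at w) = Path u.
Proof.
elim/last_ind: w u => [|w d ih] u.
  by rewrite /= /init; case: miss => [v|]; split => // -[->].
rewrite cat_rcons ih state_rcons /=; split=> [-> /=|]; first by rewrite eqxx.
case: (smode (state_at w)) => [|i|[|e v]||] //=.
- by case: ifP.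
- by case: ifP.
- by case: eqVneq => // <- [->].
- by case: ifP.
- by case: ifP.
Qed.

(** The geometric series [3/2 * (1 + 1/2 + 1/4 + ...) = 3]. *)
Lemma vals_osc_cat w u j k : `|vals (w ++ u) j - vals w k| <= 3 * side w.
Proof.
elim: u w k => [|d u ih] w k.
  have s0 := @side_gt0 R w; rewrite cats0; have := vals_osc w j k; lra.
have := ih (rcons w d) d; rewrite cat_rcons vals_corner side_rcons => h1.
have h2 := vals_osc w d k; apply: le_trans (ler_distD (vals w d) _ _) _; lra.
Qed.

(* The distance to the corner k enters through the barycentric coordinate. *)
Lemma vals_near w u j k :
  `|vals (w ++ u) j - vals w k| <= 6 * side w * (1 - lam w (vtx (cell (w ++ u)) j) k).
Proof.
elim: u w => [|d u ih] w.
  have s0 := @side_gt0 R w; rewrite cats0 -(epoint0 w j j) lam_epoint subr0 mul1r mul0r addr0.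
  have [->|jk] := eqVneq j k; first by rewrite !subrr normr0 mulr0.
  rewrite subr0 mulr1; have := vals_osc w j k; lra.
have s0 := @side_gt0 R w.
have [e|dk] := eqVneq d k.
  subst d; have := ih (rcons w k); rewrite cat_rcons vals_corner side_rcons lam_rcons eqxx /=.
  move=> h; apply: le_trans h _; rewrite le_eqVlt; apply/orP; left; apply/eqP.
  by field.
apply: le_trans (vals_osc_cat w (d :: u) j k) _.
have [|h1 h2] := @solid_rcons R w d (vtx (cell (w ++ d :: u)) j).
  rewrite -cat_rcons; apply: (@solid_cat _ _ u).
  by rewrite -(epoint0 _ j j); apply: solid_epoint; rewrite lexx ler01.
have h3 := lam_le2 dk h1.
have -> : 3 * side w = 6 * side w * (1 / 2) :> R by field.
by apply: ler_wpM2l; [rewrite mulr_ge0// ltW|lra].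
Qed.

Lemma solid_vtx_cat w u j : solid (cell w) (vtx (cell (w ++ u)) j : R * R).
Proof.
apply: (@solid_cat _ _ u); rewrite -(epoint0 _ j j).
by apply: solid_epoint; rewrite lexx ler01.
Qed.

Lemma common_prefix w v : exists c, [\/ exists u, w = c /\ v = c ++ u,
  exists u, v = c /\ w = c ++ u |
  exists i j u1 u2, [/\ i != j, w = rcons c i ++ u1 & v = rcons c j ++ u2]].
Proof.
elim: w v => [|i w ih] [|j v].
- by exists [::]; constructor 1; exists [::].
- by exists [::]; constructor 1; exists (j :: v).
- by exists [::]; constructor 2; exists (i :: w).
have [<-|ij] := eqVneq i j; last first.
  by exists [::]; constructor 3; exists i, j, w, v.
have [c [[u [-> ->]]|[u [-> ->]]|[i1 [j1 [u1 [u2 [h -> ->]]]]]]] := ih v.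
- by exists (i :: c); constructor 1; exists u.
- by exists (i :: c); constructor 2; exists u.
- by exists (i :: c); constructor 3; exists i1, j1, u1, u2.
Qed.

Definition Kval : R := 12 * side0 * kappa.

Lemma Kval_gt0 : 0 < Kval.
Proof. by rewrite mulr_gt0 ?kappa_gt0// mulr_gt0// side0_gt0. Qed.

Lemma side_lam c p q k (n : R) : 0 <= n -> n <= 12 ->
  n * side c * (lam c p k - lam c q k) <= Kval * eucl_dist p q.
Proof.
move=> n0 n12; have s0 := @side_gt0 R c; have S0 := @side0_gt0 R.
have h := le_trans (ler_norm _) (lam_lipschitz c p q k).
have k0 := @kappa_gt0 R; have e0 := eucl_ge0 p q.
apply: le_trans (ler_wpM2l _ h) _; first by rewrite mulr_ge0// ltW.
have -> : n * side c * (2 ^+ size c * kappa * eucl_dist p q) = n * (side0 * kappa * eucl_dist p q).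
  have n1 : 2 ^+ size c != 0 :> R by rewrite expf_neq0.
  by rewrite /side; move: (2 ^+ size c) n1 => N n1; field.
have -> : Kval * eucl_dist p q = 12 * (side0 * kappa * eucl_dist p q) by rewrite /Kval; ring.
apply: ler_wpM2r => //; apply: mulr_ge0 => //.
by apply: mulr_ge0; exact: ltW.
Qed.

(** Go through the vertex shared by the two children in which the words part. By [vals_near] each
    leg costs at most 6 sides times a difference of coordinates, which is half of [Kval] times the
    distance. In particular the value at a vertex does not depend on the cell used to name it. *)
Lemma vals_lipschitz w v j k :
  `|vals w j - vals v k| <= Kval * eucl_dist (vtx (cell w) j) (vtx (cell v) k).
Proof.
have prefix c u j1 k1 : `|vals c j1 - vals (c ++ u) k1| <=
    Kval * eucl_dist (vtx (cell c) j1) (vtx (cell (c ++ u)) k1).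
  rewrite distrC; apply: le_trans (vals_near c u k1 j1) _.
  have e : lam c (vtx (cell c) j1) j1 = 1 :> R.
    by rewrite -(epoint0 c j1 j1) lam_epoint eqxx mul0r addr0 subr0 mulr1.
  have n6 : 0 <= 6 :> R by [].
  have n12 : 6 <= 12 :> R by lra.
  by have := side_lam c (vtx (cell c) j1) (vtx (cell (c ++ u)) k1) j1 n6 n12; rewrite e.
have [c [[u [-> ->]]|[u [-> ->]]|[i1 [j1 [u1 [u2 [h -> ->]]]]]]] := common_prefix w v.
- exact: prefix.
- by rewrite distrC eucl_sym; exact: prefix.
have s0 := @side_gt0 R c.
set p := vtx _ j; set q := vtx _ k.
have [_ p1] := solid_rcons (solid_vtx_cat (rcons c i1) u1 j).
have [_ q1] := solid_rcons (solid_vtx_cat (rcons c j1) u2 k).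
have n1 := vals_near (rcons c i1) u1 j j1; have n2 := vals_near (rcons c j1) u2 k i1.
rewrite -(vals_mid c i1 j1) in n2; rewrite -/p in p1 n1; rewrite -/q in q1 n2.
move: n1 n2; rewrite !lam_rcons !side_rcons (negbTE h) [j1 == i1]eq_sym (negbTE h) /= => n1 n2.
have a1 : 12 * side c * (lam c p i1 - lam c q i1) <= Kval * eucl_dist p q by exact: side_lam.
have a2 : 12 * side c * (lam c q j1 - lam c p j1) <= Kval * eucl_dist p q.
  by rewrite eucl_sym; exact: side_lam.
apply: le_trans (ler_distD (vals (rcons c i1) j1) _ _) _; rewrite [X in _ + X]distrC.
have b1 : 6 * (side c / 2) * (1 - (2 * lam c p j1 - 0)) <= 6 * side c * (lam c q j1 - lam c p j1).
  have -> : 6 * (side c / 2) * (1 - (2 * lam c p j1 - 0)) = 6 * side c * (1 / 2 - lam c p j1) by field.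
  by apply: ler_wpM2l; [rewrite mulr_ge0// ltW|lra].
have b2 : 6 * (side c / 2) * (1 - (2 * lam c q i1 - 0)) <= 6 * side c * (lam c p i1 - lam c q i1).
  have -> : 6 * (side c / 2) * (1 - (2 * lam c q i1 - 0)) = 6 * side c * (1 / 2 - lam c q i1) by field.
  by apply: ler_wpM2l; [rewrite mulr_ge0// ltW|lra].
by lra.
Qed.

End Extremal.

(** * Extension of the vertex values to the plane *)

Section Extension.
Context {R : realType}.
Implicit Types (p q y z : R * R) (i j k l d : dir) (w v u : seq dir).
Variable miss : option (seq dir).
Local Notation vals w := (svals (@state_at R miss w)).
Local Notation K := (@Kval R).

(** McShane's extension of the vertex values, with their Lipschitz constant. *)
Definition ext z : R :=
  inf [set r : R | exists w j, r = vals w j + K * eucl_dist (vtx (cell w) j) z].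

Let K0 : 0 <= K := ltW (@Kval_gt0 R).

Lemma ext_lbound z w j :
  lbound [set r : R | exists w j, r = vals w j + K * eucl_dist (vtx (cell w) j) z]
    (vals w j - K * eucl_dist (vtx (cell w) j) z).
Proof.
move=> _ [v [k ->]]; have [h _] := norm_subP (@vals_lipschitz R miss w v j k).
have := ler_wpM2l K0 (eucl_triangle z (vtx (cell w) j) (vtx (cell v) k)).
rewrite (eucl_sym z) mulrDr; lra.
Qed.

Lemma ext_le z w j : ext z <= vals w j + K * eucl_dist (vtx (cell w) j) z.
Proof.
apply: (ge_inf (ex_intro _ _ (@ext_lbound z [::] DA))).
by exists w, j.
Qed.

Lemma le_ext (r : R) z : (forall w j, r <= vals w j + K * eucl_dist (vtx (cell w) j) z) -> r <= ext z.
Proof.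
move=> h; apply: lb_le_inf; last by move=> _ [w [j ->]].
by eexists; exists [::], DA.
Qed.

Lemma ext_vtx w j : ext (vtx (cell w) j) = vals w j.
Proof.
apply/eqP; rewrite eq_le; apply/andP; split.
  by have := ext_le (vtx (cell w) j) w j; rewrite eucl_refl mulr0 addr0.
apply: le_ext => v k; have := @ext_lbound (vtx (cell w) j) w j.
by rewrite eucl_refl mulr0 subr0 => /(_ _ (ex_intro _ v (ex_intro _ k erefl))).
Qed.

Lemma ext_lip y z : `|ext y - ext z| <= K * eucl_dist y z.
Proof.
have H p q : ext p - ext q <= K * eucl_dist p q.
  rewrite lerBlDr addrC -lerBlDr; apply: le_ext => w j; have h := ext_le p w j.
  have := ler_wpM2l K0 (eucl_triangle q (vtx (cell w) j) p).
  by rewrite (eucl_sym q) mulrDr; lra.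
apply: norm_sub_le => //; rewrite eucl_sym; exact: H.
Qed.

Lemma epoint_halves w j k (t : R) : 0 <= t <= 1 ->
  (exists u : R, [/\ 0 <= u <= 1, t = u / 2 & epoint w j k t = epoint (rcons w j) j k u]) \/
  (exists u : R, [/\ 0 <= u <= 1, t = (1 + u) / 2 & epoint w j k t = epoint (rcons w k) j k u]).
Proof.
move=> /andP[t0 t1]; have [h|/ltW h] := leP t (1 / 2); [left|right].
  exists (2 * t); split; [by apply/andP; split; lra|by field|].
  by rewrite epoint_left mulrC mulKf// mulrC mulfK.
exists (2 * t - 1); split; [by apply/andP; split; lra|by field|].
by rewrite epoint_right; congr epoint; field.
Qed.

Local Notation clean_edge w j k := (clean (smode (@state_at R miss w)) j k).

Lemma clean_rcons_left w j k : j != k -> clean_edge w j k -> clean_edge (rcons w j) j k.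
Proof. by rewrite state_rcons; exact: clean_left. Qed.

Lemma clean_rcons_right w j k : j != k -> clean_edge w j k -> clean_edge (rcons w k) j k.
Proof.
by rewrite state_rcons => jk; rewrite ![clean _ j k]clean_sym; apply: clean_left; rewrite eq_sym.
Qed.

Lemma clean_vals w j k : clean_edge w j k -> `|vals w j - vals w k| <= side w.
Proof. by move=> c; rewrite -(state_side miss); apply: sane_clean => //; exact: state_sane. Qed.

Lemma epoint_eucl w j k (t : R) : j != k -> 0 <= t <= 1 ->
  eucl_dist (epoint w j k t) (vtx (cell w) j) <= side w.
Proof.
move=> jk /andP[t0 t1]; rewrite -(epoint0 w j k) epoint_dist// subr0 ger0_norm//.
by rewrite ler_piMl// ltW// side_gt0.
Qed.

(** [ext] is a priori only [Kval]-Lipschitz. The constant 1 on a clean side comes from bisection: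
    both halves are clean sides of children, and every halving divides the crude error term by 2. *)
Lemma ext_end n w j k (t : R) : j != k -> clean_edge w j k -> 0 <= t <= 1 ->
  `|ext (epoint w j k t) - vals w j| <= t * side w + K * side w / 2 ^+ n.
Proof.
move=> jk; elim: n w t => [|n ih] w t c t01; have s0 := @side_gt0 R w.
  rewrite expr0 divr1 -(ext_vtx w j); apply: le_trans (ext_lip _ _) _.
  apply: (@le_trans _ _ (K * side w)); first by apply: ler_wpM2l => //; exact: epoint_eucl.
  by rewrite lerDr mulr_ge0// ?(ltW s0)//; case/andP: t01.
have E : K * side w / 2 ^+ n.+1 = K * (side w / 2) / 2 ^+ n by rewrite exprS invfM !mulrA.
have [[u [u01 tE ->]]|[u [u01 tE ->]]] := epoint_halves w j k t01.
  have := ih (rcons w j) u (clean_rcons_left jk c) u01; rewrite vals_corner side_rcons E tE.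
  by have -> : u * (side w / 2) = u / 2 * side w by field.
have := ih (rcons w k) u (clean_rcons_right jk c) u01; rewrite -(vals_mid miss w j k) side_rcons -E.
have := clean_vals (clean_rcons_left jk c); rewrite vals_corner side_rcons => h1 h2.
apply: le_trans (ler_distD (vals (rcons w j) k) _ _) _; rewrite [X in _ + X]distrC.
by rewrite tE; lra.
Qed.

Lemma ext_edge n w j k (t u : R) : j != k -> clean_edge w j k -> 0 <= t <= 1 -> 0 <= u <= 1 ->
  t <= u -> `|ext (epoint w j k t) - ext (epoint w j k u)| <=
    (u - t) * side w + 2 * K * side w / 2 ^+ n.
Proof.
move=> jk; elim: n w t u => [|n ih] w t u c t01 u01 tu; have s0 := @side_gt0 R w.
  have h1 := ext_end 0 jk c t01.
  have h2 := ext_lip (epoint w j k t) (epoint w j k u); apply: le_trans h2 _.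
  rewrite epoint_dist// distrC (ger0_norm (x := u - t)) ?subr_ge0// expr0 divr1.
  have : (u - t) * side w <= side w.
    by rewrite ler_piMl ?(ltW s0)//; move/andP: t01 => [? ?]; move/andP: u01 => [? ?]; lra.
  move=> /(ler_wpM2l K0) h3; apply: le_trans h3 _.
  have h4 : 0 <= (u - t) * side w by rewrite mulr_ge0 ?subr_ge0// ltW.
  have h5 : 0 <= K * side w by rewrite mulr_ge0// ltW.
  lra.
have E : 2 * K * side w / 2 ^+ n.+1 = 2 * K * (side w / 2) / 2 ^+ n by rewrite exprS invfM !mulrA.
have E1 : 2 * K * side w / 2 ^+ n.+1 = K * (side w / 2) / 2 ^+ n + K * (side w / 2) / 2 ^+ n.
  by rewrite exprS invfM; move: ((2 ^+ n)^-1) => A; field.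
have [[t' [t01' tE ->]]|[t' [t01' tE ->]]] := epoint_halves w j k t01;
  have [[u' [u01' uE ->]]|[u' [u01' uE ->]]] := epoint_halves w j k u01.
- have tu' : t' <= u' by move: tu; rewrite tE uE ler_pM2r ?invr_gt0.
  have := ih _ _ _ (clean_rcons_left jk c) t01' u01' tu'; rewrite side_rcons E tE uE.
  by have -> : (u' - t') * (side w / 2) = (u' / 2 - t' / 2) * side w by field.
- have h2 := ext_end n jk (clean_rcons_right jk c) u01'.
  have kj : k != j by rewrite eq_sym.
  have ck : clean_edge (rcons w j) k j by rewrite clean_sym; exact: clean_rcons_left.
  have t02 : 0 <= 1 - t' <= 1 by move/andP: t01' => [? ?]; apply/andP; split; lra.
  have := ext_end n kj ck t02; rewrite -epoint_sym => h1.
  rewrite -(vals_mid miss w j k) side_rcons in h2; rewrite side_rcons in h1.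
  apply: le_trans (ler_distD (vals (rcons w j) k) _ _) _; rewrite [X in _ + X]distrC.
  apply: le_trans (lerD h1 h2) _; rewrite E1 tE uE.
  by rewrite le_eqVlt; apply/orP; left; apply/eqP; field.
(* A point of the right half that does not lie beyond one of the left half: both are the
   midpoint. *)
- move: tu; rewrite tE uE => tu; move/andP: t01' => [t1 t2]; move/andP: u01' => [u1 u2].
  have t0 : t' = 0 by lra.
  have u0 : u' = 1 by lra.
  have -> : epoint (rcons w k) j k t' = epoint (rcons w j) j k u'.
    by rewrite epoint_left epoint_right t0 u0; congr epoint; field.
  rewrite subrr normr0 t0 u0; apply: addr_ge0.
    by rewrite addr0 subrr mul0r.
  by rewrite divr_ge0 ?exprn_ge0// mulr_ge0 ?(ltW s0)// mulr_ge0.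
- have tu' : t' <= u' by move: tu; rewrite tE uE ler_pM2r ?invr_gt0// lerD2l.
  have := ih _ _ _ (clean_rcons_right jk c) t01' u01' tu'; rewrite side_rcons E tE uE.
  by have -> : (u' - t') * (side w / 2) = ((1 + u') / 2 - (1 + t') / 2) * side w by field.
Qed.

Lemma ext_clean w j k : j != k -> clean_edge w j k -> edge_lip ext w j k.
Proof.
move=> jk c; apply/edge_lipP => t u t0 tu u1; apply/ler_addgt0Pr => e e0.
have s0 := @side_gt0 R w.
have K1 : 0 < 2 * K * side w by rewrite mulr_gt0// mulr_gt0// Kval_gt0.
have [n hn] := exp2V_small (divr_gt0 e0 K1).
apply: le_trans (ext_edge n jk c _ _ tu) _.
- by rewrite t0 (le_trans tu).
- by rewrite u1 (le_trans t0).
- by rewrite lerD2l mulrC; move: hn; rewrite ler_pdivlMr.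
Qed.

Lemma ext_admissible : admissible miss ext.
Proof.
split=> [hm j k jk|w hw].
  apply: (@ext_clean [::]) => //; case: miss hm => //.
have M i j k : i != j -> i != k -> j != k -> edge_lip ext (rcons w i) j k.
  move=> ij ik jk; apply: ext_clean => //; rewrite state_rcons; apply: clean_middle => //.
  by move=> /state_path; rewrite cats0.
have h1 : elip ext (side w / 2) (middle (cell w)) DA DB.
  have := M DB DA DC isT isT isT; rewrite /edge_lip /elip side_rcons; apply: eq_lip1 => t _ _.
  by have [-> _ _] := edge_middle w t.
have h2 : elip ext (side w / 2) (middle (cell w)) DB DC.
  have := M DC DB DA isT isT isT; rewrite /edge_lip /elip side_rcons; apply: eq_lip1 => t _ _.
  by have [_ -> _] := edge_middle w t.
have h3 : elip ext (side w / 2) (middle (cell w)) DC DA.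
  have := M DA DC DB isT isT isT; rewrite /edge_lip /elip side_rcons; apply: eq_lip1 => t _ _.
  by have [_ _ ->] := edge_middle w t.
exact: elip_edges h1 h2 h3.
Qed.

Lemma ext_bounded : exists B : R, forall p, SG p -> `|ext p| <= B.
Proof.
exists (`|ext (vtx Delta01 DA)| + K * side [::]) => p Sp.
have -> : ext p = ext (vtx Delta01 DA) - (ext (vtx Delta01 DA) - ext p) by ring.
apply: le_trans (ler_normB _ _) _; rewrite lerD2l.
apply: le_trans (ext_lip _ _) _; apply: ler_wpM2l => //.
by apply: (@vtx_near _ [::]); exact: SG_solid.
Qed.

(** With the outer triangle left out, the stretched side is the second quarter of the base, counted
    from [va]; otherwise it is the side of the hole that faces the corner [DA]. *)
Lemma bad_exists : exists w i, smode (@state_at R miss w) = Bad i.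
Proof.
case E: miss => [w|]; last by exists [:: DA; DB], DC; rewrite /state_at /= /init.
exists (rcons w DA), DA; rewrite state_rcons /=.
suff -> : smode (@state_at R (Some w) w) = Path [::] by [].
by apply/state_path; rewrite cats0.
Qed.

Lemma ext_gap : exists w j k, [/\ j != k &
  3 / 2 * side w <= ext (vtx (cell w) k) - ext (vtx (cell w) j)].
Proof.
have [w [i wi]] := bad_exists; exists w, (succ i), (succ (succ i)); split; first by case: (i).
have [_] := @state_sane R miss w; rewrite wi !ext_vtx => -[h _ _].
by rewrite h state_side.
Qed.

End Extension.

(** * The metric of RGT *)

Section Bounds.
Context {R : realType}.
Implicit Types (x y p q : R * R) (b : R * R -> R).
Local Notation Re := complex.Re.
Local Notation Im := complex.Im.
Variable s : @summand_index -> R.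
Hypothesis hs : forall i, 0 <= s i < circumference (summand_triangle i).
Variable miss : option (seq dir).
Local Notation d_RGT := (induced_dist (@SG R) (RGT s (index_of miss))).

Lemma continuous_eps_delta (h : R[i] -> R) (a : R * R -> R[i]^o) :
  (forall z z', (`|h z - h z'|)%:C%C <= `|z - z'|) -> {within SG, continuous a} ->
  forall y (e : R), SG y -> 0 < e -> exists d : R, 0 < d /\
    forall q, SG q -> eucl_dist q y <= d -> `|h (a q) - h (a y)| <= e.
Proof.
move=> hh /subspace_continuousP ca y e Sy e0.
have := ca _ Sy => /cvgrPdist_le /(_ (e%:C%C)) hca.
have e1 : 0 < e%:C%C :> R[i] by rewrite ltcR.
have {}hca : \forall q \near y, SG q -> `|a y - a q| <= e%:C%C by exact: (hca e1).
move/nbhs_ballP: hca => [d /= d0 hd]; exists (d / 2); split; first by rewrite divr_gt0.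
move=> q Sq qy; rewrite -lecR; apply: le_trans (hh _ _) _; rewrite distrC; apply: hd => //.
have dd : d / 2 < d by lra.
split; rewrite /ball /= distrC.
- by apply: le_lt_trans (eucl_coord1 q y) _; exact: le_lt_trans qy dd.
- by apply: le_lt_trans (eucl_coord2 q y) _; exact: le_lt_trans qy dd.
Qed.

Lemma Re_normB (z : R[i]) : Re `|z| <= `|Re z| + `|Im z|.
Proof.
have := eucl_le_coord (Re z, Im z) (0, 0).
by rewrite normc_def /eucl_dist /= !subr0.
Qed.

Lemma induced_dist_le x y : SG x -> SG y -> (d_RGT x y <= (8 * Kcell * eucl_dist x y)%:E)%E.
Proof.
move=> Sx Sy; apply: ge_ereal_sup => _ [a [ca ha] <-]; rewrite lee_fin.
have [aR aI] := commutator_admissible hs ca ha.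
have hRe (z z' : R[i]) : (`|Re z - Re z'|)%:C%C <= `|z - z'|.
  by rewrite -raddfB; exact: normc_ge_Re.
have hIm (z z' : R[i]) : (`|Im z - Im z'|)%:C%C <= `|z - z'|.
  by rewrite -raddfB; exact: normc_ge_Im.
have h1 := admissible_lip aR (continuous_eps_delta hRe ca) Sx Sy.
have h2 := admissible_lip aI (continuous_eps_delta hIm ca) Sx Sy.
apply: le_trans (Re_normB _) _; rewrite !raddfB /=.
by apply: le_trans (lerD h1 h2) _; lra.
Qed.

Lemma le_induced_dist b (K B : R) x y : (forall p q, `|b p - b q| <= K * eucl_dist p q) ->
  (forall p, SG p -> `|b p| <= B) -> admissible miss b ->
  ((`|b x - b y|)%:E <= d_RGT x y)%E.
Proof.
move=> bK bB ab; apply: ereal_sup_ubound; exists (fun p => (b p)%:C%C); last first.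
  by rewrite -rmorphB normc_def /= expr0n /= addr0 sqrtr_sqr.
split; last exact: admissible_commutator bB ab.
apply/subspace_continuousP => p Sp; apply/cvgrPdist_le => e e0.
(* A positive element of [R[i]] is real, so the complex epsilon reduces to a real one. *)
have [e1 eE] : 0 < Re e /\ e = (Re e)%:C%C.
  by move: e e0 => [er ei]; rewrite ltcE /= => /andP[/eqP -> ?].
have K1 : 0 < 2 * (`|K| + 1) by rewrite mulr_gt0// ltr_wpDl.
have d0 : 0 < Re e / (2 * (`|K| + 1)) by rewrite divr_gt0.
rewrite near_withinE; near=> q => Sq.
rewrite -rmorphB normc_def /= expr0n /= addr0 sqrtr_sqr eE lecR.
have pq : `|p - q| <= Re e / (2 * (`|K| + 1)) by near: q; apply: cvgr_dist_le.
have : eucl_dist p q <= 2 * `|p - q|.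
  apply: le_trans (eucl_le_coord p q) _; rewrite mulr_natl mulr2n prod_normE /=.
  by apply: lerD; rewrite le_max lexx ?orbT.
move=> /le_trans /(_ (ler_wpM2l _ pq)) => /(_ _) h.
apply: le_trans (bK p q) _.
have k0 : 0 <= `|K| + 1 by rewrite addr_ge0.
apply: le_trans (_ : _ <= (`|K| + 1) * eucl_dist p q) _.
  by apply: ler_wpM2r; [exact: eucl_ge0|apply: le_trans (ler_norm _) _; rewrite lerDl].
apply: le_trans (ler_wpM2l k0 (h _)) _; first by [].
rewrite le_eqVlt; apply/orP; left; apply/eqP; field.
by rewrite gt_eqF// ltr_wpDl.
Unshelve. all: by end_near.
Qed.

(** The two coordinates are admissible whichever triangle is left out, and the larger of the two
    coordinate differences is at least half the distance. *)
Lemma eucl_induced_dist x y : SG x -> SG y -> ((eucl_dist x y / 2)%:E <= d_RGT x y)%E.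
Proof.
move=> Sx Sy.
have H (c : R * R -> R) : (forall p q, `|c p - c q| <= eucl_dist p q) ->
    ((`|c x - c y|)%:E <= d_RGT x y)%E.
  move=> hc; apply: (@le_induced_dist c 1 (`|c (vtx Delta01 DA)| + side [::])).
  - by move=> p q; rewrite mul1r.
  - move=> p Sp; have -> : c p = c (vtx Delta01 DA) - (c (vtx Delta01 DA) - c p) by ring.
    apply: le_trans (ler_normB _ _) _; rewrite lerD2l; apply: le_trans (hc _ _) _.
    by apply: (@vtx_near _ [::]); exact: SG_solid.
  - split=> [_|w _] j k jk; apply: coord_elip => //.
    + exact: side_gt0.
    + exact: equilateral_cell.
    + by apply: divr_gt0 => //; exact: side_gt0.
    + exact: equilateral_middle.
have h1 := H fst (@eucl_coord1 R); have h2 := H snd (@eucl_coord2 R).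
have e := eucl_le_coord x y.
have [g|/ltW g] := leP `|x.1 - y.1| `|x.2 - y.2|.
  by apply: le_trans h2; rewrite lee_fin; lra.
by apply: le_trans h1; rewrite lee_fin; lra.
Qed.

End Bounds.

Theorem proposition4p1 (R : realType) (s : summand_index -> R)
    (hs : forall i, 0 <= s i < circumference (summand_triangle i))
    (i0 : summand_index) :
  [/\ equivalent_on (@SG R) (geodesic_dist (@SG R))
        (induced_dist (@SG R) (RGT s i0)),
      ~ (forall x y : R * R, SG x -> SG y ->
           induced_dist (@SG R) (RGT s i0) x y = geodesic_dist (@SG R) x y) &
      exists x y : R * R, [/\ SG x, SG y, x <> y &
        ((3 / 2)%:E * geodesic_dist (@SG R) x y <=
           induced_dist (@SG R) (RGT s i0) x y)%E]].
Proof.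
have [miss ->] := index_of_surj i0; have K0 := @Kcell_gt0 R.
have [w [j [k [jk gap]]]] := @ext_gap R miss; have s0 := @side_gt0 R w.
set x := vtx (cell w) k in gap; set y := vtx (cell w) j in gap.
have Sx : SG x by exact: SG_vtx.
have Sy : SG y by exact: SG_vtx.
have dg : (geodesic_dist SG x y <= (side w)%:E)%E by exact: geodesic_side.
have [B hB] := @ext_bounded R miss.
have dR : ((3 / 2 * side w)%:E <= induced_dist SG (RGT s (index_of miss)) x y)%E.
  apply: le_trans (le_induced_dist hs x y (@ext_lip R miss) hB (@ext_admissible R miss)).
  by rewrite lee_fin; apply: le_trans gap (ler_norm _).
split.
(* The lower constant combines [geodesic_eucl], with factor [2 * Kcell], and [eucl_induced_dist],
   with factor 2. *)
- exists (4 * Kcell)^-1, (8 * Kcell); split; [by rewrite invr_gt0 mulr_gt0|by rewrite mulr_gt0|].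
  move=> p q Sp Sq; split.
    apply: le_trans (eucl_induced_dist hs miss Sp Sq).
    have c0 : (0 <= ((4 * Kcell)^-1 : R)%:E)%E by rewrite lee_fin invr_ge0 mulr_ge0// ltW.
    apply: le_trans (lee_wpmul2l c0 (geodesic_eucl Sp Sq)) _.
    rewrite -EFinM lee_fin le_eqVlt; apply/orP; left; apply/eqP; field.
    by rewrite gt_eqF.
  apply: le_trans (induced_dist_le hs miss Sp Sq) _; rewrite EFinM.
  have c0 : (0 <= (8 * Kcell : R)%:E)%E by rewrite lee_fin mulr_ge0// ltW.
  exact: (lee_wpmul2l c0 (eucl_geodesic p q)).
- move=> /(_ x y Sx Sy) e; rewrite e in dR; have := le_trans dR dg.
  by rewrite lee_fin; lra.
- exists x, y; split=> //.
    move=> xy; have := @vtx_dist R w k j; rewrite -/x -/y xy eucl_refl eq_sym => /(_ jk) e.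
    by rewrite -e ltxx in s0.
  have c0 : (0 <= (3 / 2 : R)%:E)%E by rewrite lee_fin divr_ge0.
  apply: le_trans (lee_wpmul2l c0 dg) _.
  by rewrite -EFinM.
Qed.
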